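(* There exists an absolute constant $C\ge 1$ such that the following holds. Let $(X_t)_{t=1}^n$ be an ergodic and reversible Markov chain on $[d]=\{1,\dots,d\}$ (with arbitrary initial distribution), with spectral gap $\gamma_\star$ and minimum stationary probability $\pi_\star>0$. Let $\hat\pi_\star=\hat\pi_\star((X_t)_{t=1}^n)$ and $\hat\gamma_\star=\hat\gamma_\star((X_t)_{t=1}^n)$ be the plug-in estimators defined in the context. For any $\delta\in(0,1)$, with probability at least $1-\delta$, \[ |\hat\pi_\star-\pi_\star|\ \le\ C\left(\sqrt{\frac{\pi_\star\log\frac{1}{\pi_\star\delta}}{\gamma_\star n}}+\frac{\log\frac{1}{\pi_\star\delta}}{\gamma_\star n}\right) \] and \[ |\hat\gamma_\star-\gamma_\star|\ \le\ C\sqrt{\frac{\log\frac{d}{\delta}\cdot\log\frac{n}{\pi_\star\delta}}{\pi_\star\gamma_\star n}} . \]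
   Context: Chain: $d\ge2$; $\boldsymbol{P}$ is the transition matrix of an ergodic (irreducible, aperiodic) chain on $[d]$ with unique stationary distribution $\boldsymbol{\pi}$ (all $\pi_i>0$), reversible: $\pi_iP_{i,j}=\pi_jP_{j,i}$. $\pi_\star=\min_i\pi_i$. The eigenvalues of $\boldsymbol{P}$ are real, $1=\lambda_1>\lambda_2\ge\dots\ge\lambda_d>-1$, and $\gamma_\star=1-\max\{\lambda_2,|\lambda_d|\}$. $\log$ is the logarithm in an arbitrary fixed constant base $>1$. Plug-in estimators: from a path $(X_1,\dots,X_n)$ set \[ \widehat M_{i,j}=\frac{|\{t\in[n-1]:(X_t,X_{t+1})=(i,j)\}|}{n-1},\qquad \hat\pi_i=\frac{|\{t\in[n]:X_t=i\}|}{n}\qquad(i,j\in[d]), \] $\widehat{\boldsymbol L}=\mathrm{Diag}(\hat{\boldsymbol\pi})^{-1/2}\widehat{\boldsymbol M}\,\mathrm{Diag}(\hat{\boldsymbol\pi})^{-1/2}$ and $\mathrm{Sym}(\widehat{\boldsymbol L})=\frac12(\widehat{\boldsymbol L}+\widehat{\boldsymbol L}^\top)$, with eigenvalues $\hat\lambda_1\ge\dots\ge\hat\lambda_d$. Then $\hat\pi_\star=\min_i\hat\pi_i$ and $\hat\gamma_\star=1-\min\{1,\max\{\hat\lambda_2,|\hat\lambda_d|\}\}\in[0,1]$. If some $\hat\pi_i=0$ (in particular if $n=1$), set $\hat\gamma_\star=0$. *)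

(* Defs.v *)
From HB Require Import structures.
From mathcomp Require Import all_boot all_order all_algebra.
From mathcomp Require Import all_classical all_reals all_analysis.
Set Implicit Arguments.
Unset Strict Implicit.
Unset Printing Implicit Defensive.
Import Order.TTheory GRing.Theory Num.Theory.
Local Open Scope classical_set_scope.
Local Open Scope ring_scope.

(* States are 0, ..., d - 1 (type 'I_d) and times are 0, ..., n - 1 instead of
   1, ..., d and 1, ..., n. A path of length n is the restriction to [0, n) of
   a function nat -> 'I_d; no definition below reads it at times >= n. *)

Definition logb (R : realType) (b x : R) : R := ln x / ln b.

Section Chains.
Variables (R : realType) (d : nat).
Implicit Types (P : 'M[R]_d) (pi : 'rV[R]_d).

Definition stochastic P : Prop :=
  (forall i j, 0 <= P i j) /\ (forall i, \sum_j P i j = 1).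

Definition irreducible P : Prop :=
  forall i j, exists k : nat, 0 < (P ^+ k) i j.

(* Every state has period 1: the only common divisor of its return times is 1. *)
Definition aperiodic P : Prop :=
  forall (i : 'I_d) (g : nat),
    (forall k : nat, (0 < k)%N -> 0 < (P ^+ k) i i -> (g %| k)%N) -> g = 1%N.

Definition ergodic P : Prop :=
  [/\ stochastic P, irreducible P & aperiodic P].

Definition stationary P pi : Prop :=
  [/\ forall i, 0 <= pi 0 i, \sum_i pi 0 i = 1 & pi *m P = pi].

Definition reversible P pi : Prop :=
  forall i j, pi 0 i * P i j = pi 0 j * P j i.

(* The minimum of a nonempty row whose entries are at most 1. *)
Definition min_entry pi : R := \big[Num.min/1]_(i < d) pi 0 i.

(* The eigenvalues of A with algebraic multiplicity, in nonincreasing order;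
   the value is [::] if the characteristic polynomial of A does not split
   over R. *)
Definition eigenvalues (A : 'M[R]_d) : seq R :=
  xget [::] [set l | sorted >=%R l /\
                     char_poly A = \prod_(x <- l) ('X - x%:P)].

Lemma eigenvaluesE (A : 'M[R]_d) (l : seq R) :
  sorted >=%R l -> char_poly A = \prod_(x <- l) ('X - x%:P) ->
  eigenvalues A = l.
Proof.
move=> sl Al; apply: xget_unique; first by split.
move=> l' [sl' Al']; apply: (sorted_eq ge_trans ge_anti sl' sl).
by rewrite prod_XsubC_eq // -Al' Al.
Qed.

Definition second_eigenvalue (A : 'M[R]_d) : R := (eigenvalues A)`_1.
Definition last_eigenvalue (A : 'M[R]_d) : R := (eigenvalues A)`_d.-1.

Definition spectral_gap P : R :=
  1 - Num.max (second_eigenvalue P) `|last_eigenvalue P|.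

End Chains.

Section MarkovChain.
Variables (R : realType) (d n : nat) (disp : measure_display).
Variables (Omega : measurableType disp) (Pr : probability Omega R).

Definition cylinder (X : nat -> Omega -> 'I_d) (x : nat -> 'I_d) (m : nat) :
  set Omega := [set w | forall t, (t < m)%N -> X t w = x t].

(* The Markov property is
     Pr(X_(t+1) = x_(t+1) | X_0 = x_0, ..., X_t = x_t) = P x_t x_(t+1),
   multiplied by the probability of the conditioning event.
   The law of X_0 is unrestricted. *)
Definition markov_chain (P : 'M[R]_d) (X : nat -> Omega -> 'I_d) : Prop :=
  (forall t i, (t < n)%N -> measurable (X t @^-1` [set i])) /\
  (forall t (x : nat -> 'I_d), (t.+1 < n)%N ->
    Pr (cylinder X x t.+2) =
      (Pr (cylinder X x t.+1) * (P (x t) (x t.+1))%:E)%E).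

End MarkovChain.

Section PlugIn.
Variables (R : realType) (d n : nat).
Implicit Types x : nat -> 'I_d.

Definition Mhat x : 'M[R]_d :=
  \matrix_(i, j)
    (#|[set t : 'I_n.-1 | (x t, x t.+1) == (i, j)]%SET|%:R / n.-1%:R).

Definition pihat x : 'rV[R]_d :=
  \row_i (#|[set t : 'I_n | x t == i]%SET|%:R / n%:R).

Definition Lhat x : 'M[R]_d :=
  let D := diag_mx (\row_i (Num.sqrt (pihat x 0 i))^-1) in
  D *m Mhat x *m D.

Definition Sym (A : 'M[R]_d) : 'M[R]_d := 2^-1 *: (A + A^T).

Definition pistar_hat x : R := min_entry (pihat x).

Definition gap_hat x : R :=
  if [exists i, pihat x 0 i == 0] then 0
  else 1 - Num.min 1 (Num.max (second_eigenvalue (Sym (Lhat x)))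
                              `|last_eigenvalue (Sym (Lhat x))|).

End PlugIn.

Arguments pistar_hat R {d} n x.
Arguments gap_hat R {d} n x.

(* Main.v *)
Require Import Defs.
From HB Require Import structures.
From mathcomp Require Import all_boot all_order all_algebra.
From mathcomp Require Import all_classical all_reals all_analysis.
From mathcomp Require perm spectral complex.
From mathcomp Require Import ring lra zify.
Import Order.TTheory GRing.Theory Num.Theory.
Local Open Scope classical_set_scope.
Local Open Scope ring_scope.

(** Let D be the diagonal matrix of the stationary distribution pi. Reversibility
makes L = D^(1/2) P D^(-1/2) symmetric; it has the eigenvalues of P, and its
eigenvector for the eigenvalue 1 is u = sqrt pi. The maximum principle shows
that 1 is a simple eigenvalue and that the other ones lie in (-1, 1), so that
0 < gap <= 1 ([Lsym_spectrum]) and |<x, L x>| <= gap <u, x>^2 + (1 - gap) |x|^2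
([Lsym_quad]).

Frequencies. The moment generating function of the number of visits to a state
i is, up to weights, a coordinate of the N-th power of Z^(1/2) L Z^(1/2) applied
to a fixed vector, where Z is diagonal with 1 + a at i and 1 elsewhere. By
[Lsym_quad] and a weighted Cauchy-Schwarz inequality the norm of this matrix is
at most 1 + pi_i a + 2 pi_i a^2 / gap
([tilted_kernel_qbound]), and Chernoff's method gives a Bernstein inequality for
all states at once ([frequency_deviation]). The initial law only costs a factor
1/pistar, which the logarithm absorbs. This is the first estimate up to passing
to minima ([min_entry_close]); it also says that all frequencies are within a
factor 1 + O(rate) of pi.

Spectral gap. Sym (Lhat) = G A G, where G is diagonal and close to 1 by the
frequency estimate, and A is the average, over the transitions (i, j) of the
path, of the symmetric matrices [pair_mx], whose mean under pi_i P_ij is L. By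
Weyl's inequality it suffices to bound the norm of A - L. Put
h of the order of log (n / pistar) / gap and split the transitions according to
their time modulo h + 1. Since (P^h)_ij <= (1 + 1/n) pi_j, the law of the
transitions in one residue class is at most (1 + 1/n)^n <= e times the law of
independent pairs ([sampled_pairs_domination]): domination replaces coupling,
and it holds from every starting state. For independent pairs the trace of the 2p-th
power of the centered sum is estimated by the method of exchangeable pairs
([exchangeable_pair_step], [iid_trace_moment]); here p is of the order of
log (d / delta). The matrix variance in this estimate is diagonal and consists
of visit counts, so it is controlled by scalar moments ([pair_weight_moment]).
The residue classes are combined inside the expectation of the traces, not by a
union bound, so no factor log h is lost ([matrix_concentration]). Finally, both
gaps lie in [0, 1], so the second estimate is only at stake when its right-hand
side is below 1, which is what makes n large enough for all choices of
parameters ([block_parameters]). *)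

Set Implicit Arguments.
Unset Strict Implicit.
Unset Printing Implicit Defensive.

(** * Diagonalization of real symmetric matrices *)

Section SpectralTheorem.
Import complex.
Variable R : rcfType.

Definition dotp d (x y : 'cV[R]_d) : R := \sum_i x i 0 * y i 0.

Section Dot.
Variable d : nat.
Implicit Types (x y z : 'cV[R]_d) (A : 'M[R]_d).

Lemma dotpE x y : dotp x y = (x^T *m y) 0 0.
Proof. by rewrite mxE; apply: eq_bigr => i _; rewrite mxE. Qed.

Lemma dotpC x y : dotp x y = dotp y x.
Proof. by apply: eq_bigr => i _; rewrite mulrC. Qed.

Lemma dotpDr x y z : dotp x (y + z) = dotp x y + dotp x z.
Proof. by rewrite -big_split; apply: eq_bigr => i _; rewrite mxE mulrDr. Qed.

Lemma dotpZr a x y : dotp x (a *: y) = a * dotp x y.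
Proof. by rewrite mulr_sumr; apply: eq_bigr => i _; rewrite mxE mulrCA. Qed.

Lemma dotpNr x y : dotp x (- y) = - dotp x y.
Proof. by rewrite -scaleN1r dotpZr mulN1r. Qed.

Lemma dotpBr x y z : dotp x (y - z) = dotp x y - dotp x z.
Proof. by rewrite dotpDr dotpNr. Qed.

Lemma dotpDl x y z : dotp (y + z) x = dotp y x + dotp z x.
Proof. by rewrite dotpC dotpDr !(dotpC x). Qed.

Lemma dotpZl a x y : dotp (a *: y) x = a * dotp y x.
Proof. by rewrite dotpC dotpZr (dotpC x). Qed.

Lemma dotpBl x y z : dotp (y - z) x = dotp y x - dotp z x.
Proof. by rewrite dotpC dotpBr !(dotpC x). Qed.

Lemma dotp0r x : dotp x 0 = 0.
Proof. by rewrite -(scale0r 0) dotpZr mul0r. Qed.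

Lemma dotp_sumr (I : Type) (r : seq I) (F : I -> 'cV[R]_d) x :
  dotp x (\sum_(i <- r) F i) = \sum_(i <- r) dotp x (F i).
Proof.
elim: r => [|i r IH]; first by rewrite !big_nil dotp0r.
by rewrite !big_cons dotpDr IH.
Qed.

Lemma dotp_mulmxr A x y : dotp x (A *m y) = dotp (A^T *m x) y.
Proof. by rewrite !dotpE trmx_mul trmxK mulmxA. Qed.

Lemma dotp_ge0 x : 0 <= dotp x x.
Proof. by apply: sumr_ge0 => i _; rewrite -expr2 sqr_ge0. Qed.

Lemma dotp_eq0 x : dotp x x = 0 -> x = 0.
Proof.
move=> /psumr_eq0P h; apply/matrixP => i j.
have /h/(_ i isT) /eqP : forall k : 'I_d, true -> 0 <= x k 0 * x k 0.
  by move=> k _; rewrite -expr2 sqr_ge0.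
by rewrite ord1 !mxE mulf_eq0 orbb => /eqP.
Qed.

Lemma dotp_gt0 x : x != 0 -> 0 < dotp x x.
Proof.
by move=> x0; rewrite lt0r dotp_ge0 andbT; apply: contra x0 => /eqP/dotp_eq0/eqP.
Qed.

Lemma Cauchy_Schwarz_dotp x y : dotp x y ^+ 2 <= dotp x x * dotp y y.
Proof.
have [->|y0] := eqVneq y 0; first by rewrite !dotp0r expr0n mulr0.
have yy := dotp_gt0 y0.
have := dotp_ge0 (dotp y y *: x - dotp x y *: y).
rewrite !(dotpBl, dotpBr, dotpZl, dotpZr) (dotpC y x).
set a := dotp x x; set b := dotp x y; set c := dotp y y => h.
have : 0 <= c * (a * c - b ^+ 2) by move: h; rewrite expr2; lra.
by rewrite pmulr_rge0 // subr_ge0.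
Qed.
End Dot.

(** A root c = a + b i of the characteristic polynomial over the complex numbers
has an eigenvector x + i y; symmetry of A gives b (|x|^2 + |y|^2) = 0, so c is
real and x or y is a real eigenvector. *)
Lemma symmetric_eigenvector n (A : 'M[R]_n.+1) : A^T = A ->
  exists (l : R) (v : 'cV[R]_n.+1), v != 0 /\ A *m v = l *: v.
Proof.
move=> sA.
pose f := fun x : R => x%:C%C.
have [c /eigenvalueP [v vA v0]] :=
  @spectral.eigenvalue_closed ((R[i])) _ (map_mx f A) (ltn0Sn n).
pose x : 'cV[R]_n.+1 := \col_i complex.Re (v 0 i).
pose y : 'cV[R]_n.+1 := \col_i complex.Im (v 0 i).
pose a := complex.Re c; pose b := complex.Im c.
have key i : \sum_j v 0 j * f (A j i) = c * v 0 i.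
  have := congr1 (fun M : 'rV_n.+1 => M 0 i) vA.
  by rewrite !mxE => <-; apply: eq_bigr => j _; rewrite !mxE.
have ReM (z : (R[i])) (r : R) : complex.Re (z * f r) = complex.Re z * r.
  by case: z => z1 z2 /=; rewrite mulr0 subr0.
have ImM (z : (R[i])) (r : R) : complex.Im (z * f r) = complex.Im z * r.
  by case: z => z1 z2 /=; rewrite mulr0 add0r.
have Ax : A *m x = a *: x - b *: y.
  apply/matrixP => i j; rewrite !mxE.
  have := congr1 (@complex.Re R) (key i).
  rewrite raddf_sum /=.
  have -> : complex.Re (c * v 0 i) = a * complex.Re (v 0 i) - b * complex.Im (v 0 i).
    by rewrite /a /b; case: (c) => ? ?; case: (v 0 i).
  move=> <-; apply: eq_bigr => k _; rewrite ReM !mxE mulrC.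
  by rewrite -[in LHS]sA mxE.
have Ay : A *m y = b *: x + a *: y.
  apply/matrixP => i j; rewrite !mxE.
  have := congr1 (@complex.Im R) (key i).
  rewrite raddf_sum /=.
  have -> : complex.Im (c * v 0 i) = b * complex.Re (v 0 i) + a * complex.Im (v 0 i).
    by rewrite /a /b addrC; case: (c) => ? ?; case: (v 0 i).
  move=> <-; apply: eq_bigr => k _; rewrite ImM !mxE mulrC.
  by rewrite -[in LHS]sA mxE.
have b0 : b * (dotp x x + dotp y y) = 0.
  have := dotp_mulmxr A y x; rewrite sA Ax Ay dotpBr dotpDl !(dotpZr, dotpZl).
  rewrite (dotpC y x); lra.
have nz : x != 0 \/ y != 0.
  case: (eqVneq x 0) => [x0|]; last by left.
  case: (eqVneq y 0) => [y0|]; last by right.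
  case/eqP: v0; apply/matrixP => i j; rewrite ord1 mxE.
  have := congr1 (fun M : 'cV_n.+1 => M j 0) x0.
  have := congr1 (fun M : 'cV_n.+1 => M j 0) y0.
  by rewrite !mxE; case: (v 0 j) => ? ? /= -> ->.
have b0' : b = 0.
  move/eqP: b0; rewrite mulf_eq0 => /orP[/eqP //|].
  rewrite paddr_eq0 ?dotp_ge0 // => /andP[/eqP/dotp_eq0 x0 /eqP/dotp_eq0 y0].
  by case: nz; rewrite ?x0 ?y0 eqxx.
exists a; case: nz => h; [exists x|exists y]; split => //.
- by rewrite Ax b0' scale0r subr0.
- by rewrite Ay b0' scale0r add0r.
Qed.

(** The Householder reflection along v - e, where e is the first basis vector. *)
Lemma reflection_exists n (v : 'cV[R]_n.+1) : dotp v v = 1 ->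
  exists Q : 'M[R]_n.+1,
    [/\ Q^T = Q, Q *m Q = 1%:M & Q *m delta_mx 0 0 = v].
Proof.
move=> v1; pose e : 'cV[R]_n.+1 := delta_mx 0 0.
have [->|ve] := eqVneq v e; first by exists 1%:M; rewrite trmx1 !mul1mx.
have dot_e x : dotp x e = x 0 0.
  rewrite /dotp (bigD1 0) //= mxE !eqxx mulr1 big1 ?addr0 // => i i0.
  by rewrite mxE (negPf i0) mulr0.
have [w wE] : exists w, w = v - e by exists (v - e).
pose c := dotp w w.
have c0 : c != 0 by rewrite gt_eqF // dotp_gt0 // wE subr_eq0.
have cE : c = 2 * (1 - v 0 0).
  rewrite /c wE !(dotpBl, dotpBr) v1 (dotpC e v) !dot_e mxE !eqxx /=; lra.
have wTw : w^T *m w = c%:M.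
  by apply/matrixP => i j; rewrite !ord1 -dotpE mxE.
have we : w^T *m e = (v 0 0 - 1)%:M.
  by apply/matrixP => i j; rewrite !ord1 -dotpE dot_e wE !mxE.
exists (1%:M - (2 / c) *: (w *m w^T)); split.
- by rewrite linearB /= trmx1 linearZ /= trmx_mul trmxK.
- rewrite mulmxBr mulmx1 mulmxBl mul1mx -scalemxAl -scalemxAr.
  rewrite mulmxA -(mulmxA w) wTw mul_mx_scalar -scalemxAl !scalerA.
  have -> : 2 / c * (2 / c * c) = 2 / c + 2 / c.
    by rewrite divfK //; field.
  by rewrite scalerDl opprB addrK subrK.
- rewrite mulmxBl mul1mx -scalemxAl -mulmxA we mul_mx_scalar scalerA.
  have -> : 2 / c * (v 0 0 - 1) = -1.
    have -> : v 0 0 - 1 = - c / 2 by rewrite cE; lra.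
    by field.
  by rewrite scaleN1r opprK wE addrC subrK.
Qed.

(** Induction on the size: conjugating by a reflection that sends the first
basis vector to a unit eigenvector splits off a 1 x 1 block. *)
Lemma symmetric_diagonalization n (A : 'M[R]_n) : A^T = A ->
  exists (U : 'M[R]_n) (D : 'rV[R]_n),
    U *m U^T = 1%:M /\ A = U^T *m diag_mx D *m U.
Proof.
elim: n A => [|n IH] A sA.
  by exists 1%:M, 0; split; apply/matrixP => -[].
have [l [v0 [v0n0 Av0]]] := symmetric_eigenvector sA.
pose v := (Num.sqrt (dotp v0 v0))^-1 *: v0.
have Av : A *m v = l *: v by rewrite /v -scalemxAr Av0 !scalerA mulrC.
have v1 : dotp v v = 1.
  have p := dotp_gt0 v0n0.
  rewrite /v dotpZl dotpZr mulrA -expr2 exprVn sqr_sqrtr ?ltW // mulVf //.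
  by rewrite gt_eqF.
have [Q [QT QQ Qe]] := reflection_exists v1.
pose B : 'M[R]_(1 + n) := Q *m A *m Q.
have BT : B^T = B by rewrite /B !trmx_mul QT sA mulmxA.
have Be : B *m delta_mx 0 0 = l *: delta_mx 0 (0 : 'I_1).
  rewrite /B -!mulmxA Qe Av -scalemxAr.
  by rewrite -[in LHS]Qe mulmxA QQ mul1mx.
have AE : A = Q *m B *m Q.
  by rewrite /B !mulmxA QQ mul1mx -mulmxA QQ mulmx1.
clearbody B.
have Bi i : B i 0 = l *+ (i == 0).
  have := congr1 (fun M : 'cV_n.+1 => M i 0) Be.
  by rewrite -colE !mxE eqxx andbT mulr_natr.
have B0 i : B 0 i = l *+ (i == 0) by rewrite -{1}BT mxE.
pose B' := drsubmx B.
have B'T : B'^T = B' by rewrite /B' trmx_drsub BT.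
have [U' [D' [U'U B'E]]] := IH B' B'T.
have BE : B = block_mx l%:M 0 0 B'.
  have l0 : lshift n (0 : 'I_1) = (0 : 'I_(1 + n)) by apply/val_inj.
  rewrite -[LHS]submxK; congr block_mx; apply/matrixP => i j;
    rewrite ?mxE ?ord1 ?l0 ?B0 ?Bi ?eqxx ?mulr1n ?mulr0n //.
pose W : 'M[R]_(1 + n) := block_mx 1%:M 0 0 U'.
have WT : W^T = block_mx 1%:M 0 0 U'^T by rewrite tr_block_mx trmx1 !trmx0.
pose D : 'rV[R]_(1 + n) := row_mx (l%:M : 'rV_1) D'.
have WW : W *m W^T = 1%:M.
  rewrite WT /W mulmx_block !(mul0mx, mulmx0, mul1mx, addr0, add0r) U'U.
  by rewrite -scalar_mx_block.
have WB : W^T *m diag_mx D *m W = B.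
  rewrite BE WT /W /D diag_mx_row !mulmx_block.
  rewrite !(mul0mx, mulmx0, mul1mx, mulmx1, addr0, add0r) -B'E.
  by congr block_mx; apply/matrixP => i j; rewrite !ord1 !mxE !eqxx.
exists (W *m Q), D; split.
  by rewrite trmx_mul QT mulmxA -(mulmxA W) QQ mulmx1.
by rewrite AE -WB trmx_mul QT !mulmxA.
Qed.
End SpectralTheorem.

(** * Quadratic forms and traces of powers *)

Section Diagonalized.
Variables (R : rcfType) (n : nat) (U : 'M[R]_n) (D : 'rV[R]_n).
Hypothesis UU : U *m U^T = 1%:M.

Lemma orthogonal_tr : U^T *m U = 1%:M.
Proof. exact: mulmx1C. Qed.

Lemma diagonalized_exp k :
  (U^T *m diag_mx D *m U) ^+ k = U^T *m diag_mx (\row_i D 0 i ^+ k) *m U.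
Proof.
elim: k => [|k IH].
  have -> : \row_i D 0 i ^+ 0 = const_mx 1.
    by apply/matrixP => i j; rewrite !mxE expr0.
  by rewrite diag_const_mx mulmx1 orthogonal_tr.
rewrite exprS IH -mulmxE !mulmxA; congr (_ *m _).
rewrite -(mulmxA _ U) UU mulmx1 -mulmxA mulmx_diag; congr (_ *m diag_mx _).
by apply/matrixP => i j; rewrite !mxE exprS.
Qed.

Lemma dotp_orthogonal x : dotp (U *m x) (U *m x) = dotp x x.
Proof. by rewrite dotp_mulmxr mulmxA orthogonal_tr mul1mx. Qed.

Lemma diagonalized_quad x :
  dotp x ((U^T *m diag_mx D *m U) *m x) = \sum_i D 0 i * (U *m x) i 0 ^+ 2.
Proof.
rewrite -!mulmxA dotp_mulmxr trmxK; apply: eq_bigr => i _.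
by rewrite mul_diag_mx !mxE expr2; ring.
Qed.

Lemma dotp_coord x : dotp x x = \sum_i (U *m x) i 0 ^+ 2.
Proof. by rewrite -dotp_orthogonal; apply: eq_bigr => i _; rewrite expr2. Qed.

Lemma diagonalized_trace : \tr (U^T *m diag_mx D *m U) = \sum_i D 0 i.
Proof. by rewrite mxtrace_mulC mulmxA UU mul1mx mxtrace_diag. Qed.

Lemma diagonalized_diag x :
  (U^T *m diag_mx D *m U) x x = \sum_i D 0 i * U i x ^+ 2.
Proof.
rewrite -mulmxA mxE; apply: eq_bigr => i _.
by rewrite mul_diag_mx !mxE expr2; ring.
Qed.

Lemma orthogonal_col x : \sum_i U i x ^+ 2 = 1.
Proof.
have := congr1 (fun M : 'M[R]_n => M x x) orthogonal_tr.
by rewrite !mxE eqxx => e; rewrite -[RHS]e; apply: eq_bigr => i _; rewrite mxE expr2.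
Qed.

Lemma diagonalized_sandwich (Q : 'M[R]_n) :
  \tr (Q *m (U^T *m diag_mx D *m U)) =
  \sum_i D 0 i * dotp (row i U)^T (Q *m (row i U)^T).
Proof.
rewrite mulmxA mxtrace_mulC !mulmxA; rewrite /mxtrace; apply: eq_bigr => i _.
rewrite mul_mx_diag mxE mulrC; congr (_ * _).
rewrite dotpE trmxK -mulmxA !mxE; apply: eq_bigr => j _.
by rewrite !mxE; congr (_ * _); apply: eq_bigr => k _; rewrite !mxE.
Qed.
End Diagonalized.

Section QuadraticBound.
Variables (R : rcfType) (n : nat).
Implicit Types (A B : 'M[R]_n) (x : 'cV[R]_n) (e : R).

(** For a symmetric matrix this says that its spectral norm is at most e. Only
quadratic forms are ever compared, so no norm is introduced. *)
Definition qbound A e := forall x, `|dotp x (A *m x)| <= e * dotp x x.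

Lemma qboundD A B e f : qbound A e -> qbound B f -> qbound (A + B) (e + f).
Proof.
move=> hA hB x; rewrite mulmxDl dotpDr mulrDl.
by rewrite (le_trans (ler_normD _ _)) // lerD.
Qed.

Lemma qboundZ a A e : qbound A e -> qbound (a *: A) (`|a| * e).
Proof.
by move=> hA x; rewrite -scalemxAl dotpZr normrM -mulrA ler_wpM2l.
Qed.

Lemma qboundN A e : qbound A e -> qbound (- A) e.
Proof. by move=> hA x; rewrite mulNmx dotpNr normrN. Qed.

Lemma qbound0 : qbound 0 0.
Proof. by move=> x; rewrite mul0mx dotp0r normr0 mul0r. Qed.

Lemma qbound_sum (I : Type) (r : seq I) (P : pred I) (F : I -> 'M[R]_n) (e : I -> R) :
  (forall i, P i -> qbound (F i) (e i)) ->
  qbound (\sum_(i <- r | P i) F i) (\sum_(i <- r | P i) e i).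
Proof.
move=> h; apply: (big_ind2 qbound) => //; first exact: qbound0.
by move=> *; apply: qboundD.
Qed.

Lemma qbound_le A e f : e <= f -> qbound A e -> qbound A f.
Proof. by move=> ef hA x; rewrite (le_trans (hA x)) // ler_wpM2r // dotp_ge0. Qed.

Lemma qbound_eigen (U : 'M[R]_n) D e : U *m U^T = 1%:M ->
  qbound (U^T *m diag_mx D *m U) e -> forall i, `|D 0 i| <= e.
Proof.
move=> UU hA i; have := hA (U^T *m delta_mx i 0).
rewrite diagonalized_quad (dotp_coord UU) mulmxA UU mul1mx.
rewrite (bigD1 i) //= big1 => [|j ji]; last by rewrite mxE (negPf ji) expr0n mulr0.
rewrite (bigD1 (P := xpredT) i) //= big1 => [|j ji]; last by rewrite mxE (negPf ji) expr0n.
by rewrite !addr0 mxE !eqxx expr1n !mulr1.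
Qed.

Lemma qbound_mulmx_sqr A e x : A^T = A -> qbound A e ->
  dotp (A *m x) (A *m x) <= e ^+ 2 * dotp x x.
Proof.
move=> sA; have [U [D [UU AE]]] := symmetric_diagonalization sA.
rewrite {1}AE => hA.
have -> : dotp (A *m x) (A *m x) = dotp x (A ^+ 2 *m x).
  by rewrite expr2 -mulmxE -mulmxA [RHS]dotp_mulmxr sA.
rewrite AE diagonalized_exp // diagonalized_quad (dotp_coord UU) mulr_sumr.
apply: ler_sum => i _; rewrite mxE ler_wpM2r ?sqr_ge0 //.
by rewrite -real_normK ?num_real // lerXn2r ?nnegrE ?normr_ge0 ?(qbound_eigen UU hA) //
  (le_trans (normr_ge0 _) (qbound_eigen UU hA i)).
Qed.

Lemma qbound_exp_sqr A e x k : A^T = A -> qbound A e ->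
  dotp (A ^+ k *m x) (A ^+ k *m x) <= e ^+ (2 * k) * dotp x x.
Proof.
move=> sA hA; elim: k => [|k IH]; first by rewrite muln0 !expr0 mul1mx mul1r.
rewrite exprS -mulmxE -mulmxA (le_trans (qbound_mulmx_sqr _ sA hA)) //.
by rewrite mulnS exprD -mulrA ler_wpM2l // sqr_ge0.
Qed.

(** An eigenvalue t satisfies |t| / e <= 1 + (t / e)^(2p), and t^(2p) is at most
the trace. This affine form of |t| <= (tr A^(2p))^(1/(2p)) needs no roots and can
be summed over several matrices. *)
Lemma qbound_trace_pow A e p : A^T = A -> 0 < e -> (0 < p)%N ->
  qbound A (e + e * (\tr (A ^+ (2 * p)) / e ^+ (2 * p))).
Proof.
move=> sA e0 p0; have [U [D [UU AE]]] := symmetric_diagonalization sA.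
rewrite AE diagonalized_exp // diagonalized_trace // => x.
rewrite diagonalized_quad (dotp_coord UU) mulr_sumr.
apply: (le_trans (ler_norm_sum _ _ _)); apply: ler_sum => i _.
rewrite normrM [X in _ * X]ger0_norm ?sqr_ge0 // ler_wpM2r ?sqr_ge0 //.
have D2 j : 0 <= D 0 j ^+ (2 * p) by rewrite exprM exprn_ge0 // sqr_ge0.
have h : `|D 0 i| <= e + e * (D 0 i ^+ (2 * p) / e ^+ (2 * p)).
  rewrite -[X in X + _]mulr1 -mulrDr -ler_pdivrMl // mulrC.
  have -> : D 0 i ^+ (2 * p) / e ^+ (2 * p) = (`|D 0 i| / e) ^+ (2 * p).
    by rewrite exprMn exprVn; congr (_ / _); rewrite !exprM real_normK ?num_real.
  set a := `|D 0 i| / e; have a0 : 0 <= a by rewrite divr_ge0 // ltW.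
  have [a1|/ltW a1] := lerP a 1; first by rewrite (le_trans a1) // lerDl exprn_ge0.
  by rewrite (@le_trans _ _ (a ^+ (2 * p))) ?lerDr // ler_eXnr // muln_gt0.
apply: (le_trans h); rewrite lerD2l ler_pM2l // ler_pM2r ?invr_gt0 ?exprn_gt0 //.
rewrite (bigD1 i) //= mxE lerDl; apply: sumr_ge0 => j _; by rewrite mxE.
Qed.

(** For nonnegative a and b the difference of the two sides is
(a^q - b^q) (a^r - b^r). *)
Lemma power_mean_exchange (a b : R) q r :
  a ^+ q * b ^+ r + a ^+ r * b ^+ q <= `|a| ^+ (q + r) + `|b| ^+ (q + r).
Proof.
have h (x y : R) : 0 <= x -> 0 <= y ->
    x ^+ q * y ^+ r + x ^+ r * y ^+ q <= x ^+ (q + r) + y ^+ (q + r).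
  move=> x0 y0; rewrite -subr_ge0 !exprD.
  have -> : x ^+ q * x ^+ r + y ^+ q * y ^+ r - (x ^+ q * y ^+ r + x ^+ r * y ^+ q) =
    (x ^+ q - y ^+ q) * (x ^+ r - y ^+ r) by ring.
  by case: (leP x y) => [xy|/ltW yx]; [apply: mulr_le0; rewrite subr_le0 lerXn2r|
    apply: mulr_ge0; rewrite subr_ge0 lerXn2r].
apply: le_trans (h _ _ (normr_ge0 a) (normr_ge0 b)).
by rewrite (le_trans (ler_norm _)) // (le_trans (ler_normD _ _)) // !normrM !normrX.
Qed.

(** The (i, j) entry of U H V^T is the matrix coefficient of H between the i-th
eigenvector of A and the j-th one of B. *)
Lemma trace_sandwich A B q r (H : 'M[R]_n) (U V : 'M[R]_n) D E :
  H^T = H ->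
  U *m U^T = 1%:M -> V *m V^T = 1%:M ->
  A = U^T *m diag_mx D *m U -> B = V^T *m diag_mx E *m V ->
  \tr (H *m A ^+ q *m H *m B ^+ r) =
    \sum_i \sum_j D 0 i ^+ q * E 0 j ^+ r * (U *m H *m V^T) i j ^+ 2.
Proof.
move=> sH UU VV -> ->; rewrite !diagonalized_exp //.
have [G GE] : exists G, G = U *m H *m V^T by eexists.
have GT : G^T = V *m H *m U^T by rewrite GE !trmx_mul trmxK sH mulmxA.
rewrite -GE.
rewrite (_ : _ *m _ = H *m U^T *m (diag_mx (\row_i D 0 i ^+ q) *m G *m
   diag_mx (\row_i E 0 i ^+ r)) *m V); last by rewrite GE !mulmxA.
rewrite mxtrace_mulC !mulmxA -GT.
rewrite exchange_big /= /mxtrace.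
apply: eq_bigr => j _; rewrite mul_mx_diag mxE [X in X * _]mxE mulr_suml.
by apply: eq_bigr => i _; rewrite mul_mx_diag !mxE expr2; ring.
Qed.

(** In eigenbases of A and B the trace becomes a sum of a^q b^(2s - q) with
nonnegative coefficients; pairing q with 2s - q reduces the claim to
[power_mean_exchange]. *)
Lemma Heinz_trace A B (H : 'M[R]_n) s : A^T = A -> B^T = B -> H^T = H ->
  \sum_(q < (2 * s).+1) \tr (H *m A ^+ q *m H *m B ^+ (2 * s - q)) <=
  (2 * s).+1%:R / 2 * \tr (H *m H *m (A ^+ (2 * s) + B ^+ (2 * s))).
Proof.
move=> sA sB sH.
have [U [D [UU AE]]] := symmetric_diagonalization sA.
have [V [E [VV BE]]] := symmetric_diagonalization sB.
have e0 (M : 'M[R]_n) : M ^+ 0 = 1%:M by rewrite expr0.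
have tA : \tr (H *m H *m A ^+ (2 * s)) =
    \sum_i \sum_j D 0 i ^+ (2 * s) * (U *m H *m V^T) i j ^+ 2.
  rewrite -mulmxA mxtrace_mulC -[X in \tr X]mulmx1 -(e0 B).
  rewrite (trace_sandwich _ _ sH UU VV AE BE).
  by apply: eq_bigr => i _; apply: eq_bigr => j _; rewrite expr0 mulr1.
have tB : \tr (H *m H *m B ^+ (2 * s)) =
    \sum_i \sum_j E 0 j ^+ (2 * s) * (U *m H *m V^T) i j ^+ 2.
  have -> : H *m H = H *m A ^+ 0 *m H by rewrite e0 mulmx1.
  rewrite (trace_sandwich _ _ sH UU VV AE BE).
  by apply: eq_bigr => i _; apply: eq_bigr => j _; rewrite expr0 mul1r.
rewrite mulmxDr mxtraceD tA tB -big_split /= mulr_sumr.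
under eq_bigr do rewrite (trace_sandwich _ _ sH UU VV AE BE).
rewrite exchange_big /=; apply: ler_sum => i _.
rewrite exchange_big /= -big_split /= mulr_sumr; apply: ler_sum => j _.
have := sqr_ge0 ((U *m H *m V^T) i j).
move: (_ ^+ 2) => g g0; rewrite -mulr_suml -mulrDl mulrA ler_wpM2r //.
set a := D 0 i; set b := E 0 j.
have even (y : R) : y ^+ (2 * s) = `|y| ^+ (2 * s).
  by rewrite !exprM real_normK ?num_real.
set S := \sum_(q < _) _.
suff : S + S <= (2 * s).+1%:R * (a ^+ (2 * s) + b ^+ (2 * s)) by lra.
rewrite {2}/S (reindex_inj rev_ord_inj) /= -big_split /=.
have -> : (2 * s).+1%:R = \sum_(q < (2 * s).+1) (1 : R) by rewrite sumr_const card_ord.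
rewrite mulr_suml; apply: ler_sum => q _; rewrite mul1r.
have qs : (q <= 2 * s)%N by rewrite -ltnS.
rewrite subSS subKn // (even a) (even b) -[in leRHS](subnKC qs).
exact: power_mean_exchange.
Qed.

Lemma trace_even_pow_ge0 A s : A^T = A -> 0 <= \tr (A ^+ (2 * s)).
Proof.
move=> sA; have [U [D [UU ->]]] := symmetric_diagonalization sA.
rewrite diagonalized_exp // diagonalized_trace //; apply: sumr_ge0 => i _.
by rewrite mxE exprM exprn_ge0 // sqr_ge0.
Qed.

(** An even power of A is positive semidefinite, so its trace against Q is a
nonnegative combination of values of the quadratic form of Q. *)
Lemma trace_even_pow_le A (Q B : 'M[R]_n) s : A^T = A ->
  (forall x, dotp x (Q *m x) <= dotp x (B *m x)) ->
  \tr (Q *m A ^+ (2 * s)) <= \tr (B *m A ^+ (2 * s)).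
Proof.
move=> sA h; have [U [D [UU AE]]] := symmetric_diagonalization sA.
rewrite AE diagonalized_exp // !diagonalized_sandwich //.
apply: ler_sum => i _; rewrite ler_wpM2l // mxE exprM exprn_ge0 ?sqr_ge0 //.
Qed.

(** Young's inequality with the exponents p + 1 and (p + 1) / p, in a form that
needs no roots. *)
Lemma Young_pow (u w : R) p : 0 <= u -> 0 <= w ->
  p.+1%:R * u * w ^+ p <= u ^+ p.+1 + p%:R * w ^+ p.+1.
Proof.
move=> u0 w0; elim: p => [|p IH]; first by rewrite expr0 mulr1 !mul1r expr1 mul0r addr0.
have := ler_wpM2r w0 IH.
have : 0 <= (u ^+ p.+1 - w ^+ p.+1) * (u - w).
  by case: (leP u w) => [xy|/ltW yx]; [apply: mulr_le0; rewrite subr_le0 ?lerXn2r|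
    apply: mulr_ge0; rewrite subr_ge0 ?lerXn2r].
rewrite -[p.+2%:R]natr1 -[p.+1%:R]natr1 !exprS.
set a := u ^+ p; set b := w ^+ p; lra.
Qed.

(** Young's inequality for every eigenvalue, weighted by the squared coordinates
of the x-th basis vector in the eigenbasis, which sum to 1. *)
Lemma Young_diag A p (v : R) (x : 'I_n) : A^T = A -> 0 <= v ->
  p.+1%:R * (v * (A ^+ (2 * p)) x x) <= v ^+ p.+1 + p%:R * (A ^+ (2 * p.+1)) x x.
Proof.
move=> sA v0; have [U [D [UU AE]]] := symmetric_diagonalization sA.
rewrite AE !diagonalized_exp // !diagonalized_diag.
have -> : v ^+ p.+1 = \sum_i v ^+ p.+1 * U i x ^+ 2.
  by rewrite -mulr_sumr (orthogonal_col UU) mulr1.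
rewrite !mulr_sumr -big_split /=.
apply: ler_sum => i _; rewrite !mxE.
have := ler_wpM2r (sqr_ge0 (U i x)) (@Young_pow v (D 0 i ^+ 2) p v0 (sqr_ge0 _)).
rewrite -!exprM; move: (D 0 i ^+ _) (D 0 i ^+ _) (U i x ^+ 2) (v ^+ _) => a b c f.
by lra.
Qed.
End QuadraticBound.

(** * Ordered eigenvalues and their perturbation *)

Section SortedSpectrum.
Import perm.
Variable R : realType.

Lemma char_poly_similar n (V W A : 'M[R]_n) : V *m W = 1%:M ->
  char_poly (V *m A *m W) = char_poly A.
Proof.
move=> VW; pose f (M : 'M[R]_n) := map_mx (@polyC R) M.
have VWp : f V *m f W = 1%:M by rewrite /f -map_mxM VW map_mx1.
have -> : char_poly (V *m A *m W) = \det (f V *m char_poly_mx A *m f W).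
  rewrite /char_poly /char_poly_mx; congr (\det _).
  rewrite mulmxBr mulmxBl /f !map_mxM; congr (_ - _).
  by rewrite scalar_mxC -mulmxA -/(f V) -/(f W) VWp mulmx1.
by rewrite !det_mulmx mulrAC -det_mulmx VWp det1 mul1r.
Qed.

(** The rows of the diagonalizing matrix are permuted in the order that sorts the
eigenvalues. *)
Lemma sorted_diagonalization n (A : 'M[R]_n) : A^T = A ->
  exists (U : 'M[R]_n) (l : seq R),
    [/\ U *m U^T = 1%:M, size l = n, sorted >=%R l &
        A = U^T *m diag_mx (\row_i l`_i) *m U].
Proof.
move=> /symmetric_diagonalization [U [D [UU AE]]].
pose t : n.-tuple R := [tuple D 0 i | i < n].
have sz : size (sort >=%R t) == n by rewrite size_sort size_tuple.
have /tuple_permP [s sE] : perm_eq (Tuple sz) t by rewrite perm_sort.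
have lE (i : 'I_n) : (sort >=%R t)`_i = D 0 (s i).
  have : sort >=%R t = [tuple tnth t (s i) | i < n] :> seq R by rewrite -sE.
  by move=> ->; rewrite -tnth_nth !tnth_mktuple.
exists (row_perm s U), (sort >=%R t); split.
- apply/matrixP => i j; have := congr1 (fun M : 'M[R]_n => M (s i) (s j)) UU.
  rewrite !mxE (inj_eq perm_inj) => <-; apply: eq_bigr => k _.
  by rewrite !mxE.
- exact/eqP.
- by apply: sort_sorted => x y; exact: le_total.
rewrite AE; apply/matrixP => i j; rewrite !mxE (reindex_inj (@perm_inj _ s)) /=.
by apply: eq_bigr => k _; rewrite !mul_mx_diag !mxE lE.
Qed.

Lemma eigenvalues_diagonalized n (U : 'M[R]_n) (l : seq R) :
  U *m U^T = 1%:M -> size l = n -> sorted >=%R l ->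
  eigenvalues (U^T *m diag_mx (\row_i l`_i) *m U) = l.
Proof.
move=> UU sl ls; apply: eigenvaluesE => //.
rewrite char_poly_similar; last exact: orthogonal_tr.
rewrite char_poly_trig; last exact: diag_mx_is_trig.
rewrite (big_nth 0) big_mkord sl; apply: eq_bigr => i _.
by rewrite !mxE eqxx.
Qed.

Lemma eigenvalues_similar n (V W A : 'M[R]_n) : V *m W = 1%:M ->
  eigenvalues (V *m A *m W) = eigenvalues A.
Proof. by move=> VW; rewrite /eigenvalues char_poly_similar. Qed.

Lemma sorted_ge_nth (l : seq R) i j : sorted >=%R l -> (i <= j)%N -> (j < size l)%N ->
  l`_j <= l`_i.
Proof.
move=> sl ij jl; have tr : transitive (>=%R : rel R) by move=> y x z xy yz; exact: le_trans yz xy.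
by apply: (sorted_leq_nth tr (@lexx _ _) 0 sl) => //; rewrite inE // (leq_ltn_trans ij).
Qed.

(** The eigenvector of B for its last eigenvalue is a test vector for A. *)
Lemma last_eigenvalue_perturb n (A B : 'M[R]_n.+1) e : A^T = A -> B^T = B ->
  qbound (A - B) e -> last_eigenvalue A <= last_eigenvalue B + e.
Proof.
move=> /sorted_diagonalization [U [l [UU sl ls AE]]].
move=> /sorted_diagonalization [V [m [VV sm ms BE]]] h.
rewrite /last_eigenvalue AE BE !eigenvalues_diagonalized // /=.
pose x := V^T *m delta_mx ord_max 0 : 'cV_n.+1.
have Vx : V *m x = delta_mx ord_max 0 by rewrite mulmxA VV mul1mx.
have sum_delta (F : 'I_n.+1 -> R) :
    \sum_i F i * (delta_mx ord_max 0 : 'cV[R]_n.+1) i 0 ^+ 2 = F ord_max.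
  rewrite (bigD1 ord_max) //= big1 => [|j jm]; last by rewrite mxE (negPf jm) expr0n mulr0.
  by rewrite mxE !eqxx expr1n mulr1 addr0.
have xx : dotp x x = 1.
  rewrite (dotp_coord VV) Vx -[RHS](sum_delta (fun _ => 1)).
  by apply: eq_bigr => i _; rewrite mul1r.
have Bx : dotp x (B *m x) = m`_n.
  by rewrite BE diagonalized_quad Vx (sum_delta (fun i => _ 0 i)) mxE.
have Ax : l`_n <= dotp x (A *m x).
  rewrite -[leLHS]mulr1 -xx (dotp_coord UU) AE diagonalized_quad mulr_sumr.
  apply: ler_sum => i _; rewrite ler_wpM2r ?sqr_ge0 // mxE.
  by apply: sorted_ge_nth => //; rewrite ?sl // -ltnS.
have := h x; rewrite xx mulr1 mulmxBl dotpBr Bx => /ler_normlP [_].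
by lra.
Qed.

(** The span of the two top eigenvectors of A contains a nonzero vector orthogonal
to the top eigenvector of B; this is the test vector. *)
Lemma second_eigenvalue_perturb n (A B : 'M[R]_n.+2) e : A^T = A -> B^T = B ->
  qbound (A - B) e -> second_eigenvalue A <= second_eigenvalue B + e.
Proof.
move=> /sorted_diagonalization [U [l [UU sl ls AE]]].
move=> /sorted_diagonalization [V [m [VV sm ms BE]]] h.
rewrite /second_eigenvalue AE BE !eigenvalues_diagonalized //.
pose i1 : 'I_n.+2 := lift ord0 ord0.
pose a0 := U^T *m delta_mx 0 0 : 'cV_n.+2.
pose a1 := U^T *m delta_mx i1 0 : 'cV_n.+2.
have [c0 [c1 [cn0 Vc]]] : exists c0 c1, 0 < c0 ^+ 2 + c1 ^+ 2 /\
    (V *m (c0 *: a0 + c1 *: a1)) 0 0 = 0.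
  pose p := (V *m a0) 0 0; pose q := (V *m a1) 0 0.
  have E c0 c1 : (V *m (c0 *: a0 + c1 *: a1)) 0 0 = c0 * p + c1 * q.
    by rewrite mulmxDr -!scalemxAr mxE [X in X + _]mxE [X in _ + X]mxE.
  have [p0|p0] := eqVneq p 0.
    by exists 1, 0; rewrite E p0; split; [lra|ring].
  exists (- q), p; rewrite E; split; last by ring.
  by rewrite ltr_wpDl ?sqr_ge0 // exprn_even_gt0.
set x := c0 *: a0 + c1 *: a1 in Vc.
have Ux : U *m x = c0 *: delta_mx 0 0 + c1 *: delta_mx i1 0.
  by rewrite /x mulmxDr -!scalemxAr !mulmxA UU !mul1mx.
have sum_delta (F : 'I_n.+2 -> R) :
    \sum_i F i * (U *m x) i 0 ^+ 2 = F 0 * c0 ^+ 2 + F i1 * c1 ^+ 2.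
  rewrite Ux (bigD1 0) //= (bigD1 i1) //= big1 => [|j /andP[j0 j1]].
    by rewrite !mxE !eqxx /= addr0; congr (_ * _ + _ * _); ring.
  by rewrite !mxE (negPf j0) (negPf j1) !mulr0 addr0 expr0n mulr0.
have xx : dotp x x = c0 ^+ 2 + c1 ^+ 2.
  rewrite (dotp_coord UU) -[c0 ^+ 2]mul1r -[c1 ^+ 2]mul1r -(sum_delta (fun _ => 1)).
  by apply: eq_bigr => i _; rewrite mul1r.
have x0 : 0 < dotp x x by rewrite xx.
have Ax : l`_1 * dotp x x <= dotp x (A *m x).
  rewrite AE diagonalized_quad (sum_delta (fun i => _ 0 i)) !mxE xx mulrDr /= lerD2r.
  by rewrite ler_wpM2r ?sqr_ge0 // sorted_ge_nth // sl.
have Bx : dotp x (B *m x) <= m`_1 * dotp x x.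
  rewrite BE diagonalized_quad (dotp_coord VV) mulr_sumr.
  apply: ler_sum => i _; have [->|i0] := eqVneq i 0.
    by rewrite Vc expr0n !mulr0.
  rewrite ler_wpM2r ?sqr_ge0 // mxE sorted_ge_nth ?sm ?ltn_ord // lt0n.
  by apply: contra i0 => /eqP i0; apply/eqP/val_inj.
have := h x; rewrite mulmxBl dotpBr => /ler_normlP [_ hx].
rewrite -(ler_pM2r x0) mulrDl; lra.
Qed.

End SortedSpectrum.

(** * The spectrum of an ergodic reversible chain *)

Section Chain.
Variables (R : realType) (d : nat) (P : 'M[R]_d) (pi : 'rV[R]_d).
Hypothesis sto : stochastic P.
Hypothesis irr : irreducible P.
Hypothesis aper : aperiodic P.
Hypothesis stat : stationary P pi.
Hypothesis rev : reversible P pi.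
Hypothesis d2 : (2 <= d)%N.

Lemma stochastic_ge0 i j : 0 <= P i j. Proof. by case: sto. Qed.
Lemma stochastic_row_sum i : \sum_j P i j = 1. Proof. by case: sto. Qed.

Lemma stochastic_exp_ge0 k i j : 0 <= (P ^+ k) i j.
Proof.
elim: k i j => [|k IH] i j; first by rewrite expr0 mxE ler0n.
by rewrite exprS mxE; apply: sumr_ge0 => l _; rewrite mulr_ge0 ?stochastic_ge0.
Qed.

Lemma stochastic_exp_row_sum k i : \sum_j (P ^+ k) i j = 1.
Proof.
elim: k i => [|k IH] i.
  rewrite expr0 (bigD1 i) //= mxE eqxx big1 ?addr0 // => j ji.
  by rewrite mxE eq_sym (negPf ji).
under eq_bigr do rewrite exprS mxE.
rewrite exchange_big /= -(stochastic_row_sum i); apply: eq_bigr => j _.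
by rewrite -mulr_sumr IH mulr1.
Qed.

Lemma stationary_exp k : pi *m P ^+ k = pi.
Proof.
case: stat => _ _ h; elim: k => [|k IH]; first by rewrite expr0 mulmx1.
by rewrite exprS -mulmxE mulmxA h.
Qed.

Lemma stationary_sum1 : \sum_i pi 0 i = 1. Proof. by case: stat. Qed.
Lemma stationary_ge0 i : 0 <= pi 0 i. Proof. by case: stat. Qed.

Lemma stationary_gt0 i : 0 < pi 0 i.
Proof.
rewrite lt0r stationary_ge0 andbT; apply/eqP => pi0.
have : \sum_i pi 0 i = 0.
  rewrite big1 // => j _; have [k jk] := irr j i.
  have := congr1 (fun M : 'rV[R]_d => M 0 i) (stationary_exp k).
  rewrite mxE pi0 => /psumr_eq0P h.
  have /eqP : pi 0 j * (P ^+ k) j i = 0.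
    by apply: h => // l _; rewrite mulr_ge0 ?stochastic_exp_ge0 ?stationary_ge0.
  by rewrite mulf_eq0 (gt_eqF jk) orbF => /eqP.
by rewrite stationary_sum1 => /eqP; rewrite oner_eq0.
Qed.

Lemma stationary_le1 i : pi 0 i <= 1.
Proof.
by rewrite -stationary_sum1 (bigD1 i) //= lerDl; apply: sumr_ge0 => j _; exact: stationary_ge0.
Qed.

Local Notation pistar := (min_entry pi).

Lemma min_entry_le i : pistar <= pi 0 i.
Proof. by rewrite /min_entry (bigD1 i) //= ge_min lexx. Qed.

(** The default value 1 of the minimum is itself attained when it is the minimum,
because all entries are at most 1. *)
Lemma min_entry_attained (r : 'rV[R]_d) : (forall i, r 0 i <= 1) ->
  exists i, min_entry r = r 0 i.
Proof.
move=> r1; have i0 : 'I_d by apply: (@Ordinal d 0); rewrite (leq_trans _ d2).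
have h : min_entry r = 1 \/ exists i, min_entry r = r 0 i.
  rewrite /min_entry; elim/big_rec: _ => [|i x _ [->|[j ->]]]; first by left.
    by right; exists i; apply/min_idPl.
  by right; case: leP => _; [exists i|exists j].
case: h => // h; exists i0; apply/eqP; rewrite eq_le h r1 andbT.
by rewrite -h /min_entry (bigD1 i0) //= ge_min lexx.
Qed.

Lemma stationary_min_gt0 : 0 < pistar.
Proof. by have [i ->] := min_entry_attained stationary_le1; exact: stationary_gt0. Qed.

Lemma stationary_min_card : pistar * d%:R <= 1.
Proof.
rewrite -[leRHS]stationary_sum1 mulr_natr -[d in _ *+ d]card_ord -sumr_const; apply: ler_sum => i _.
exact: min_entry_le.
Qed.

Lemma stationary_min_le_half : pistar <= 2^-1.
Proof.
rewrite -[leRHS]mul1r ler_pdivlMr // (le_trans _ stationary_min_card) // ler_wpM2l ?ler_nat //.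
exact: ltW stationary_min_gt0.
Qed.

Lemma eigenfunction_exp k c (f : 'cV[R]_d) : P *m f = c *: f -> (P ^+ k) *m f = c ^+ k *: f.
Proof.
move=> h; elim: k => [|k IH]; first by rewrite !expr0 mul1mx scale1r.
by rewrite exprS -mulmxE -mulmxA IH -scalemxAr h scalerA exprSr.
Qed.

Lemma norm_argmax (f : 'cV[R]_d) : f != 0 ->
  exists i, f i 0 != 0 /\ forall j, `|f j 0| <= `|f i 0|.
Proof.
move=> f0; have i0 : 'I_d by apply: (@Ordinal d 0); rewrite (leq_trans _ d2).
case: (@Order.TotalTheory.arg_maxP _ R 'I_d i0 xpredT (fun i => `|f i 0|) isT) => i _ h.
exists i; split; last by move=> j; exact: h.
apply: contra f0 => /eqP fi; apply/eqP/matrixP => j k; rewrite ord1 mxE.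
by apply/eqP; rewrite -normr_le0 (le_trans (h j isT)) // fi normr0.
Qed.

Lemma eigenvalue_le1 c (f : 'cV[R]_d) : f != 0 -> P *m f = c *: f -> `|c| <= 1.
Proof.
move=> /norm_argmax [i [fi h]] Pf.
have := congr1 (fun M : 'cV[R]_d => `|M i 0|) Pf.
rewrite !mxE normrM => e; have := @ler_pM2r _ `|f i 0| _ `|c| 1.
rewrite normr_gt0 => <- //; rewrite mul1r -e (le_trans (ler_norm_sum _ _ _)) //.
rewrite -[leRHS]mul1r -(stochastic_row_sum i) mulr_suml; apply: ler_sum => j _.
by rewrite normrM ger0_norm ?stochastic_ge0 // ler_wpM2l ?stochastic_ge0.
Qed.

(** The maximum principle for P^k at a point i where |f| is maximal: c^k f(i) is an
average of values of f, and all of them are at most |f(i)| in absolute value.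
The case c = 1 meets irreducibility, the case c = -1 aperiodicity. *)
Lemma eigenfunction_maximum c (f : 'cV[R]_d) i j k : c ^+ 2 = 1 -> P *m f = c *: f ->
  (forall j, `|f j 0| <= `|f i 0|) -> 0 < (P ^+ k) i j -> f j 0 = c ^+ k * f i 0.
Proof.
move=> c1 Pf h Pk.
have cN : `|c| = 1.
  by apply/eqP; rewrite -(@eqrXn2 _ 2) ?normr_ge0 // real_normK ?num_real // c1 expr1n.
(* the sign s makes s * f maximal, not only its absolute value *)
pose s := Num.sg (c ^+ k * f i 0).
have ss : s * (c ^+ k * f i 0) = `|f i 0|.
  by rewrite /s -[RHS]mul1r -[in 1](expr1n _ k) -cN -normrX -normrM -normrEsg.
have sle j' : s * f j' 0 <= `|f i 0|.
  rewrite (le_trans _ (h j')) // (le_trans (ler_norm _)) // normrM.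
  by rewrite -[leRHS]mul1r ler_wpM2r // normr_sg; case: (_ == _).
have : \sum_j (P ^+ k) i j * (`|f i 0| - s * f j 0) = 0.
  under eq_bigr do rewrite mulrBr.
  rewrite sumrB -mulr_suml stochastic_exp_row_sum mul1r.
  have := congr1 (fun M : 'cV[R]_d => M i 0) (eigenfunction_exp k Pf).
  rewrite !mxE => e; under eq_bigr do rewrite mulrCA.
  by rewrite -mulr_sumr e ss subrr.
move=> /psumr_eq0P/(_ j isT) e.
have /eqP : (P ^+ k) i j * (`|f i 0| - s * f j 0) = 0.
  by apply: e => j' _; rewrite mulr_ge0 ?stochastic_exp_ge0 // subr_ge0.
rewrite mulf_eq0 gt_eqF //= -ss subr_eq0 => /eqP.
have [f0|f0] := eqVneq (f i 0) 0.
  move=> _; rewrite f0 mulr0; apply/eqP; rewrite -normr_le0 (le_trans (h j)) //.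
  by rewrite f0 normr0.
have s0 : s != 0.
  by rewrite sgr_eq0 mulf_neq0 // expf_neq0 // -normr_eq0 cN oner_eq0.
by move/(mulfI s0).
Qed.

Lemma eigenfunction1_const (f : 'cV[R]_d) : P *m f = f -> forall i j, f i 0 = f j 0.
Proof.
move=> Pf; have [->|f0] := eqVneq f 0; first by move=> i j; rewrite !mxE.
have [i [fi h]] := norm_argmax f0.
suff e j : f j 0 = f i 0 by move=> j k; rewrite !e.
have [k ik] := irr i j.
rewrite (@eigenfunction_maximum 1 f i j k) ?expr1n ?mul1r //.
by rewrite scale1r.
Qed.

(** An eigenfunction for -1 changes sign at every step, so every return time of a
point where |f| is maximal is even, which contradicts aperiodicity. *)
Lemma eigenvalue_neqN1 (f : 'cV[R]_d) : f != 0 -> P *m f <> - f.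
Proof.
move=> /norm_argmax [i [fi h]] Pf.
suff : 2 = 1%N by [].
apply: (aper (i := i)) => k _ ii.
have : f i 0 = (-1) ^+ k * f i 0.
  by apply: eigenfunction_maximum h ii; rewrite ?sqrrN ?expr1n ?scaleN1r.
rewrite dvdn2 -signr_odd; case: (odd k) => //=; rewrite expr1 mulN1r => /eqP.
by rewrite -subr_eq0 opprK -mulr2n mulrn_eq0 /= (negPf fi).
Qed.

(** D^(1/2) P D^(-1/2), the matrix of P in an orthonormal basis of L^2(pi). *)
Definition Lsym : 'M[R]_d :=
  \matrix_(i, j) (Num.sqrt (pi 0 i) * P i j / Num.sqrt (pi 0 j)).
Definition sqrtpi : 'cV[R]_d := \col_i Num.sqrt (pi 0 i).

Lemma sqrtpi_gt0 i : 0 < Num.sqrt (pi 0 i).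
Proof. by rewrite sqrtr_gt0 stationary_gt0. Qed.

Lemma sqrtpi_neq0 i : Num.sqrt (pi 0 i) != 0.
Proof. by rewrite gt_eqF // sqrtpi_gt0. Qed.

Lemma sqrtpi_sqr i : Num.sqrt (pi 0 i) ^+ 2 = pi 0 i.
Proof. by rewrite sqr_sqrtr // stationary_ge0. Qed.

Lemma Lsym_sym : Lsym^T = Lsym.
Proof.
apply/matrixP => i j; rewrite !mxE.
have := rev i j; rewrite -[in LHS]sqrtpi_sqr -[in RHS]sqrtpi_sqr !expr2.
have := sqrtpi_neq0 i; have := sqrtpi_neq0 j.
set a := Num.sqrt _; set b := Num.sqrt (pi 0 i) => a0 b0 e.
apply: (mulfI a0); apply: (mulfI b0).
transitivity (a * a * P j i); first by field.
by rewrite -e; field.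
Qed.

Lemma sqrtpi_norm1 : dotp sqrtpi sqrtpi = 1.
Proof.
by rewrite -stationary_sum1; apply: eq_bigr => i _; rewrite !mxE -expr2 sqrtpi_sqr.
Qed.

Lemma Lsym_sqrtpi : Lsym *m sqrtpi = sqrtpi.
Proof.
apply/matrixP => i j; rewrite !mxE -[RHS]mulr1 -(stochastic_row_sum i) mulr_sumr.
by apply: eq_bigr => k _; rewrite !mxE divfK // sqrtpi_neq0.
Qed.

Lemma Lsym_similar : eigenvalues P = eigenvalues Lsym.
Proof.
pose V := diag_mx (\row_i Num.sqrt (pi 0 i)).
pose W := diag_mx (\row_i (Num.sqrt (pi 0 i))^-1).
have VW : V *m W = 1%:M.
  apply/matrixP => i j; rewrite mulmx_diag !mxE.
  by case: eqP => // _; rewrite divff ?sqrtpi_neq0.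
rewrite -(eigenvalues_similar P VW); congr eigenvalues.
by apply/matrixP => i j; rewrite mul_mx_diag mxE mul_diag_mx !mxE.
Qed.

Lemma Lsym_eigenfunction c (x : 'cV[R]_d) : Lsym *m x = c *: x ->
  P *m (\col_i (x i 0 / Num.sqrt (pi 0 i))) = c *: \col_i (x i 0 / Num.sqrt (pi 0 i)).
Proof.
move=> e; apply/matrixP => i j; rewrite ord1 !mxE.
have := congr1 (fun M : 'cV[R]_d => M i 0) e; rewrite !mxE => e'.
apply: (mulfI (sqrtpi_neq0 i)); rewrite mulr_sumr.
rewrite [RHS]mulrC mulrA divfK ?sqrtpi_neq0 // -e'; apply: eq_bigr => k _.
by rewrite !mxE; field; exact: sqrtpi_neq0.
Qed.

Local Notation lam := (1 - spectral_gap P).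

(** An eigenvector of L divided by sqrt pi is an eigenfunction of P, so the
maximum principle confines the spectrum. The top eigenvector is sqrt pi up to
its sign, on which the two clauses about the row i0 of U do not depend. *)
Lemma Lsym_spectrum : exists (U : 'M[R]_d) (l : seq R) (i0 : 'I_d),
  [/\ U *m U^T = 1%:M, Lsym = U^T *m diag_mx (\row_i l`_i) *m U, l`_i0 = 1,
      (forall i, i != i0 -> `|l`_i| <= lam) &
      (forall x : 'cV[R]_d, (U *m x) i0 0 ^+ 2 = dotp sqrtpi x ^+ 2) ] /\
  (0 <= lam < 1 /\ forall x y, U i0 x * U i0 y = sqrtpi x 0 * sqrtpi y 0).
Proof.
have [U [l [UU sl ls LE]]] := sorted_diagonalization Lsym_sym.
have eE : eigenvalues P = l.
  by rewrite Lsym_similar LE eigenvalues_diagonalized.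
pose x (i : 'I_d) : 'cV[R]_d := U^T *m delta_mx i 0.
have Ux i : U *m x i = delta_mx i 0 by rewrite mulmxA UU mul1mx.
have xL (i : 'I_d) : Lsym *m x i = l`_i *: x i.
  rewrite LE -mulmxA Ux -mulmxA; rewrite /x scalemxAr; congr (_ *m _).
  by apply/matrixP => j k; rewrite mul_diag_mx !mxE; case: eqP => [->|_] /=; rewrite ?mulr0.
have xx i j : dotp (x i) (x j) = (i == j)%:R.
  rewrite dotp_mulmxr trmxK Ux /dotp (bigD1 j) //= big1 => [|k kj]; last by rewrite [X in _ * X]mxE (negPf kj) mulr0.
  by rewrite !mxE !eqxx andbT mulr1 addr0 eq_sym.
have x0 i : x i != 0.
  by apply/eqP => xi; have := xx i i; rewrite xi dotp0r eqxx => /esym/eqP; rewrite oner_eq0.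
pose f (i : 'I_d) : 'cV[R]_d := \col_j (x i j 0 / Num.sqrt (pi 0 j)).
have f0 i : f i != 0.
  apply: contra (x0 i) => /eqP fi; apply/eqP/matrixP => j k; rewrite ord1.
  have := congr1 (fun M : 'cV[R]_d => M j 0) fi; rewrite !mxE => /eqP.
  by rewrite mulf_eq0 invr_eq0 (negPf (sqrtpi_neq0 _)) orbF => /eqP.
have Pf (i : 'I_d) : P *m f i = l`_i *: f i by apply: Lsym_eigenfunction.
have l1 (i : 'I_d) : `|l`_i| <= 1 by apply: eigenvalue_le1 (f0 i) (Pf i).
have lN1 (i : 'I_d) : l`_i != -1.
  by apply/eqP => li; apply: (eigenvalue_neqN1 (f0 i)); rewrite Pf li scaleN1r.
have one (i : 'I_d) : l`_i = 1 -> exists c, x i = c *: sqrtpi.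
  move=> li; have := Pf i; rewrite li scale1r => /eigenfunction1_const h.
  have k0 : 'I_d by apply: (@Ordinal d 0); rewrite (leq_trans _ d2).
  exists (f i k0 0); apply/matrixP => j k; rewrite ord1 [RHS]mxE (h k0 j).
  have -> : f i j 0 = x i j 0 / Num.sqrt (pi 0 j) by rewrite mxE.
  have -> : sqrtpi j 0 = Num.sqrt (pi 0 j) by rewrite mxE.
  by rewrite divfK // sqrtpi_neq0.
have d0 : (0 < d)%N by apply: leq_trans d2.
pose i0 := Ordinal d0.
have l01 : l`_i0 = 1.
  have [i ui] : exists i : 'I_d, (U *m sqrtpi) i 0 != 0.
    apply/existsP; rewrite -negb_forall; apply/negP => /forallP h.
    have := sqrtpi_norm1; rewrite (dotp_coord UU) big1 => [/esym/eqP|i _].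
      by rewrite oner_eq0.
    by rewrite (eqP (h i)) expr0n.
  have li : l`_i = 1.
    have := congr1 (fun M : 'cV[R]_d => (U *m M) i 0) Lsym_sqrtpi.
    have -> : U *m (Lsym *m sqrtpi) = diag_mx (\row_i l`_i) *m (U *m sqrtpi).
      by rewrite LE !mulmxA UU mul1mx.
    by rewrite mul_diag_mx mxE mxE => e; apply: (mulIf ui); rewrite mul1r.
  apply/eqP; rewrite eq_le (le_trans (ler_norm _) (l1 i0)) /= -{1}li.
  by rewrite sorted_ge_nth // sl.
have l_lt1 (i : 'I_d) : i != i0 -> l`_i < 1.
  move=> ii; rewrite lt_neqAle (le_trans (ler_norm _) (l1 i)) andbT; apply/eqP => li.
  have [c xi] := one i li; have [c' xi'] := one i0 l01.
  have := xx i i0; rewrite (negPf ii) xi xi' dotpZl dotpZr sqrtpi_norm1 mulr1.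
  move/eqP; rewrite mulf_eq0 => /orP[] /eqP c0.
    by have := x0 i; rewrite xi c0 scale0r eqxx.
  by have := x0 i0; rewrite xi' c0 scale0r eqxx.
have l_lt (i : 'I_d) : i != i0 -> `|l`_i| < 1.
  move=> ii; rewrite ltr_norml l_lt1 // andbT lt_neqAle eq_sym lN1 /=.
  by have := l1 i; rewrite ler_norml => /andP[].
have lamE : lam = Num.max l`_1 `|l`_d.-1|.
  by rewrite /spectral_gap /second_eigenvalue /last_eigenvalue eE opprB addrC subrK.
exists U, l, i0; split; [split => //|split].
- move=> i ii; rewrite lamE ler_norml; apply/andP; split.
    rewrite lerNl le_max; apply/orP; right; rewrite -normrN (le_trans _ (ler_norm _)) // lerN2.
    by rewrite sorted_ge_nth ?sl ?prednK // -ltnS prednK.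
  rewrite le_max; apply/orP; left; rewrite sorted_ge_nth ?sl // lt0n.
  by apply: contra ii => /eqP h; apply/eqP/val_inj.
- move=> y; have [c xi] := one i0 l01.
  have cc : c ^+ 2 = 1.
    by have := xx i0 i0; rewrite eqxx xi dotpZl dotpZr sqrtpi_norm1 mulr1 expr2.
  have -> : (U *m y) i0 0 = dotp (x i0) y.
    rewrite /x dotpC dotp_mulmxr trmxK /dotp (bigD1 i0) //= big1 => [|k kj]; last by rewrite [X in _ * X]mxE (negPf kj) mulr0.
    by rewrite [X in _ * X + _]mxE !eqxx mulr1 addr0.
  by rewrite xi dotpZl exprMn cc mul1r.
- rewrite lamE le_max normr_ge0 orbT /= gt_max.
  have d1 : (1 < d)%N by [].
  have dl : (d.-1 < d)%N by rewrite prednK.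
  rewrite (l_lt1 (Ordinal d1)) //= (l_lt (Ordinal dl)) //.
  by rewrite -val_eqE /= -lt0n -subn1 subn_gt0.
- move=> y z; have [c xi] := one i0 l01.
  have cc : c * c = 1.
    by have := xx i0 i0; rewrite eqxx xi dotpZl dotpZr sqrtpi_norm1 mulr1.
  have Ui w : U i0 w = c * sqrtpi w 0.
    have -> : U i0 w = x i0 w 0 by rewrite /x -colE !mxE.
    by rewrite xi mxE.
  by rewrite !Ui mulrACA cc mul1r.
Qed.

Lemma subgap_itv : 0 <= lam < 1.
Proof. by have [U [l [i0 [_ []]]]] := Lsym_spectrum. Qed.

Lemma gap_itv : 0 < spectral_gap P <= 1.
Proof. have /andP[? ?] := subgap_itv; apply/andP; split; lra. Qed.

(** The quadratic form of L is dominated by that of gap u u^T + (1 - gap) I, the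
symmetrization of the chain that forgets its state with probability gap at each
step (the Leon-Perron chain). *)
Lemma Lsym_quad (x : 'cV[R]_d) :
  `|dotp x (Lsym *m x)| <= (1 - lam) * dotp sqrtpi x ^+ 2 + lam * dotp x x.
Proof.
have [U [l [i0 [[UU LE l1 ll Ux] _]]]] := Lsym_spectrum.
rewrite LE diagonalized_quad (dotp_coord UU) -Ux (bigD1 i0) //= mxE l1 mul1r.
rewrite [X in _ <= _ + _ * X](bigD1 i0) //= mulrDr addrA -mulrDl subrK mul1r.
rewrite (le_trans (ler_normD _ _)) // ger0_norm ?sqr_ge0 // lerD2l.
rewrite (le_trans (ler_norm_sum _ _ _)) // mulr_sumr; apply: ler_sum => i ii.
by rewrite normrM (ger0_norm (sqr_ge0 _)) mxE ler_wpM2r ?sqr_ge0 // ll.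
Qed.

Lemma Lsym_qbound : qbound Lsym 1.
Proof.
move=> x; rewrite mul1r (le_trans (Lsym_quad x)) //.
have := Cauchy_Schwarz_dotp sqrtpi x; rewrite sqrtpi_norm1 mul1r => h.
have /andP[l0 l1] := subgap_itv.
have : (1 - lam) * dotp sqrtpi x ^+ 2 <= (1 - lam) * dotp x x by rewrite ler_wpM2l //; lra.
by lra.
Qed.

Lemma Lsym_exp k i j :
  (Lsym ^+ k) i j = Num.sqrt (pi 0 i) * (P ^+ k) i j / Num.sqrt (pi 0 j).
Proof.
elim: k i j => [|k IH] i j.
  rewrite !expr0 !mxE; case: eqP => [->|_]; last by rewrite mulr0 mul0r.
  by rewrite mulr1 divff // sqrtpi_neq0.
rewrite !exprS !mxE mulr_sumr mulr_suml; apply: eq_bigr => h _.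
by rewrite IH !mxE; field; rewrite !sqrtpi_neq0.
Qed.

(** Off the top eigenvector the k-th power of L has norm at most (1 - gap)^k; the
weights sqrt pi turn this into a relative error with a factor 1/pistar. *)
Lemma transition_le_stationary k i j : (P ^+ k) i j <= pi 0 j * (1 + lam ^+ k / pistar).
Proof.
have [U [l [i0 [[UU LE l1 ll _] [/andP[lam0 lam1] Ux]]]]] := Lsym_spectrum.
(* the products of coordinates off the top eigenvector are at most half the
   sum of their squares, and the squares sum to at most 1 *)
have key : (Lsym ^+ k) i j <= Num.sqrt (pi 0 i) * Num.sqrt (pi 0 j) + lam ^+ k.
  rewrite LE diagonalized_exp // -mulmxA mxE (bigD1 i0) //=.
  rewrite mul_diag_mx !mxE l1 expr1n mul1r Ux !mxE lerD2l.
  have : \sum_(h | h != i0) (2^-1 * lam ^+ k * (U h i ^+ 2 + U h j ^+ 2)) <= lam ^+ k.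
    rewrite -mulr_sumr big_split /= -[leRHS]mulr1 -mulrA [2^-1 * _]mulrC -mulrA.
    rewrite ler_wpM2l ?exprn_ge0 //.
    have h x : \sum_(h | h != i0) U h x ^+ 2 <= 1.
      by rewrite -(orthogonal_col UU x) [leRHS](bigD1 i0) //= lerDr sqr_ge0.
    have := h i; have := h j; lra.
  apply: le_trans; apply: ler_sum => h hi; rewrite !mxE.
  have := ll h hi; set c := l`_h => cl.
  rewrite mulrCA (le_trans (ler_norm _)) // normrM normrX.
  have ck : `|c| ^+ k <= lam ^+ k by rewrite lerXn2r ?nnegrE.
  rewrite (le_trans (ler_wpM2r (normr_ge0 _) ck)) //.
  rewrite [2^-1 * _]mulrC -mulrA ler_wpM2l ?exprn_ge0 //.
  rewrite normrM -(real_normK (num_real (U h i))) -(real_normK (num_real (U h j))).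
  by have := sqr_ge0 (`|U h i| - `|U h j|); rewrite sqrrB; lra.
move: key; rewrite Lsym_exp.
have a0 := sqrtpi_gt0 j; have b0 := sqrtpi_gt0 i.
have pa : pistar <= Num.sqrt (pi 0 j) ^+ 2 by rewrite sqrtpi_sqr min_entry_le.
have pb : pistar <= Num.sqrt (pi 0 i) ^+ 2 by rewrite sqrtpi_sqr min_entry_le.
rewrite -[X in _ -> _ <= X * _](sqrtpi_sqr j).
move: (Num.sqrt (pi 0 j)) (Num.sqrt (pi 0 i)) a0 b0 pa pb => a b a0 b0 pa pb.
rewrite ler_pdivrMr // mulrC -ler_pdivlMr // => h; apply: (le_trans h).
have p0 := stationary_min_gt0.
have -> : (b * a + lam ^+ k) * a / b = a ^+ 2 * (1 + lam ^+ k / (a * b)).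
  by field; rewrite !gt_eqF.
rewrite ler_wpM2l ?sqr_ge0 // lerD2l ler_wpM2l ?exprn_ge0 //.
rewrite lef_pV2 ?posrE ?mulr_gt0 // -ler_sqr ?nnegrE ?mulr_ge0 ?(ltW p0) ?(ltW a0) ?(ltW b0) //.
by rewrite exprMn [leLHS]expr2 ler_pM ?(ltW p0).
Qed.

End Chain.

(** * Expectations over paths *)

Section PathExpectation.
Variables (R : realType) (T : finType).

(** The expectation of F (x_1, ..., x_n) for a chain with kernel K that starts at
x = x_0. A kernel that ignores its first argument describes independent draws. *)
Fixpoint Epath (K : T -> T -> R) (n : nat) (x : T) (F : seq T -> R) : R :=
  if n is n'.+1 then \sum_y K x y * Epath K n' y (fun s => F (y :: s)) else F [::].

Section Linear.
Variable K : T -> T -> R.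

Lemma Epath_ext n x F G : (forall s, size s = n -> F s = G s) ->
  Epath K n x F = Epath K n x G.
Proof.
elim: n x F G => [|n IH] x F G h /=; first exact: h.
by apply: eq_bigr => y _; congr (_ * _); apply: IH => s sn; apply: h; rewrite /= sn.
Qed.

Lemma EpathD n x F G : Epath K n x (fun s => F s + G s) = Epath K n x F + Epath K n x G.
Proof.
elim: n x F G => [//|n IH] x F G /=.
by rewrite -big_split /=; apply: eq_bigr => y _; rewrite IH mulrDr.
Qed.

Lemma EpathZ n x a F : Epath K n x (fun s => a * F s) = a * Epath K n x F.
Proof.
elim: n x F => [//|n IH] x F /=.
by rewrite mulr_sumr; apply: eq_bigr => y _; rewrite IH mulrCA.
Qed.

Lemma Epath0 n x : Epath K n x (fun _ => 0) = 0.
Proof. by elim: n x => [//|n IH] x /=; rewrite big1 // => y _; rewrite IH mulr0. Qed.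

Lemma Epath_sum (I : Type) (r : seq I) n x (F : I -> seq T -> R) :
  Epath K n x (fun s => \sum_(i <- r) F i s) = \sum_(i <- r) Epath K n x (F i).
Proof.
elim: r => [|i r IH].
  by rewrite big_nil -[RHS](Epath0 n x); apply: Epath_ext => s _; rewrite big_nil.
by rewrite big_cons -IH -EpathD; apply: Epath_ext => s _; rewrite big_cons.
Qed.

Lemma Epath_cat m n x F :
  Epath K (m + n) x F = Epath K m x (fun s => Epath K n (last x s) (fun s' => F (s ++ s'))).
Proof.
elim: m x F => [//|m IH] x F /=.
by apply: eq_bigr => y _; rewrite IH.
Qed.

Hypothesis K0 : forall x y, 0 <= K x y.

Lemma Epath_le n x F G : (forall s, size s = n -> F s <= G s) ->
  Epath K n x F <= Epath K n x G.
Proof.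
elim: n x F G => [|n IH] x F G h /=; first exact: h.
apply: ler_sum => y _; rewrite ler_wpM2l //; apply: IH => s sn.
by apply: h; rewrite /= sn.
Qed.

Lemma Epath_ge0 n x F : (forall s, size s = n -> 0 <= F s) -> 0 <= Epath K n x F.
Proof. by move=> h; rewrite -(Epath0 n x); exact: Epath_le. Qed.

Hypothesis K1 : forall x, \sum_y K x y = 1.

Lemma Epath_cst n x c : Epath K n x (fun _ => c) = c.
Proof.
elim: n x => [//|n IH] x /=; under eq_bigr do rewrite IH.
by rewrite -mulr_suml K1 mul1r.
Qed.

Lemma Epath_Markov n x (B : seq T -> bool) F c : 0 < c ->
  (forall s, size s = n -> 0 <= F s) ->
  (forall s, size s = n -> B s -> c <= F s) ->
  Epath K n x (fun s => (B s)%:R) <= Epath K n x F / c.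
Proof.
move=> c0 F0 h; rewrite mulrC -EpathZ; apply: Epath_le => s sn.
rewrite ler_pdivlMl //; case: (boolP (B s)) => [Bs|_]; first by rewrite mulr1 h.
by rewrite mulr0 F0.
Qed.

End Linear.

End PathExpectation.

Lemma Epath_last (R : realType) d (P : 'M[R]_d) n (x : 'I_d) (g : 'I_d -> R) :
  Epath P n x (fun s => g (last x s)) = \sum_y (P ^+ n) x y * g y.
Proof.
elim: n x => [|n IH] x /=.
  rewrite (bigD1 x) //= big1 => [|y yx]; last by rewrite expr0 mxE eq_sym (negPf yx) mul0r.
  by rewrite expr0 mxE eqxx mul1r addr0.
under eq_bigr do rewrite IH mulr_sumr.
rewrite exchange_big /=; apply: eq_bigr => y _; rewrite exprS mxE mulr_suml.
by apply: eq_bigr => z _; rewrite mulrA.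
Qed.

Section PathLaw.
Variables (R : realType) (d n : nat) (disp : measure_display).
Variables (Omega : measurableType disp) (Pr : probability Omega R).
Variables (P : 'M[R]_d) (X : nat -> Omega -> 'I_d).
Hypothesis mc : markov_chain n Pr P X.

Lemma measurable_cylinder x m : (m <= n)%N -> measurable (cylinder X x m).
Proof.
elim: m => [|m IH] mn.
  rewrite (_ : cylinder _ _ _ = setT) //; apply/seteqP; split => w //= _ t.
rewrite (_ : cylinder _ _ _ = cylinder X x m `&` X m @^-1` [set x m]).
  apply: measurableI; first exact: IH (ltnW mn).
  by case: mc => h _; apply: h.
apply/seteqP; split => w /=.
  by move=> h; split; [move=> t tm; apply: h; exact: ltnW|exact: h].
move=> [h1 h2] t; rewrite ltnS leq_eqVlt => /orP[/eqP ->//|]; exact: h1.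
Qed.

Lemma measure_disjoint_bigU (I : eqType) (r : seq I) (F : I -> set Omega) :
  uniq r -> (forall i, measurable (F i)) ->
  (forall i j, i != j -> F i `&` F j = set0) ->
  measurable (\big[setU/set0]_(i <- r) F i) /\
  Pr (\big[setU/set0]_(i <- r) F i) = (\sum_(i <- r) Pr (F i))%E.
Proof.
move=> + mF dF; elim: r => [|i r IH] /=.
  by rewrite !big_nil measure0; split.
move=> /andP[ir /IH [mr Er]]; rewrite !big_cons; split; first exact: measurableU.
have dFr : F i `&` \big[setU/set0]_(j <- r) F j = set0.
  elim: r ir {IH mr Er} => [|j r IH]; first by rewrite big_nil setI0.
  by rewrite inE negb_or => /andP[ij /IH h]; rewrite big_cons setIUr h dF // setU0.
by rewrite measureU //; congr (_ + _)%E; exact: Er.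
Qed.

Definition path_event (B : seq 'I_d -> bool) : set Omega :=
  [set w | B (mkseq (fun t => X t w) n)].

(** Induction on the number k of remaining steps, splitting the event according to
the next state; the function x carries the past. *)
Lemma cylinder_path_event (B : seq 'I_d -> bool) k t (x : nat -> 'I_d) :
  n = (t.+1 + k)%N ->
  let E := cylinder X x t.+1 `&` path_event B in
  measurable E /\
  Pr E = (Pr (cylinder X x t.+1) *
    (Epath P k (x t) (fun s => (B (mkseq x t.+1 ++ s))%:R))%:E)%E.
Proof.
elim: k t x => [|k IH] t x nE /=.
  have pE w : cylinder X x t.+1 w -> mkseq (fun u => X u w) n = mkseq x t.+1.
    move=> h; rewrite nE addn0; apply/eq_in_map => u; rewrite mem_iota => /andP[_ ut].
    exact: h.
  have mcyl : measurable (cylinder X x t.+1).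
    by apply: measurable_cylinder; rewrite nE leq_addr.
  rewrite cats0; case: (boolP (B (mkseq x t.+1))) => [Bx|nBx].
    have -> : cylinder X x t.+1 `&` path_event B = cylinder X x t.+1.
      by apply/setIidPl => w wx; rewrite /path_event /= (pE _ wx).
    by rewrite mule1.
  have -> : cylinder X x t.+1 `&` path_event B = set0.
    apply/seteqP; split => w //= [wx]; rewrite /path_event /= (pE _ wx).
    by rewrite (negPf nBx).
  by rewrite measure0 mule0.
pose x' y := fun u => if (u <= t)%N then x u else y : 'I_d.
pose E y := cylinder X (x' y) t.+2 `&` path_event B.
have nE' : n = (t.+2 + k)%N by rewrite nE addnS addSn.
have IHy y := IH t.+1 (x' y) nE'.
have x'E y u : (u < t.+1)%N -> x' y u = x u by rewrite /x' ltnS => ->.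
have x'Et y : x' y t.+1 = y by rewrite /x' ltnn.
have cylE y : cylinder X (x' y) t.+1 = cylinder X x t.+1.
  by apply/seteqP; split => w h u ut; rewrite h // x'E.
have mkE y : mkseq (x' y) t.+2 = rcons (mkseq x t.+1) y.
  rewrite mkseqS x'Et; congr rcons.
  by apply/eq_in_map => u; rewrite mem_iota => /andP[_ ut]; exact: x'E.
have EU : cylinder X x t.+1 `&` path_event B =
    \big[setU/set0]_(y <- index_enum 'I_d) E y.
  rewrite -bigcup_seq; apply/seteqP; split => w /=.
    move=> [wx wB]; exists (X t.+1 w); first by rewrite /= mem_index_enum.
    split => // u; rewrite ltnS leq_eqVlt => /orP[/eqP ->|ut]; first by rewrite x'Et.
    by rewrite x'E // wx.
  move=> [y _ [wx wB]]; split => // u ut; rewrite wx ?x'E //; exact: ltnW.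
have [] := @measure_disjoint_bigU _ (index_enum 'I_d) E (index_enum_uniq _).
- by move=> y; have [] := IHy y.
- move=> y z yz; apply/seteqP; split => w //= [[wy _] [wz _]].
  by case/eqP: yz; rewrite -(x'Et y) -(x'Et z) -wy // -wz.
rewrite -EU => mE ->; split => //.
have [p pE] : exists p, Pr (cylinder X x t.+1) = p%:E.
  exists (fine (Pr (cylinder X x t.+1))); rewrite fineK //.
  by apply/fin_num_measure/measurable_cylinder; rewrite nE leq_addr.
rewrite pE -EFinM mulr_sumr -sumEFin; apply: eq_bigr => y _.
have [_ ->] := IHy y; case: mc => _ ->; last by rewrite nE' leq_addr.
rewrite cylE x'E // x'Et mkE pE -!EFinM -mulrA; congr (_ * (_ * _))%:E.
by apply: Epath_ext => s _; rewrite cat_rcons.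
Qed.

(** The probability of a path event is an average over the initial law q of
expectations from a fixed start. All later estimates hold uniformly in the start,
so q stays arbitrary. *)
Lemma path_law : (0 < n)%N ->
  exists q : 'I_d -> R, [/\ forall i, 0 <= q i, \sum_i q i = 1 &
    forall B : seq 'I_d -> bool,
    measurable (path_event B) /\
    Pr (path_event B) = (\sum_i q i * Epath P n.-1 i (fun s => (B (i :: s))%:R))%:E].
Proof.
move=> n0.
pose F i := cylinder X (fun _ => i) 1.
have mF i : measurable (F i) by apply: measurable_cylinder.
have dF i j : i != j -> F i `&` F j = set0.
  move=> ij; apply/seteqP; split => w //= [wi wj].
  by case/eqP: ij; rewrite -(wi 0) // (wj 0).
have UF : \big[setU/set0]_(i <- index_enum 'I_d) F i = setT.
  rewrite -bigcup_seq; apply/seteqP; split => w //= _.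
  exists (X 0 w); first by rewrite /= mem_index_enum.
  by move=> t; rewrite ltnS leqn0 => /eqP ->.
pose q i := fine (Pr (F i)).
have qE i : (q i)%:E = Pr (F i) by rewrite fineK // fin_num_measure.
exists q; split.
- by move=> i; rewrite -lee_fin qE measure_ge0.
- have [_] := measure_disjoint_bigU (index_enum_uniq _) mF dF.
  rewrite UF probability_setT => e; apply: EFin_inj; rewrite e -sumEFin.
  by apply: eq_bigr => i _; rewrite qE.
move=> B.
have nE : n = (1 + n.-1)%N by rewrite add1n prednK.
have IHi i := cylinder_path_event B (fun _ => i) nE.
have EU : path_event B = \big[setU/set0]_(i <- index_enum 'I_d) (F i `&` path_event B).
  by rewrite -big_distrl /= UF setTI.
have [] := @measure_disjoint_bigU _ (index_enum 'I_d) (fun i => F i `&` path_event B)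
  (index_enum_uniq _).
- by move=> i; have [] := IHi i.
- by move=> i j ij; rewrite setIACA dF // set0I.
rewrite -EU => mE ->; split => //; rewrite -sumEFin; apply: eq_bigr => i _.
by have [_ ->] := IHi i; rewrite EFinM qE.
Qed.

End PathLaw.

(** * Deviation of the visit frequencies *)

Section Bernstein.
Variables (R : realType) (d : nat) (P : 'M[R]_d) (pi : 'rV[R]_d).
Hypothesis sto : stochastic P.
Hypothesis irr : irreducible P.
Hypothesis aper : aperiodic P.
Hypothesis stat : stationary P pi.
Hypothesis rev : reversible P pi.
Hypothesis d2 : (2 <= d)%N.
Local Notation gap := (spectral_gap P).
Local Notation pistar := (min_entry pi).
Local Notation L := (Lsym P pi).
Local Notation u := (sqrtpi pi).
Let gap0 : 0 < gap. Proof. by case/andP: (gap_itv sto irr aper stat rev d2). Qed.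
Let gap1 : gap <= 1. Proof. by case/andP: (gap_itv sto irr aper stat rev d2). Qed.
Let pi0 i : 0 < pi 0 i. Proof. exact: stationary_gt0 sto irr stat i. Qed.
Let pi1 i : pi 0 i <= 1. Proof. exact: stationary_le1 stat i. Qed.
Let pistar0 : 0 < pistar. Proof. exact: stationary_min_gt0 sto irr stat d2. Qed.
Let pistar1 : pistar <= 2^-1. Proof. exact: stationary_min_le_half sto irr stat d2. Qed.

Lemma weighted_Cauchy_Schwarz (f g w : 'I_d -> R) : (forall x, 0 < w x) ->
  (\sum_x f x * g x) ^+ 2 <= (\sum_x f x ^+ 2 / w x) * (\sum_x w x * g x ^+ 2).
Proof.
move=> w0; pose a : 'cV[R]_d := \col_x (f x / Num.sqrt (w x)).
pose b : 'cV[R]_d := \col_x (Num.sqrt (w x) * g x).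
have s0 x : Num.sqrt (w x) != 0 by rewrite gt_eqF // sqrtr_gt0.
have s2 x : Num.sqrt (w x) ^+ 2 = w x by rewrite sqr_sqrtr // ltW.
have -> : \sum_x f x * g x = dotp a b.
  by apply: eq_bigr => x _; rewrite !mxE mulrA divfK.
have -> : \sum_x f x ^+ 2 / w x = dotp a a.
  by apply: eq_bigr => x _; rewrite !mxE -[in LHS]s2; field.
have -> : \sum_x w x * g x ^+ 2 = dotp b b.
  by apply: eq_bigr => x _; rewrite !mxE -[in LHS]s2; ring.
exact: Cauchy_Schwarz_dotp.
Qed.

Section Tilt.
Variables (i : 'I_d) (a : R).
Hypothesis ha : `|a| <= gap / 4.
Local Notation p := (pi 0 i).
(** A bound on the growth per step of the moment generating function of the number
of visits to i, with 1 + a for e^theta. *)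
Definition tilted_rate : R := 1 + pi 0 i * a + 2 * pi 0 i * a ^+ 2 / gap.
Local Notation rho := tilted_rate.

Let a_itv : - (gap / 4) <= a <= gap / 4. Proof. by rewrite -ler_norml. Qed.
Let pa_itv : - (gap / 4) <= p * a <= gap / 4.
Proof.
rewrite -ler_norml normrM ger0_norm ?(ltW (pi0 i)) //.
by rewrite -[leRHS]mul1r ler_pM // ?(ltW (pi0 i)) // ?pi1.
Qed.
Let s0 : 0 <= 2 * p * a ^+ 2 / gap.
Proof.
have a2 := sqr_ge0 a; have g0 := ltW gap0; have p0 := ltW (pi0 i).
by rewrite divr_ge0 // mulr_ge0 // mulr_ge0.
Qed.

Lemma tilted_rate_ge : 3 / 4 <= rho.
Proof.
rewrite /tilted_rate; have /andP[h _] := pa_itv; have := s0.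
have := gap1; lra.
Qed.

Let W1_gt0 : 0 < rho - (1 - gap).
Proof.
rewrite /tilted_rate; have /andP[h _] := pa_itv; have := s0.
have := gap0; lra.
Qed.

Let lama : (1 - gap) * a <= gap / 4.
Proof.
have /andP[_ h] := a_itv; have [a0|a0] := lerP 0 a.
  have : 0 <= gap * a by rewrite mulr_ge0 // ltW.
  lra.
have : (1 - gap) * a <= 0 by rewrite mulr_ge0_le0 ?subr_ge0 // ltW.
have := gap0; lra.
Qed.

Let W2_gt0 : 0 < rho - (1 - gap) * (1 + a).
Proof.
rewrite /tilted_rate; have /andP[h _] := pa_itv; have := s0.
have := lama; have := gap0; lra.
Qed.

(** After clearing denominators the inequality reads
s (gap + r - (1 - p) (1 - gap) a) >= (1 - p) (1 - gap) p a^2, where rho = 1 + r and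
s = 2 p a^2 / gap; the bracket is at least gap / 2 because |a| <= gap / 4. *)
Lemma tilted_rate_le1 :
  gap * ((1 - p) / (rho - (1 - gap)) + p * (1 + a) / (rho - (1 - gap) * (1 + a))) <= 1.
Proof.
have h1 := W1_gt0; have h2 := W2_gt0.
set W1 := rho - (1 - gap) in h1 *; set W2 := rho - _ in h2 *.
rewrite (_ : gap * _ = gap * ((1 - p) * W2 + p * (1 + a) * W1) / (W1 * W2)); last first.
  by field; rewrite !gt_eqF.
rewrite ler_pdivrMr ?mulr_gt0 // mul1r -subr_ge0.
set s := 2 * p * a ^+ 2 / gap.
have rE : rho = 1 + p * a + s by [].
have -> : W1 * W2 - gap * ((1 - p) * W2 + p * (1 + a) * W1) =
   s * (gap + (p * a + s) - (1 - p) * (1 - gap) * a) - (1 - p) * (1 - gap) * (p * a ^+ 2).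
  by rewrite /W1 /W2 rE; ring.
have p0 : 0 <= p by rewrite ltW // pi0.
have p1 : 0 <= 1 - p by rewrite subr_ge0 pi1.
have g1 : 0 <= 1 - gap by rewrite subr_ge0.
have h3 : (1 - p) * (1 - gap) * a <= gap / 4.
  have [a0|a0] := lerP 0 a.
    rewrite -mulrA (le_trans _ lama) // ler_piMl ?mulr_ge0 //; lra.
  have : (1 - p) * (1 - gap) * a <= 0 by rewrite mulr_ge0_le0 ?mulr_ge0 // ltW.
  have := gap0; lra.
have h4 : gap / 2 <= gap + (p * a + s) - (1 - p) * (1 - gap) * a.
  have /andP[h _] := pa_itv; have := s0; rewrite -/s; lra.
have h5 : s * (gap / 2) = p * a ^+ 2 by rewrite /s; field; rewrite gt_eqF.
have h6 : s * (gap / 2) <= s * (gap + (p * a + s) - (1 - p) * (1 - gap) * a).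
  by rewrite ler_wpM2l.
have h7 : (1 - p) * (1 - gap) * (p * a ^+ 2) <= p * a ^+ 2.
  have h8 : 0 <= p * a ^+ 2 by rewrite mulr_ge0 ?sqr_ge0.
  rewrite ler_piMl // mulr_ile1 //; have := gap0; lra.
lra.
Qed.

Let z0 : 0 < 1 + a.
Proof. have /andP[h _] := a_itv; have := gap1; have := gap0; lra. Qed.

Let sg (x : 'I_d) : R := if x == i then Num.sqrt (1 + a) else 1.
Let sg2 x : sg x ^+ 2 = if x == i then 1 + a else 1.
Proof. by rewrite /sg; case: ifP => _; rewrite ?expr1n // sqr_sqrtr // ltW. Qed.

Definition tilted_kernel : 'M[R]_d := \matrix_(x, y) (sg x * L x y * sg y).

Local Notation Kt := tilted_kernel.

Lemma tilted_kernel_sym : Kt^T = Kt.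
Proof.
apply/matrixP => x y; rewrite !mxE; have := Lsym_sym sto irr stat rev.
move/(congr1 (fun M : 'M[R]_d => M x y)); rewrite mxE => e.
rewrite /Lsym !mxE in e; rewrite e; ring.
Qed.

(** By [Lsym_quad] it is enough that
gap <u, h>^2 <= rho |x|^2 - (1 - gap) |h|^2, where h is x multiplied by sg. The
right-hand side is a weighted square norm of x, and Cauchy-Schwarz with these
weights leaves the inequality [tilted_rate_le1]. *)
Lemma tilted_kernel_qbound : qbound Kt rho.
Proof.
move=> x; pose h : 'cV[R]_d := \col_y (sg y * x y 0).
have -> : dotp x (Kt *m x) = dotp h (L *m h).
  apply: eq_bigr => y _; rewrite [in LHS]mxE [(L *m h) y 0]mxE [h y 0]mxE !mulr_sumr.
  by apply: eq_bigr => k _; rewrite [tilted_kernel _ _]mxE [h k 0]mxE; ring.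
apply: (le_trans (Lsym_quad sto irr aper stat rev d2 h)).
have -> : 1 - (1 - gap) = gap by ring.
pose w y := rho - (1 - gap) * sg y ^+ 2.
have w0 y : 0 < w y by rewrite /w sg2; case: ifP => _ //; rewrite mulr1.
have uh : dotp u h = \sum_y (u y 0 * sg y) * x y 0.
  by apply: eq_bigr => y _; rewrite [h y 0]mxE mulrA.
have := weighted_Cauchy_Schwarz (fun y => u y 0 * sg y) (fun y => x y 0) w0.
rewrite -uh.
have -> : \sum_y (u y 0 * sg y) ^+ 2 / w y =
  (1 - p) / (rho - (1 - gap)) + p * (1 + a) / (rho - (1 - gap) * (1 + a)).
  rewrite (bigD1 i) //= addrC; congr (_ + _); last first.
    by rewrite exprMn /w sg2 eqxx mxE (sqrtpi_sqr stat).
  have -> : 1 - p = \sum_(y | y != i) pi 0 y.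
    by rewrite -(stationary_sum1 stat) (bigD1 i) //= [X in X - _]addrC addrK.
  rewrite mulr_suml; apply: eq_bigr => y yi.
  by rewrite exprMn /w sg2 (negPf yi) !mulr1 mxE (sqrtpi_sqr stat).
set A := (_ / _ + _) => CS.
have wx : \sum_y w y * x y 0 ^+ 2 = rho * dotp x x - (1 - gap) * dotp h h.
  rewrite !mulr_sumr -sumrB; apply: eq_bigr => y _.
  by rewrite [h y 0]mxE /w; ring.
have hh : gap * dotp u h ^+ 2 <= \sum_y w y * x y 0 ^+ 2.
  apply: (@le_trans _ _ (gap * (A * \sum_y w y * x y 0 ^+ 2))).
    by rewrite ler_wpM2l // ltW.
  rewrite mulrA ler_piMl ?tilted_rate_le1 //.
  by apply: sumr_ge0 => y _; rewrite mulr_ge0 ?sqr_ge0 // ltW.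
by move: hh; rewrite wx; lra.
Qed.

(** Weighting the expectation by sqrt pi and by the square root of 1 + a turns one
step of the tilted chain into the symmetric matrix. *)
Lemma mgf_recursion N :
  \col_x (u x 0 * sg x * Epath P N x (fun s => (1 + a) ^+ count_mem i s)) =
  Kt ^+ N *m (\col_x (u x 0 * sg x)).
Proof.
elim: N => [|N IH].
  by rewrite expr0 mul1mx; apply/matrixP => x y; rewrite !mxE /= expr0 mulr1.
rewrite exprS -mulmxE -mulmxA -IH; apply/matrixP => x y; rewrite !mxE /= mulr_sumr.
apply: eq_bigr => k _; rewrite !mxE.
rewrite (_ : Epath _ _ _ _ = sg k ^+ 2 * Epath P N k (fun s => (1 + a) ^+ count_mem i s)).
  by field; exact: (sqrtpi_neq0 sto irr stat).
rewrite -EpathZ; apply: Epath_ext => s _; rewrite exprD sg2; congr (_ * _).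
by case: (k == i); rewrite ?expr1 ?expr0.
Qed.

(** The start x enters only through the weight 1 / sqrt (pi x), which is where the
factor 1/pistar of an arbitrary initial law comes from. *)
Lemma mgf_bound N x :
  Epath P N x (fun s => (1 + a) ^+ count_mem i (x :: s)) <= 2 / pistar * rho ^+ N.+1.
Proof.
have r34 := tilted_rate_ge; have r0 : 0 < rho by apply: lt_le_trans r34; lra.
pose v0 : 'cV[R]_d := \col_x (u x 0 * sg x).
pose phi := Epath P N x (fun s => (1 + a) ^+ count_mem i s).
have sgz y : sg y ^+ 2 <= 5 / 4.
  rewrite sg2; have /andP[_ h] := a_itv; have := gap1; case: ifP => _; lra.
have v0n : dotp v0 v0 <= 5 / 4.
  have -> : 5 / 4 = \sum_y pi 0 y * (5 / 4) :> R.
    by rewrite -mulr_suml (stationary_sum1 stat) mul1r.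
  apply: ler_sum => y _.
  rewrite [v0 y 0]mxE -expr2 exprMn mxE (sqrtpi_sqr stat).
  by apply: ler_wpM2l (sgz y); exact: ltW (pi0 y).
have key : (u x 0 * sg x * phi) ^+ 2 <= rho ^+ (2 * N) * (5 / 4).
  have := qbound_exp_sqr v0 N tilted_kernel_sym tilted_kernel_qbound.
  rewrite -mgf_recursion => h.
  apply: (@le_trans _ _ (rho ^+ (2 * N) * dotp v0 v0)); last first.
    by apply: ler_wpM2l v0n; rewrite exprn_ge0 // ltW.
  apply: le_trans h; rewrite /dotp (bigD1 x) //= !mxE -expr2 lerDl.
  by apply: sumr_ge0 => y _; rewrite -expr2 sqr_ge0.
have E : Epath P N x (fun s => (1 + a) ^+ count_mem i (x :: s)) = sg x ^+ 2 * phi.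
  rewrite -EpathZ; apply: Epath_ext => s _; rewrite /= exprD sg2; congr (_ * _).
  by case: (x == i); rewrite ?expr1 ?expr0.
rewrite E -ler_sqr ?nnegrE; last 2 first.
- rewrite mulr_ge0 ?sqr_ge0 // /phi; apply: Epath_ge0 => [y z|s _]; first by case: sto.
  by rewrite exprn_ge0 // ltW.
- by rewrite mulr_ge0 ?exprn_ge0 ?divr_ge0 // ltW.
have ux2 : u x 0 ^+ 2 = pi 0 x by rewrite mxE (sqrtpi_sqr stat).
have key' : (sg x ^+ 2 * phi) ^+ 2 * pi 0 x <= 25 / 16 * rho ^+ (2 * N).
  have -> : (sg x ^+ 2 * phi) ^+ 2 * pi 0 x = sg x ^+ 2 * (u x 0 * sg x * phi) ^+ 2.
    by rewrite -ux2; ring.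
  have -> : 25 / 16 * rho ^+ (2 * N) = 5 / 4 * (rho ^+ (2 * N) * (5 / 4)) by field.
  by apply: ler_pM; rewrite ?sqr_ge0.
have px := min_entry_le pi x; have f0 := sqr_ge0 (sg x ^+ 2 * phi).
have key2 : (sg x ^+ 2 * phi) ^+ 2 * pistar <= 25 / 16 * rho ^+ (2 * N).
  by apply: le_trans key'; rewrite ler_wpM2l.
have ps : pistar ^+ 2 <= pistar.
  rewrite expr2 ler_piMl ?(ltW pistar0) //; have := pistar1; lra.
have rN : 0 <= rho ^+ (2 * N) by rewrite exprn_ge0 // ltW.
have r2 : 9 / 16 <= rho ^+ 2.
  have -> : 9 / 16 = (3 / 4) ^+ 2 :> R by field.
  by rewrite lerXn2r ?nnegrE ?(ltW r0) //; lra.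
have -> : (2 / pistar * rho ^+ N.+1) ^+ 2 = 4 * rho ^+ (2 * N) * rho ^+ 2 / pistar ^+ 2.
  rewrite exprMn -exprM mulnC mulnS exprD; field; rewrite gt_eqF //.
rewrite ler_pdivlMr ?exprn_gt0 //.
apply: (@le_trans _ _ (25 / 16 * rho ^+ (2 * N))).
  by apply: le_trans key2; rewrite ler_wpM2l.
have : rho ^+ (2 * N) * (9 / 16) <= rho ^+ (2 * N) * rho ^+ 2 by rewrite ler_wpM2l.
lra.
Qed.

Lemma mgf_bound_exp N x :
  Epath P N x (fun s => (1 + a) ^+ count_mem i (x :: s)) <=
  2 / pistar * expR (N.+1%:R * (pi 0 i * a + 2 * pi 0 i * a ^+ 2 / gap)).
Proof.
apply: le_trans (mgf_bound N x) _; rewrite ler_wpM2l ?divr_ge0 ?(ltW pistar0) //.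
rewrite expRM_natl lerXn2r ?nnegrE ?expR_ge0 //.
  by rewrite (le_trans _ tilted_rate_ge) // divr_ge0.
by rewrite /tilted_rate -addrA expR_ge1Dx.
Qed.
End Tilt.

(** ln (1 + y) = - ln (1 - y / (1 + y)). *)
Lemma ln1D_ge (y : R) : -1 < y -> y / (1 + y) <= ln (1 + y).
Proof.
move=> y1; have z0 : 0 < 1 + y by lra.
have e : 1 + - (y / (1 + y)) = (1 + y)^-1 by field; rewrite gt_eqF.
have h : -1 < - (y / (1 + y)).
  have : 0 < (1 + y)^-1 by rewrite invr_gt0.
  by move: e; set q := y / _; set r := (1 + y)^-1; lra.
have := le_ln1Dx h; rewrite e lnV ?posrE //; lra.
Qed.

(** Chernoff's method with a = gap t / (8 pi_i + 4 t): this choice is at most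
gap / 4 and within a constant of the optimum both for small and for large t. *)
Lemma upper_tail N x i (t : R) : 0 < t ->
  Epath P N x (fun s => (N.+1%:R * (pi 0 i + t) <= (count_mem i (x :: s))%:R :> R)%:R) <=
  2 / pistar * expR (- (3 / 8 * (N.+1%:R * gap * (t ^+ 2 / (8 * pi 0 i + 4 * t))))).
Proof.
move=> t0; set p := pi 0 i; have p0 : 0 < p := pi0 i.
have D0 : 0 < 8 * p + 4 * t by lra.
pose a := gap * t / (8 * p + 4 * t).
have a0 : 0 < a by rewrite divr_gt0 ?mulr_gt0.
have a4 : a <= gap / 4.
  rewrite ler_pdivrMr // -subr_ge0.
  have -> : gap / 4 * (8 * p + 4 * t) - gap * t = 2 * gap * p by field.
  by rewrite !mulr_ge0 ?ltW.
have ha : `|a| <= gap / 4 by rewrite gtr0_norm.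
have z0 : 0 < 1 + a by lra.
set n := N.+1%:R : R; have n0 : 0 < n by rewrite ltr0n.
have lnz : a - a ^+ 2 <= ln (1 + a).
  apply: le_trans (ln1D_ge _); last by lra.
  rewrite ler_pdivlMr // -subr_ge0.
  have -> : a - (a - a ^+ 2) * (1 + a) = a ^+ 3 by ring.
  by rewrite exprn_ge0 // ltW.
have ln0 : 0 <= ln (1 + a) by rewrite ln_ge0 // lerDl ltW.
pose c := expR (n * (p + t) * ln (1 + a)).
apply: le_trans (@Epath_Markov _ _ _ (stochastic_ge0 sto) _ _ _ (fun s => (1 + a) ^+ count_mem i (x :: s)) c _ _ _) _.
- exact: expR_gt0.
- by move=> s _; rewrite exprn_ge0 // ltW.
- move=> s _ h; rewrite -[in leRHS](lnK (x := 1 + a)) ?posrE // -expRM_natl ler_expR.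
  by rewrite ler_wpM2r.
rewrite ler_pdivrMr ?expR_gt0 //; apply: le_trans (mgf_bound_exp i ha N x) _.
rewrite -[leRHS]mulrA /c -expRD ler_wpM2l ?divr_ge0 ?(ltW pistar0) // ler_expR -/p -/n.
have -> : - (3 / 8 * (n * gap * (t ^+ 2 / (8 * p + 4 * t)))) = n * (- (3 / 8 * (a * t))).
  by rewrite /a; field; rewrite gt_eqF.
rewrite -(mulrA n _ (ln _)) -mulrDr ler_pM2l //.
have h1 : (p + t) * (a - a ^+ 2) <= (p + t) * ln (1 + a).
  by rewrite ler_wpM2l // ltW // addr_gt0.
have h2 : a ^+ 2 / gap = a * (t / (8 * p + 4 * t)).
  by rewrite /a; field; rewrite !gt_eqF.
have h3 : a ^+ 2 <= a ^+ 2 / gap.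
  by rewrite ler_peMr ?sqr_ge0 // invf_ge1.
have h4 : a ^+ 2 / gap * p <= a * t / 8.
  have pD : p / (8 * p + 4 * t) <= 8^-1 by rewrite ler_pdivrMr //; lra.
  have -> : a ^+ 2 / gap * p = a * t * (p / (8 * p + 4 * t)).
    by rewrite h2; ring.
  by rewrite ler_pM2l // mulr_gt0.
have h5 : a ^+ 2 <= a / 4.
  rewrite expr2 ler_pM2l //; have := gap1; lra.
have h6 : p * a ^+ 2 <= p * (a ^+ 2 / gap) by rewrite ler_pM2l.
have h7 : t * a ^+ 2 <= t * (a / 4) by rewrite ler_pM2l.
have h8 : 2 * p * a ^+ 2 / gap = 2 * (a ^+ 2 / gap * p) by field; rewrite gt_eqF.
rewrite h8; lra.
Qed.

Lemma lower_tail N x i (t : R) : 0 < t ->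
  Epath P N x (fun s => ((count_mem i (x :: s))%:R <= N.+1%:R * (pi 0 i - t) :> R)%:R) <=
  2 / pistar * expR (- (3 / 8 * (N.+1%:R * gap * (t ^+ 2 / (8 * pi 0 i + 4 * t))))).
Proof.
move=> t0; set p := pi 0 i; have p0 : 0 < p := pi0 i.
have D0 : 0 < 8 * p + 4 * t by lra.
pose a := gap * t / (8 * p + 4 * t).
have a0 : 0 < a by rewrite divr_gt0 ?mulr_gt0.
have a4 : a <= gap / 4.
  rewrite ler_pdivrMr // -subr_ge0.
  have -> : gap / 4 * (8 * p + 4 * t) - gap * t = 2 * gap * p by field.
  by rewrite !mulr_ge0 ?ltW.
have ha : `|- a| <= gap / 4 by rewrite normrN gtr0_norm.
have z0 : 0 < 1 + - a by have := gap1; lra.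
set n := N.+1%:R : R; have n0 : 0 < n by rewrite ltr0n.
have lnz : - a - 2 * a ^+ 2 <= ln (1 + - a).
  apply: le_trans (ln1D_ge _); last by lra.
  rewrite ler_pdivlMr // -subr_ge0.
  have -> : - a - (- a - 2 * a ^+ 2) * (1 + - a) = a ^+ 2 * (1 - 2 * a) by ring.
  rewrite mulr_ge0 ?sqr_ge0 //; have := gap1; lra.
have ln1 : ln (1 + - a) <= - a by apply: le_ln1Dx; lra.
have ln0 : ln (1 + - a) <= 0 by lra.
pose c := expR (n * (p - t) * ln (1 + - a)).
apply: le_trans (@Epath_Markov _ _ _ (stochastic_ge0 sto) _ _ _ (fun s => (1 + - a) ^+ count_mem i (x :: s)) c _ _ _) _.
- exact: expR_gt0.
- by move=> s _; rewrite exprn_ge0 // ltW.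
- move=> s _ h; rewrite -[in leRHS](lnK (x := 1 + - a)) ?posrE // -expRM_natl ler_expR.
  by rewrite ler_wnM2r.
rewrite ler_pdivrMr ?expR_gt0 //; apply: le_trans (mgf_bound_exp i ha N x) _.
rewrite -[leRHS]mulrA /c -expRD ler_wpM2l ?divr_ge0 ?(ltW pistar0) // ler_expR -/p -/n.
have -> : - (3 / 8 * (n * gap * (t ^+ 2 / (8 * p + 4 * t)))) = n * (- (3 / 8 * (a * t))).
  by rewrite /a; field; rewrite gt_eqF.
rewrite -(mulrA n _ (ln _)) -mulrDr ler_pM2l //.
have h1 : p * (- a - 2 * a ^+ 2) <= p * ln (1 + - a) by rewrite ler_pM2l.
have h1' : t * ln (1 + - a) <= t * - a by rewrite ler_pM2l.
have h2 : a ^+ 2 / gap = a * (t / (8 * p + 4 * t)).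
  by rewrite /a; field; rewrite !gt_eqF.
have h3 : a ^+ 2 <= a ^+ 2 / gap.
  by rewrite ler_peMr ?sqr_ge0 // invf_ge1.
have h4 : a ^+ 2 / gap * p <= a * t / 8.
  have pD : p / (8 * p + 4 * t) <= 8^-1 by rewrite ler_pdivrMr //; lra.
  have -> : a ^+ 2 / gap * p = a * t * (p / (8 * p + 4 * t)).
    by rewrite h2; ring.
  by rewrite ler_pM2l // mulr_gt0.
have h6 : p * a ^+ 2 <= p * (a ^+ 2 / gap) by rewrite ler_pM2l.
have h8 : 2 * p * (- a) ^+ 2 / gap = 2 * (a ^+ 2 / gap * p) by rewrite sqrrN; field; rewrite gt_eqF.
rewrite h8; have := mulr_gt0 a0 t0; lra.
Qed.

(** The deviation in Bernstein's inequality, where K stands for the logarithmic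
factor divided by gap n. *)
Definition freq_radius (i : 'I_d) (K : R) := 128 * (Num.sqrt (pi 0 i * K) + K).

Lemma freq_radius_exponent i K : 0 < K ->
  16 * K <= freq_radius i K ^+ 2 / (8 * pi 0 i + 4 * freq_radius i K).
Proof.
move=> K0; rewrite /freq_radius; have p0 := pi0 i.
have h : Num.sqrt (pi 0 i * K) ^+ 2 = pi 0 i * K by rewrite sqr_sqrtr // mulr_ge0 // ltW.
have s0 := sqrtr_ge0 (pi 0 i * K).
move: (Num.sqrt _) h s0 => r h s0.
rewrite ler_pdivlMr; last by lra.
have : 0 <= r * K by rewrite mulr_ge0 // ltW.
have : 0 < K * K by rewrite mulr_gt0.
have : 0 < pi 0 i * K by rewrite mulr_gt0.
have -> : (128 * (r + K)) ^+ 2 = 16384 * (r ^+ 2 + 2 * (r * K) + K * K) by ring.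
rewrite h; lra.
Qed.

Lemma frequency_deviation N x (K : R) : 0 < K ->
  Epath P N x (fun s => ([exists i : 'I_d,
     freq_radius i K <= `|(count_mem i (x :: s))%:R / N.+1%:R - pi 0 i|])%:R) <=
  d%:R * (4 / pistar * expR (- (6 * (N.+1%:R * gap * K)))).
Proof.
move=> K0; set n := N.+1%:R : R; have n0 : 0 < n by rewrite ltr0n.
have K0' x' y : 0 <= P x' y by case: sto.
pose up i s : R := (n * (pi 0 i + freq_radius i K) <= (count_mem i (x :: s))%:R :> R)%:R.
pose dn i s : R := ((count_mem i (x :: s))%:R <= n * (pi 0 i - freq_radius i K) :> R)%:R.
apply: (@le_trans _ _ (Epath P N x (fun s => \sum_(i < d) (up i s + dn i s)))).
  apply: Epath_le => // s _; case: existsP => [[i hi]|_]; last first.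
    by apply: sumr_ge0 => i _; rewrite addr_ge0 ?ler0n.
  rewrite (bigD1 i) //= ler_wpDr //.
    by apply: sumr_ge0 => j _; rewrite addr_ge0 ?ler0n.
  rewrite /up /dn; set c := (count_mem i (x :: s))%:R in hi *.
  move: hi; rewrite ler_normr => /orP[h|h].
    have -> : n * (pi 0 i + freq_radius i K) <= c.
      rewrite mulrC -ler_pdivlMr //; move: (c / n) (freq_radius i K) (pi 0 i) h => q f p h; lra.
    by rewrite lerDl ler0n.
  have -> : c <= n * (pi 0 i - freq_radius i K).
    rewrite mulrC -ler_pdivrMr //; move: (c / n) (freq_radius i K) (pi 0 i) h => q f p h; lra.
  by rewrite lerDr ler0n.
rewrite Epath_sum mulr_natl -[d in _ *+ d]card_ord -sumr_const; apply: ler_sum => i _.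
rewrite EpathD.
have t0 : 0 < freq_radius i K.
  by rewrite /freq_radius mulr_gt0 // ltr_wpDl // sqrtr_ge0.
have e : expR (- (3 / 8 * (n * gap * (freq_radius i K ^+ 2 / (8 * pi 0 i + 4 * freq_radius i K)))))
    <= expR (- (6 * (n * gap * K))).
  rewrite ler_expR lerN2.
  have -> : 6 * (n * gap * K) = 3 / 8 * (n * gap * (16 * K)) by field.
  rewrite ler_wpM2l // ler_wpM2l ?freq_radius_exponent //.
  by rewrite mulr_ge0 // ltW.
have := upper_tail N x i t0; have := lower_tail N x i t0; rewrite -/n.
have q0 : 0 <= 2 / pistar by rewrite divr_ge0 // ltW.
have := ler_wpM2l q0 e; rewrite /up /dn.
lra.
Qed.
End Bernstein.

(** * Trace moments of sums of independent matrices *)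

Section Symmetric.
Variables (R : realType) (d : nat).
Implicit Types A B : 'M[R]_d.

Lemma symD A B : A^T = A -> B^T = B -> (A + B)^T = A + B.
Proof. by move=> sA sB; rewrite -[in RHS]sA -[in RHS]sB; apply/matrixP => i j; rewrite !mxE. Qed.

Lemma symB A B : A^T = A -> B^T = B -> (A - B)^T = A - B.
Proof. by move=> sA sB; rewrite -[in RHS]sA -[in RHS]sB; apply/matrixP => i j; rewrite !mxE. Qed.

Lemma sym_sum (I : Type) (r : seq I) (F : I -> 'M[R]_d) :
  (forall i, (F i)^T = F i) -> (\sum_(i <- r) F i)^T = \sum_(i <- r) F i.
Proof.
move=> h; elim/big_rec: _ => [|i x _ IH]; first by rewrite trmx0.
exact: symD.
Qed.

(** The factorization of a difference of powers in a noncommutative ring. *)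
Lemma expr_diff_telescope A B k :
  A ^+ k.+1 - B ^+ k.+1 = \sum_(q < k.+1) A ^+ q * (A - B) * B ^+ (k - q).
Proof.
elim: k => [|k IH]; first by rewrite big_ord1 subn0 !expr1 expr0 mul1r mulr1.
rewrite big_ord_recl /= subn0 expr0 mul1r.
have -> : \sum_(i < k.+1) A ^+ bump 0 i * (A - B) * B ^+ (k.+1 - bump 0 i) =
    A * (A ^+ k.+1 - B ^+ k.+1).
  rewrite IH mulr_sumr; apply: eq_bigr => i _.
  by rewrite /bump add1n exprS subSS !mulrA.
by rewrite mulrBr mulrBl -!exprS [RHS]addrC addrA subrK.
Qed.

Lemma trace_difference_le A B s : A^T = A -> B^T = B ->
  \tr ((A - B) *m (A ^+ (2 * s).+1 - B ^+ (2 * s).+1)) <=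
  (2 * s).+1%:R / 2 * \tr ((A - B) *m (A - B) *m (A ^+ (2 * s) + B ^+ (2 * s))).
Proof.
move=> sA sB; apply: le_trans (Heinz_trace s sA sB (symB sA sB)).
rewrite expr_diff_telescope mulmx_sumr raddf_sum /=; apply: ler_sum => q _.
by rewrite -!mulmxE !mulmxA.
Qed.
End Symmetric.

Section IidMatrixMoments.
Variables (R : realType) (d : nat) (T : finType) (mu : T -> R) (y : T -> 'M[R]_d).
Hypothesis mu0 : forall z, 0 <= mu z.
Hypothesis mu1 : \sum_z mu z = 1.
Hypothesis ysym : forall z, (y z)^T = y z.

Definition mean_mx : 'M[R]_d := \sum_z mu z *: y z.
Definition centered z := y z - mean_mx.
Definition csum (l : seq T) := \sum_(z <- l) centered z.

Lemma mean_sym : mean_mx^T = mean_mx.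
Proof. by apply: sym_sum => z; rewrite linearZ /= ysym. Qed.

Lemma centered_sym z : (centered z)^T = centered z.
Proof. exact: symB (ysym z) mean_sym. Qed.

Lemma csum_sym l : (csum l)^T = csum l.
Proof. exact: sym_sum centered_sym. Qed.

Lemma centered_mean0 : \sum_z mu z *: centered z = 0.
Proof.
under eq_bigr do rewrite scalerBr.
by rewrite sumrB -scaler_suml mu1 scale1r subrr.
Qed.

Variable beta : T -> 'I_d -> R.
Hypothesis betaP : forall z (x : 'cV[R]_d),
  \sum_z' mu z' * dotp ((y z - y z') *m x) ((y z - y z') *m x) <=
  \sum_i beta z i * x i 0 ^+ 2.

(** Let Y_z be the centered summand and z' an independent copy of z. Because Y_z has
mean zero, the left-hand side
is half the expectation of tr (Y_z - Y_z') (B_z^(2s+1) - B_z'^(2s+1)), where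
B_z = A + Y_z and B_z - B_z' = Y_z - Y_z'. [trace_difference_le] turns the
difference of powers into the square (Y_z - Y_z')^2, whose conditional expectation
given z is dominated by the diagonal matrix beta z. *)
Lemma exchangeable_pair_step (A : 'M[R]_d) s : A^T = A ->
  \sum_z mu z * \tr (centered z *m (A + centered z) ^+ (2 * s).+1) <=
  (2 * s).+1%:R / 2 *
    \sum_z mu z * \sum_i beta z i * ((A + centered z) ^+ (2 * s)) i i.
Proof.
move=> sA; pose B z := A + centered z.
have sB z : (B z)^T = B z := symD sA (centered_sym z).
have BB z z' : B z - B z' = y z - y z'.
  by rewrite /B /centered opprD addrACA subrr add0r opprB addrA subrK.
pose D z z' := \tr ((B z - B z') *m (B z ^+ (2 * s).+1 - B z' ^+ (2 * s).+1)).
have mean0 (F : 'M[R]_d) : \sum_z mu z * \tr (centered z *m F) = 0.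
  transitivity (\tr ((\sum_z mu z *: centered z) *m F)).
    rewrite mulmx_suml raddf_sum /=; apply: eq_bigr => z _.
    by rewrite -scalemxAl mxtraceZ.
  by rewrite centered_mean0 mul0mx mxtrace0.
(* the mixed terms vanish because the summands are centered *)
have E1 : \sum_z \sum_z' mu z * mu z' * D z z' =
    2 * \sum_z mu z * \tr (centered z *m B z ^+ (2 * s).+1).
  have Dexp z z' : D z z' =
      \tr (centered z *m B z ^+ (2 * s).+1) + \tr (centered z' *m B z' ^+ (2 * s).+1)
      - \tr (centered z *m B z' ^+ (2 * s).+1) - \tr (centered z' *m B z ^+ (2 * s).+1).
    rewrite /D (_ : B z - B z' = centered z - centered z'); last first.
      by rewrite /B opprD addrACA subrr add0r.
    rewrite mulmxBl !mulmxBr !(raddfB (@mxtrace R d)) /= opprB addrACA addrA.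
    by rewrite [X in X - _]addrAC.
  transitivity (\sum_z \sum_z' (mu z' * (mu z * \tr (centered z *m B z ^+ (2 * s).+1))
     + mu z * (mu z' * \tr (centered z' *m B z' ^+ (2 * s).+1))
     - mu z' * (mu z * \tr (centered z *m B z' ^+ (2 * s).+1))
     - mu z * (mu z' * \tr (centered z' *m B z ^+ (2 * s).+1)))).
    by apply: eq_bigr => z _; apply: eq_bigr => z' _; rewrite Dexp; ring.
  under eq_bigr do rewrite !sumrB big_split /=.
  rewrite !sumrB big_split /=.
  rewrite [X in _ - X - _](_ : _ = 0); last first.
    rewrite exchange_big /= big1 // => z' _; rewrite -mulr_sumr mean0 mulr0 //.
  rewrite [X in _ - X](_ : _ = 0); last first.
    by rewrite big1 // => z _; rewrite -mulr_sumr mean0 mulr0.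
  rewrite !subr0 mulr_natl mulr2n; congr (_ + _).
    by apply: eq_bigr => z _; rewrite -mulr_suml mu1 mul1r.
  under eq_bigr do rewrite -mulr_sumr.
  by rewrite -mulr_suml mu1 mul1r.
pose Q z z' := (y z - y z') *m (y z - y z').
have E2 : \sum_z \sum_z' mu z * mu z' * D z z' <=
    \sum_z \sum_z' mu z * mu z' *
      ((2 * s).+1%:R / 2 * \tr (Q z z' *m (B z ^+ (2 * s) + B z' ^+ (2 * s)))).
  apply: ler_sum => z _; apply: ler_sum => z' _; rewrite ler_wpM2l ?mulr_ge0 //.
  by rewrite /Q -BB; exact: trace_difference_le.
have E3 : \sum_z \sum_z' mu z * mu z' *
      ((2 * s).+1%:R / 2 * \tr (Q z z' *m (B z ^+ (2 * s) + B z' ^+ (2 * s)))) =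
    (2 * s).+1%:R * \sum_z mu z * \tr ((\sum_z' mu z' *: Q z z') *m B z ^+ (2 * s)).
  pose G z z' := mu z * mu z' * \tr (Q z z' *m B z ^+ (2 * s)).
  have -> : \sum_z mu z * \tr ((\sum_z' mu z' *: Q z z') *m B z ^+ (2 * s)) =
      \sum_z \sum_z' G z z'.
    apply: eq_bigr => z _; rewrite mulmx_suml raddf_sum mulr_sumr /=.
    by apply: eq_bigr => z' _; rewrite -scalemxAl mxtraceZ mulrA.
  have Qs z z' : Q z z' = Q z' z.
    by rewrite /Q -(opprB (y z') (y z)) mulNmx mulmxN opprK.
  transitivity ((2 * s).+1%:R / 2 * (\sum_z \sum_z' G z z' + \sum_z \sum_z' G z' z)).
    rewrite -big_split /= mulr_sumr; apply: eq_bigr => z _.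
    rewrite -big_split /= mulr_sumr; apply: eq_bigr => z' _.
    rewrite /G mulmxDr mxtraceD (Qs z' z); ring.
  by rewrite [X in _ + X]exchange_big /=; field.
have E4 : \sum_z mu z * \tr ((\sum_z' mu z' *: Q z z') *m B z ^+ (2 * s)) <=
    \sum_z mu z * \sum_i beta z i * (B z ^+ (2 * s)) i i.
  apply: ler_sum => z _; rewrite ler_wpM2l //.
  have -> : \sum_i beta z i * (B z ^+ (2 * s)) i i =
      \tr (diag_mx (\row_i beta z i) *m B z ^+ (2 * s)).
    by apply: eq_bigr => i _; rewrite mul_diag_mx !mxE.
  apply: trace_even_pow_le => // x.
  rewrite mulmx_suml dotp_sumr.
  have -> : dotp x (diag_mx (\row_i beta z i) *m x) = \sum_i beta z i * x i 0 ^+ 2.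
    by apply: eq_bigr => i _; rewrite mul_diag_mx !mxE; ring.
  apply: le_trans (betaP z x); rewrite le_eqVlt; apply/orP; left; apply/eqP.
  apply: eq_bigr => z' _; rewrite -scalemxAl dotpZr; congr (_ * _).
  by rewrite /Q -mulmxA dotp_mulmxr symB.
have s0 : (0 : R) < (2 * s).+1%:R by rewrite ltr0n.
rewrite -/(B _).
have := le_trans E2 _; rewrite E1 E3 => /(_ _ (ler_wpM2l (ltW s0) E4)).
rewrite /B; lra.
Qed.

Local Notation E m z F := (Epath (fun _ : T => mu) m z F).

(** Induction on the number of draws. The matrix A collects the summands already
drawn: the new draw is handled by [exchangeable_pair_step] with the rest of the
sum in place of A, the rest by the induction hypothesis. *)
Lemma exchangeable_pair_sum m z0 (A : 'M[R]_d) s : A^T = A ->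
  E m z0 (fun l => \tr (csum l *m (A + csum l) ^+ (2 * s).+1)) <=
  (2 * s).+1%:R / 2 *
  E m z0 (fun l => \sum_i (\sum_(z <- l) beta z i) * ((A + csum l) ^+ (2 * s)) i i).
Proof.
elim: m z0 A => [|m IH] z0 A sA.
  rewrite /= /csum big_nil mul0mx mxtrace0 big1 ?mulr0 // => i _.
  by rewrite big_nil mul0r.
rewrite /=.
have csumE z l : csum (z :: l) = centered z + csum l by rewrite /csum big_cons.
have L z : E m z (fun l => \tr (csum (z :: l) *m (A + csum (z :: l)) ^+ (2 * s).+1)) =
   E m z0 (fun l => \tr (centered z *m (A + csum l + centered z) ^+ (2 * s).+1)) +
   E m z (fun l => \tr (csum l *m (A + centered z + csum l) ^+ (2 * s).+1)).
  have start (F : seq T -> R) z1 z2 : E m z1 F = E m z2 F by case: (m).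
  rewrite (start _ z0 z) -EpathD; apply: Epath_ext => l _.
  rewrite csumE mulmxDl mxtraceD addrA; congr (\tr _ + _).
  by rewrite [A + csum l + _]addrAC.
under eq_bigr do rewrite L mulrDr.
rewrite big_split /=.
have Rr z : E m z (fun l => \sum_i (\sum_(z1 <- z :: l) beta z1 i) *
       ((A + csum (z :: l)) ^+ (2 * s)) i i) =
   E m z0 (fun l => \sum_i beta z i * ((A + csum l + centered z) ^+ (2 * s)) i i) +
   E m z (fun l => \sum_i (\sum_(z1 <- l) beta z1 i) *
       ((A + centered z + csum l) ^+ (2 * s)) i i).
  have start (F : seq T -> R) z1 z2 : E m z1 F = E m z2 F by case: (m).
  rewrite (start _ z0 z) -EpathD; apply: Epath_ext => l _.
  rewrite -big_split /=; apply: eq_bigr => i _; rewrite big_cons mulrDl csumE.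
  by rewrite addrA [A + csum l + _]addrAC.
under [in leRHS]eq_bigr do rewrite Rr mulrDr.
rewrite big_split mulrDr /=; apply: lerD.
  pose F1 z l := \tr (centered z *m (A + csum l + centered z) ^+ (2 * s).+1).
  pose F2 z l := \sum_i beta z i * ((A + csum l + centered z) ^+ (2 * s)) i i.
  rewrite -/(F1 _) -/(F2 _).
  have ex F : \sum_z mu z * E m z0 (F z) = E m z0 (fun l => \sum_z mu z * F z l).
    by rewrite Epath_sum; apply: eq_bigr => z _; rewrite EpathZ.
  rewrite (ex F1) (ex F2) -EpathZ; apply: Epath_le => // l _.
  exact: exchangeable_pair_step (symD sA (csum_sym l)).
rewrite mulr_sumr; apply: ler_sum => z _.
rewrite [leRHS]mulrCA ler_wpM2l //; apply: IH; exact: symD sA (centered_sym z).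
Qed.

Hypothesis beta0 : forall z i, 0 <= beta z i.

(** Young's inequality separates the random variance from the power of the sum, and
the trace moment that it leaves on the right is absorbed by the left-hand side. *)
Lemma iid_trace_moment m z0 s :
  E m z0 (fun l => \tr (csum l ^+ (2 * s.+1))) <=
  \sum_i E m z0 (fun l => ((2 * s).+1%:R / 2 * \sum_(z <- l) beta z i) ^+ s.+1).
Proof.
have := exchangeable_pair_sum m z0 s (trmx0 _ _ _).
set k := (2 * s).+1%:R / 2 : R.
have k0 : 0 <= k by rewrite divr_ge0.
have -> : E m z0 (fun l => \tr (csum l *m (0 + csum l) ^+ (2 * s).+1)) =
    E m z0 (fun l => \tr (csum l ^+ (2 * s.+1))).
  by apply: Epath_ext => l _; rewrite add0r mulmxE -exprS mulnS.
set M := E m z0 _ => h.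
rewrite -Epath_sum.
set W := E m z0 (fun l => \sum_i (k * _) ^+ _).
have : s.+1%:R * (k * E m z0 (fun l => \sum_i (\sum_(z <- l) beta z i) *
    ((0 + csum l) ^+ (2 * s)) i i)) <= W + s%:R * M.
  rewrite /W /M -!EpathZ -EpathD; apply: Epath_le => // l _.
  rewrite add0r /mxtrace !mulr_sumr -big_split /=; apply: ler_sum => i _.
  have v0 : 0 <= k * \sum_(z <- l) beta z i.
    by rewrite mulr_ge0 //; apply: sumr_ge0.
  by have := Young_diag s i (csum_sym l) v0; rewrite -!mulrA.
have s0 : (0 : R) <= s.+1%:R by [].
have := ler_wpM2l s0 h; rewrite -natr1; lra.
Qed.

Lemma iid_prod m z0 (g : T -> R) :
  E m z0 (fun l => \prod_(z <- l) g z) = (\sum_z mu z * g z) ^+ m.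
Proof.
elim: m z0 => [|m IH] z0 /=; first by rewrite big_nil.
rewrite exprS mulr_suml; apply: eq_bigr => z _.
rewrite -mulrA -(IH z); congr (_ * _); rewrite -EpathZ.
by apply: Epath_ext => l _; rewrite big_cons.
Qed.

End IidMatrixMoments.

(** * Matrices attached to transitions *)

Section PairMatrices.
Variables (R : realType) (d : nat) (P : 'M[R]_d) (pi : 'rV[R]_d).
Hypothesis sto : stochastic P.
Hypothesis irr : irreducible P.
Hypothesis stat : stationary P pi.
Hypothesis rev : reversible P pi.
Hypothesis d2 : (2 <= d)%N.
Local Notation pistar := (min_entry pi).
Local Notation L := (Lsym P pi).
Local Notation pair := ('I_d * 'I_d)%type.
Let pi0 i : 0 < pi 0 i. Proof. exact: stationary_gt0 sto irr stat i. Qed.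
Let pistar0 : 0 < pistar. Proof. exact: stationary_min_gt0 sto irr stat d2. Qed.
Let pistarV0 : 0 <= pistar^-1. Proof. by rewrite invr_ge0 ltW. Qed.
Let s0 i : Num.sqrt (pi 0 i) != 0. Proof. exact: sqrtpi_neq0 sto irr stat i. Qed.
Let s2 i : Num.sqrt (pi 0 i) ^+ 2 = pi 0 i. Proof. exact: sqrtpi_sqr stat i. Qed.

Definition pair_law (z : pair) : R := pi 0 z.1 * P z.1 z.2.

(** The contribution of one transition (i, j) to the symmetrized and rescaled
transition counts: a symmetric matrix with mean L under the law pi_i P_ij. *)
Definition pair_mx (z : pair) : 'M[R]_d :=
  (2 * Num.sqrt (pi 0 z.1) * Num.sqrt (pi 0 z.2))^-1 *:
    (delta_mx z.1 z.2 + delta_mx z.2 z.1).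

Lemma pair_law_ge0 z : 0 <= pair_law z.
Proof. by rewrite mulr_ge0 ?(ltW (pi0 _)) // (stochastic_ge0 sto). Qed.

Lemma pair_law_left i : \sum_z pair_law z * (z.1 == i)%:R = pi 0 i.
Proof.
rewrite -(pair_bigA _ (fun a b => pair_law (a, b) * (a == i)%:R)) (bigD1 i) //=.
rewrite [X in _ + X]big1 => [|j ji].
  transitivity (pi 0 i * \sum_j P i j); last by rewrite (stochastic_row_sum sto) mulr1.
  by rewrite addr0 mulr_sumr; apply: eq_bigr => j _; rewrite eqxx mulr1.
by rewrite big1 // => k _; rewrite (negPf ji) mulr0.
Qed.

Lemma pair_law_right i : \sum_z pair_law z * (z.2 == i)%:R = pi 0 i.
Proof.
rewrite -(pair_bigA _ (fun a b => pair_law (a, b) * (b == i)%:R)) exchange_big /=.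
rewrite (bigD1 i) //= [X in _ + X]big1 => [|j ji].
  case: stat => _ _ /(congr1 (fun M : 'rV[R]_d => M 0 i)); rewrite mxE addr0 => e.
  by rewrite -[RHS]e; apply: eq_bigr => j _; rewrite eqxx mulr1.
by rewrite big1 // => k _; rewrite (negPf ji) mulr0.
Qed.

Lemma pair_law_sum1 : \sum_z pair_law z = 1.
Proof.
rewrite -(pair_bigA _ (fun a b => pair_law (a, b))) /= -(stationary_sum1 stat).
apply: eq_bigr => i _; transitivity (\sum_j pi 0 i * P i j); first by [].
by rewrite -mulr_sumr (stochastic_row_sum sto) mulr1.
Qed.

Lemma pair_mx_sym z : (pair_mx z)^T = pair_mx z.
Proof. by apply/matrixP => i j; rewrite !mxE addrC; congr (_ * (_%:R + _%:R)); rewrite andbC. Qed.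

Lemma pair_mx_mean : mean_mx pair_law pair_mx = L.
Proof.
apply/matrixP => a b; rewrite /mean_mx summxE.
pose F (i j : 'I_d) : R := pair_law (i, j) * (2 * Num.sqrt (pi 0 i) * Num.sqrt (pi 0 j))^-1.
have -> : \sum_z (pair_law z *: pair_mx z) a b =
    \sum_i \sum_j F i j * ((a == i) && (b == j))%:R +
    \sum_i \sum_j F i j * ((a == j) && (b == i))%:R.
  rewrite -big_split /= -[LHS](eq_bigr _ (fun z _ => erefl _)).
  rewrite (eq_bigr (fun z : pair => F z.1 z.2 * ((a == z.1) && (b == z.2))%:R +
     F z.1 z.2 * ((a == z.2) && (b == z.1))%:R)); last first.
    by move=> [i j] _; rewrite /F !mxE /=; ring.
  rewrite -(pair_bigA _ (fun i j => F i j * ((a == i) && (b == j))%:R +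
     F i j * ((a == j) && (b == i))%:R)) /=.
  by apply: eq_bigr => i _; rewrite big_split.
have S (G : 'I_d -> 'I_d -> R) i j :
    \sum_k \sum_l G k l * ((i == k) && (j == l))%:R = G i j.
  rewrite (bigD1 i) //= [X in _ + X]big1 => [|k ki]; last first.
    by rewrite big1 // => l _; rewrite eq_sym (negPf ki) mulr0.
  rewrite addr0 (bigD1 j) //= big1 => [|l lj]; last by rewrite eqxx eq_sym (negPf lj) mulr0.
  by rewrite !eqxx mulr1 addr0.
rewrite S exchange_big /= (S (fun k l => F l k)) /F /pair_law /= (rev b a) !mxE.
move: (s2 a) (s0 a) (s0 b); move: (Num.sqrt (pi 0 a)) (Num.sqrt (pi 0 b)) => sa sb <- ha hb.
by field; rewrite ha hb.
Qed.

(** The square of [pair_mx] is at most a diagonal matrix supported on the two states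
of the pair. *)
Lemma pair_mx_norm2 z (x : 'cV[R]_d) :
  dotp (pair_mx z *m x) (pair_mx z *m x) <=
  \sum_i ((z.1 == i)%:R + (z.2 == i)%:R) / (2 * pistar * pi 0 i) * x i 0 ^+ 2.
Proof.
case: z => i j /=.
have dx a b k : ((delta_mx a b : 'M[R]_d) *m x) k 0 = (k == a)%:R * x b 0.
  rewrite mxE (bigD1 b) //= big1 => [|l lb]; last by rewrite mxE (negPf lb) andbF mul0r.
  by rewrite mxE eqxx andbT addr0.
have sum_ind a (F : 'I_d -> R) : \sum_k (a == k)%:R * F k = F a.
  rewrite (bigD1 a) //= big1 => [|k ka]; last by rewrite eq_sym (negPf ka) mul0r.
  by rewrite eqxx mul1r addr0.
have -> : \sum_k ((i == k)%:R + (j == k)%:R) / (2 * pistar * pi 0 k) * x k 0 ^+ 2 =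
    x i 0 ^+ 2 / (2 * pistar * pi 0 i) + x j 0 ^+ 2 / (2 * pistar * pi 0 j).
  rewrite -[RHS](congr2 +%R (sum_ind i (fun k => x k 0 ^+ 2 / (2 * pistar * pi 0 k)))
                          (sum_ind j (fun k => x k 0 ^+ 2 / (2 * pistar * pi 0 k)))).
  by rewrite -big_split /=; apply: eq_bigr => k _; ring.
set c := (2 * Num.sqrt (pi 0 i) * Num.sqrt (pi 0 j))^-1.
apply: (@le_trans _ _ (c ^+ 2 * (2 * x j 0 ^+ 2 + 2 * x i 0 ^+ 2))).
  have -> : 2 * x j 0 ^+ 2 + 2 * x i 0 ^+ 2 =
     \sum_k (i == k)%:R * (2 * x j 0 ^+ 2) + \sum_k (j == k)%:R * (2 * x i 0 ^+ 2).
    by rewrite !sum_ind.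
  rewrite -big_split mulr_sumr; apply: ler_sum => k _ /=.
  have -> : (pair_mx (i, j) *m x) k 0 = c * ((k == i)%:R * x j 0 + (k == j)%:R * x i 0).
    by rewrite /pair_mx -scalemxAl mxE mulmxDl mxE !dx.
  rewrite mulrACA -expr2 ler_wpM2l ?sqr_ge0 // ![k == _]eq_sym.
  have := sqr_ge0 (x i 0 - x j 0); have := sqr_ge0 (x i 0); have := sqr_ge0 (x j 0).
  by case: (i == k); case: (j == k) => /=; rewrite ?mul1r ?mul0r ?expr2; lra.
have -> : c ^+ 2 * (2 * x j 0 ^+ 2 + 2 * x i 0 ^+ 2) =
    x i 0 ^+ 2 / (2 * pi 0 j * pi 0 i) + x j 0 ^+ 2 / (2 * pi 0 i * pi 0 j).
  have e : c ^+ 2 = (4 * pi 0 i * pi 0 j)^-1.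
    by rewrite /c exprVn !exprMn !s2; congr (_ * _ * _)^-1; ring.
  by rewrite e; field; rewrite !gt_eqF.
apply: lerD; rewrite ler_wpM2l ?sqr_ge0 // lef_pV2 ?posrE ?mulr_gt0 //;
  by rewrite ler_pM2r // ler_pM2l // min_entry_le.
Qed.

(** A diagonal matrix above the conditional expectation of the square of the
difference of two independent pair matrices, given the first pair: the visits to i
of the given pair, and a constant for the other pair. *)
Definition pair_weight (z : pair) (i : 'I_d) : R :=
  ((z.1 == i)%:R + (z.2 == i)%:R) / (pistar * pi 0 i) + 2 / pistar.

Lemma pair_weight_ge0 z i : 0 <= pair_weight z i.
Proof.
rewrite addr_ge0 // divr_ge0 ?(ltW pistar0) //.
by rewrite mulr_ge0 // ltW.
Qed.

Lemma pair_weightP z (x : 'cV[R]_d) :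
  \sum_z' pair_law z' * dotp ((pair_mx z - pair_mx z') *m x) ((pair_mx z - pair_mx z') *m x) <=
  \sum_i pair_weight z i * x i 0 ^+ 2.
Proof.
pose b (z : pair) i : R := ((z.1 == i)%:R + (z.2 == i)%:R) / (2 * pistar * pi 0 i).
have h z' : dotp ((pair_mx z - pair_mx z') *m x) ((pair_mx z - pair_mx z') *m x) <=
    \sum_i (2 * b z i + 2 * b z' i) * x i 0 ^+ 2.
  have -> : \sum_i (2 * b z i + 2 * b z' i) * x i 0 ^+ 2 =
     2 * (\sum_i b z i * x i 0 ^+ 2) + 2 * (\sum_i b z' i * x i 0 ^+ 2).
    rewrite !mulr_sumr -big_split /=; apply: eq_bigr => i _; ring.
  have h1 : dotp (pair_mx z *m x) (pair_mx z *m x) <= \sum_i b z i * x i 0 ^+ 2.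
    exact: pair_mx_norm2.
  have h2 : dotp (pair_mx z' *m x) (pair_mx z' *m x) <= \sum_i b z' i * x i 0 ^+ 2.
    exact: pair_mx_norm2.
  rewrite mulmxBl; move: h1 h2; set f := pair_mx z *m x; set g := pair_mx z' *m x.
  have := dotp_ge0 (f + g); rewrite !(dotpBl, dotpBr) !(dotpDl, dotpDr) (dotpC g f).
  move: (dotp f f) (dotp f g) (dotp g g) (\sum_i _) (\sum_i _) => u v w p q; lra.
apply: (@le_trans _ _ (\sum_z' pair_law z' * \sum_i (2 * b z i + 2 * b z' i) * x i 0 ^+ 2)).
  by apply: ler_sum => z' _; rewrite ler_wpM2l ?pair_law_ge0.
under eq_bigr do rewrite mulr_sumr.
rewrite exchange_big /=; apply: ler_sum => i _.
under eq_bigr do rewrite mulrA.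
rewrite -mulr_suml ler_wpM2r ?sqr_ge0 //.
under eq_bigr do rewrite mulrDr.
rewrite big_split /= -mulr_suml pair_law_sum1 mul1r.
have -> : \sum_z' pair_law z' * (2 * b z' i) =
   (\sum_z' pair_law z' * (z'.1 == i)%:R + \sum_z' pair_law z' * (z'.2 == i)%:R)
     / (pistar * pi 0 i).
  rewrite -big_split /= mulr_suml; apply: eq_bigr => z' _; rewrite /b.
  by field; rewrite !gt_eqF.
rewrite pair_law_left pair_law_right /pair_weight /b le_eqVlt; apply/orP; left; apply/eqP.
by field; rewrite !gt_eqF.
Qed.

Local Notation E m z F := (Epath (fun _ : pair => pair_law) m z F).

(** e^y = (e^(-y/2))^(-2) <= (1 - y/2)^(-2). *)
Lemma expR_le_linear (y : R) : 0 <= y <= 1 -> expR y <= 1 + 4 * y.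
Proof.
move=> /andP[y0 y1].
have -> : expR y = (expR (- (y / 2)) ^+ 2)^-1.
  by rewrite -expRM_natl -expRN; congr expR; field.
have h := expR_ge1Dx (- (y / 2)).
have h0 : 0 < 1 + - (y / 2) by lra.
have h1 : 0 < 1 + 4 * y by lra.
rewrite invf_ple ?posrE ?exprn_gt0 ?expR_gt0 //.
apply: (@le_trans _ _ ((1 + - (y / 2)) ^+ 2)); last by rewrite lerXn2r ?nnegrE ?expR_ge0 // ltW.
rewrite -div1r ler_pdivrMr // -subr_ge0.
have -> : (1 + - (y / 2)) ^+ 2 * (1 + 4 * y) - 1 = y * (3 - 15 / 4 * y + y ^+ 2) by field.
rewrite mulr_ge0 //.
have -> : 3 - 15 / 4 * y + y ^+ 2 = (1 - y) * (11 / 4 - y) + 1 / 4 by field.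
by rewrite addr_ge0 // mulr_ge0 //; lra.
Qed.

(** Over m pairs the diagonal entry at i is m / pistar times T + 2, where T is the
number of visits to i divided by its scale m pi_i. Since T + 2 <= e^(T + 1), its
p-th moment is controlled by an exponential moment of a sum of independent terms,
which is bounded as soon as 2 p <= m pistar. *)
Lemma pair_weight_moment m z0 (i : 'I_d) (k : R) p : (0 < m)%N -> 0 <= k ->
  (2 * p)%:R <= m%:R * pistar ->
  E m z0 (fun l => (k * \sum_(z <- l) pair_weight z i) ^+ p) <=
  (k * (m%:R / pistar)) ^+ p * expR (9 * p%:R).
Proof.
move=> m0 k0 pm.
have mR : (0 : R) < m%:R by rewrite ltr0n.
pose s : R := p%:R / (m%:R * pi 0 i).
pose c (z : pair) : R := (z.1 == i)%:R + (z.2 == i)%:R.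
have s0' : 0 <= s by rewrite divr_ge0 // ltW // mulr_gt0.
have s1 : s <= 2^-1.
  rewrite ler_pdivrMr ?mulr_gt0 // -ler_pdivrMl ?invr_gt0 // invrK.
  rewrite -natrM (le_trans pm) // ler_pM2l //; exact: min_entry_le.
apply: (@le_trans _ _ (E m z0 (fun l => (k * (m%:R / pistar)) ^+ p * expR p%:R *
    \prod_(z <- l) expR (s * c z)))).
  apply: Epath_le => [_ z|l lm]; first exact: pair_law_ge0.
  have -> : \prod_(z <- l) expR (s * c z) = expR (s * \sum_(z <- l) c z).
    by rewrite mulr_sumr; elim: (l) => [|z r IH]; rewrite ?big_nil ?expR0 // !big_cons IH expRD.
  have -> : \sum_(z <- l) pair_weight z i =
     m%:R / pistar * ((\sum_(z <- l) c z) / (m%:R * pi 0 i) + 2).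
    rewrite /pair_weight big_split /= -mulr_suml big_const_seq count_predT lm iter_addr addr0.
    rewrite -[_ *+ m]mulr_natl /c; field; rewrite !gt_eqF //.
  set S := \sum_(z <- l) c z.
  have S0 : 0 <= S by apply: sumr_ge0 => z _; rewrite addr_ge0.
  rewrite mulrA [leLHS]exprMn -[leRHS]mulrA ler_wpM2l ?exprn_ge0 ?mulr_ge0 ?pistarV0 //.
  rewrite -expRD.
  have -> : p%:R + s * S = (S / (m%:R * pi 0 i) + 1) * p%:R.
    by rewrite /s; field; rewrite !gt_eqF.
  rewrite expRM_natr lerXn2r ?nnegrE ?expR_ge0 //.
    by rewrite addr_ge0 // divr_ge0 // mulr_ge0 // ltW.
  have := expR_ge1Dx (S / (m%:R * pi 0 i) + 1); lra.
rewrite EpathZ iid_prod.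
have -> : expR (9 * p%:R) = expR p%:R * expR (8 * p%:R / m%:R) ^+ m :> R.
  by rewrite -expRM_natl -expRD; congr expR; field; rewrite gt_eqF.
rewrite mulrA ler_wpM2l ?mulr_ge0 ?expR_ge0 ?exprn_ge0 ?mulr_ge0 ?pistarV0 //.
have g0 z : 0 <= pair_law z * expR (s * c z) by rewrite mulr_ge0 ?pair_law_ge0 ?expR_ge0.
rewrite lerXn2r ?nnegrE ?expR_ge0 ?sumr_ge0 //.
apply: (@le_trans _ _ (1 + 8 * p%:R / m%:R)); last exact: expR_ge1Dx.
have -> : 1 + 8 * p%:R / m%:R = \sum_z pair_law z * (1 + 4 * (s * c z)).
  have -> : 8 * p%:R / m%:R = 4 * s * (\sum_z pair_law z * (z.1 == i)%:R +
      \sum_z pair_law z * (z.2 == i)%:R).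
    by rewrite pair_law_left pair_law_right /s; field; rewrite !gt_eqF.
  transitivity (\sum_z pair_law z + 4 * s * (\sum_z pair_law z * (z.1 == i)%:R +
      \sum_z pair_law z * (z.2 == i)%:R)); first by rewrite pair_law_sum1.
  rewrite mulrDr !mulr_sumr -!big_split /=.
  by apply: eq_bigr => z _; rewrite /c; ring.
apply: ler_sum => z _; rewrite ler_wpM2l ?pair_law_ge0 // expR_le_linear //.
rewrite mulr_ge0 ?addr_ge0 //=.
have : c z <= 2.
  rewrite /c; case: (z.1 == i); case: (z.2 == i) => /=; lra.
have c0 : 0 <= c z by rewrite addr_ge0.
have : s * c z <= 2^-1 * c z by rewrite ler_wpM2r.
lra.
Qed.

Lemma pair_trace_moment m z0 p : (0 < m)%N -> (0 < p)%N -> (2 * p)%:R <= m%:R * pistar ->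
  E m z0 (fun l => \tr (csum pair_law pair_mx l ^+ (2 * p))) <=
  d%:R * ((p%:R * (m%:R / pistar)) ^+ p * expR (9 * p%:R)).
Proof.
case: p => // s m0 _ pm.
apply: le_trans (iid_trace_moment pair_law_ge0 pair_law_sum1 pair_mx_sym pair_weightP
  pair_weight_ge0 m z0 s) _.
have dE (X : R) : d%:R * X = \sum_(i < d) X by rewrite sumr_const card_ord mulr_natl.
rewrite dE; apply: ler_sum => i _.
have k0 : 0 <= (2 * s).+1%:R / 2 :> R by rewrite divr_ge0.
apply: le_trans (pair_weight_moment z0 i m0 k0 pm) _.
have kp : (2 * s).+1%:R / 2 <= s.+1%:R :> R.
  rewrite ler_pdivrMr // -natrM ler_nat.
  by lia.
have mp : 0 <= m%:R / pistar by rewrite mulr_ge0 ?pistarV0.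
rewrite ler_wpM2r ?expR_ge0 // lerXn2r ?nnegrE ?(mulr_ge0 k0 mp) ?(mulr_ge0 _ mp) //.
by rewrite ler_wpM2r.
Qed.

Definition step_pair (i0 : 'I_d) (s : seq 'I_d) (t : nat) : pair :=
  (nth i0 s t, nth i0 s t.+1).

(** Between two sampled pairs the chain makes h unobserved steps, so the state in
which the next pair begins has a conditional law of at most c pi. Induction on the
number of pairs. *)
Lemma sampled_pairs_domination (i0 : 'I_d) h (c : R) (mix : forall t i j, (h <= t)%N ->
    (P ^+ t) i j <= c * pi 0 j) (c0 : 0 <= c) m N x t0 z0 (G : seq pair -> R) :
  (forall l, 0 <= G l) -> (h <= t0)%N -> (t0 + h.+1 * m <= N + h)%N ->
  Epath P N x (fun s => G (mkseq (fun k => step_pair i0 (x :: s) (t0 + h.+1 * k)) m)) <=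
  c ^+ m * E m z0 G.
Proof.
elim: m N x t0 z0 G => [|m IH] N x t0 z0 G G0 ht hN.
  rewrite expr0 mul1r /=; under Epath_ext do rewrite /mkseq /=.
  by rewrite (Epath_cst (stochastic_row_sum sto)).
have [N' NE] : exists N', N = (t0 + N'.+1)%N.
  exists (N - t0.+1)%N; rewrite -subSn; first by rewrite subSS subnKC //; lia.
  by lia.
rewrite {}NE in hN *; rewrite Epath_cat.
pose Phi (z : 'I_d) := \sum_y P z y * Epath P N' y (fun r2 =>
  G ((z, y) :: mkseq (fun k => step_pair i0 (y :: r2) (h + h.+1 * k)) m)).
have PhiE s1 : size s1 = t0 -> Epath P N'.+1 (last x s1) (fun s' =>
    G (mkseq (fun k => step_pair i0 (x :: s1 ++ s') (t0 + h.+1 * k)) m.+1)) =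
    Phi (last x s1).
  move=> st; rewrite /=; apply: eq_bigr => y _; congr (_ * _); apply: Epath_ext => r2 _.
  congr G; rewrite /mkseq /= muln0 addn0; congr (_ :: _).
    rewrite /step_pair /= -cat_cons; congr (_, _).
      by rewrite nth_cat /= st ltnSn -st (last_nth i0).
    by rewrite nth_cat st ltnn subnn.
  rewrite -[1%N]/(0.+1) (iotaDl 1 0) -map_comp; apply/eq_map => k /=.
  rewrite /step_pair; have -> : (t0 + h.+1 * (1 + k) = t0.+1 + (h + h.+1 * k))%N by lia.
  have nthE j : nth i0 ((x :: s1) ++ (y :: r2)) (t0.+1 + j) = nth i0 (y :: r2) j.
    have e : size (x :: s1) = t0.+1 by rewrite /= st.
    by rewrite nth_cat e ltnNge leq_addr addKn.
  by rewrite -cat_cons -addnS !nthE.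
rewrite (@Epath_ext _ _ _ _ _ _ (fun s1 => Phi (last x s1))) // Epath_last.
have Phi0 z : 0 <= Phi z.
  apply: sumr_ge0 => y _; rewrite mulr_ge0 ?(stochastic_ge0 sto) //; apply: Epath_ge0 => // s *.
  exact: (stochastic_ge0 sto).
apply: (@le_trans _ _ (\sum_z c * pi 0 z * Phi z)).
  by apply: ler_sum => z _; rewrite ler_wpM2r // mix.
have K0 (x' y' : pair) : 0 <= pair_law y' by exact: pair_law_ge0.
have Ez z1 z2 (F : seq pair -> R) : E m z1 F = E m z2 F by case: (m).
apply: (@le_trans _ _ (\sum_z \sum_y c ^+ m.+1 *
   (pair_law (z, y) * E m (z, y) (fun l => G ((z, y) :: l))))).
  apply: ler_sum => z _; rewrite /Phi mulr_sumr; apply: ler_sum => y _.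
  have := IH N' y h (z, y) (fun l => G ((z, y) :: l)) (fun _ => G0 _) (leqnn h).
  set A := Epath P N' y _; set B := E m (z, y) _ => h1.
  have -> : c * pi 0 z * (P z y * A) = c * (pair_law (z, y) * A).
    by rewrite /pair_law /=; ring.
  have -> : c ^+ m.+1 * (pair_law (z, y) * B) = c * (pair_law (z, y) * (c ^+ m * B)).
    by rewrite exprS; ring.
  by rewrite ler_wpM2l // ler_wpM2l ?pair_law_ge0 // h1 //; lia.
rewrite (pair_bigA _ (fun z y => c ^+ m.+1 *
   (pair_law (z, y) * E m (z, y) (fun l => G ((z, y) :: l))))) /= mulr_sumr.
by apply: ler_sum => -[z y] _.
Qed.
End PairMatrices.

(** * Concentration of the average transition matrix *)

Lemma big_nat_residues (V : nmodType) (F : nat -> V) h a m :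
  \sum_(h <= t < h + a * m) F t = \sum_(r < a) \sum_(k < m) F (h + r + a * k)%N.
Proof.
elim: m => [|m IH].
  by rewrite muln0 addn0 big_geq // big1 // => r _; rewrite big_ord0.
rewrite mulnS [(a + _)%N]addnC addnA (big_cat_nat (n := h + a * m)) ?leq_addr //= IH.
under [RHS]eq_bigr do rewrite big_ord_recr /=.
rewrite big_split /=; congr (_ + _).
rewrite -{1}[(h + a * m)%N]add0n big_addn addKn big_mkord; apply: eq_bigr => r _.
by congr F; lia.
Qed.

Section MatrixConcentration.
Variables (R : realType) (d : nat) (P : 'M[R]_d) (pi : 'rV[R]_d).
Hypothesis sto : stochastic P.
Hypothesis irr : irreducible P.
Hypothesis aper : aperiodic P.
Hypothesis stat : stationary P pi.
Hypothesis rev : reversible P pi.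
Hypothesis d2 : (2 <= d)%N.
Local Notation gap := (spectral_gap P).
Local Notation pistar := (min_entry pi).
Local Notation pair := ('I_d * 'I_d)%type.
Let pi0 i : 0 < pi 0 i. Proof. exact: stationary_gt0 sto irr stat i. Qed.
Let pistar0 : 0 < pistar. Proof. exact: stationary_min_gt0 sto irr stat d2. Qed.
Let pistar1 : pistar <= 2^-1. Proof. exact: stationary_min_le_half sto irr stat d2. Qed.
Let pistarV0 : 0 <= pistar^-1. Proof. by rewrite invr_ge0 ltW. Qed.
Local Notation centered_pair := (centered (pair_law P pi) (pair_mx pi)).

Lemma pair_mx_qbound z : qbound (pair_mx pi z) pistar^-1.
Proof.
move=> x; have xx := dotp_ge0 x.
rewrite -ler_sqr ?nnegrE ?mulr_ge0 // real_normK ?num_real //.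
apply: (le_trans (Cauchy_Schwarz_dotp _ _)).
rewrite exprMn [dotp x x ^+ 2]expr2 mulrCA ler_wpM2l //.
apply: (le_trans (pair_mx_norm2 sto irr stat d2 z x)).
rewrite mulr_sumr; apply: ler_sum => i _; rewrite -expr2 ler_wpM2r ?sqr_ge0 //.
apply: (@le_trans _ _ (2 / (2 * pistar * pi 0 i))).
  rewrite ler_wpM2r ?invr_ge0 ?mulr_ge0 ?(ltW pistar0) ?(ltW (pi0 i)) //.
  by case: (z.1 == i); case: (z.2 == i) => /=; lra.
have -> : 2 / (2 * pistar * pi 0 i) = pistar^-1 * (pi 0 i)^-1.
  by field; rewrite !gt_eqF.
by rewrite expr2 ler_wpM2l // lef_pV2 ?posrE // min_entry_le.
Qed.

Lemma centered_pair_qbound z : qbound (centered_pair z) (2 / pistar).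
Proof.
rewrite /centered pair_mx_mean //.
apply: qbound_le (qboundD (pair_mx_qbound z) (qboundN (Lsym_qbound sto irr aper stat rev d2))).
have : 1 <= pistar^-1 by rewrite invf_ge1 // (le_trans pistar1) //; lra.
lra.
Qed.

Variables (i0 : 'I_d) (N : nat) (x : 'I_d).

(** The sum over the N transitions of the path x :: s; i0 is the default value of
[nth]. *)
Definition path_deviation (s : seq 'I_d) : 'M[R]_d :=
  \sum_(t < N) centered_pair (step_pair i0 (x :: s) t).

(** The pairs at the times h + r, h + r + (h + 1), ...: the first h steps bring the
chain close to stationarity. *)
Definition residue_pairs h m r (s : seq 'I_d) : seq pair :=
  mkseq (fun k => step_pair i0 (x :: s) (h + r + h.+1 * k)) m.

Definition residue_moment h m p (s : seq 'I_d) : R :=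
  \sum_(r < h.+1)
    \tr (csum (pair_law P pi) (pair_mx pi) (residue_pairs h m r s) ^+ (2 * p)).

Lemma csum_mkseq (f : nat -> pair) m :
  csum (pair_law P pi) (pair_mx pi) (mkseq f m) = \sum_(k < m) centered_pair (f k).
Proof.
rewrite /csum /mkseq big_map -(big_mkord xpredT (fun k => centered_pair (f k))).
by rewrite /index_iota subn0.
Qed.

(** At most 2 (h + 1) transitions at the two ends of the path are not sampled; each
of them contributes at most 2 / pistar. The residue classes are summed with
[qbound_trace_pow]. *)
Lemma path_deviation_qbound h m p s (e : R) : (0 < p)%N -> 0 < e ->
  (h.+1 * m.+1 <= N.+1 < h.+1 * m.+2)%N ->
  residue_moment h m p s <= h.+1%:R * e ^+ (2 * p) ->
  qbound (path_deviation s) (2 * h.+1%:R * e + 4 * h.+1%:R / pistar).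
Proof.
move=> p0 e0 /andP[Nlo Nhi] W.
have hN : (h + h.+1 * m <= N)%N by lia.
pose F t := centered_pair (step_pair i0 (x :: s) t).
(* the h first transitions, the sampled ones, and at most h last ones *)
have split : path_deviation s = \sum_(0 <= t < h) F t +
    \sum_(h <= t < h + h.+1 * m) F t + \sum_(h + h.+1 * m <= t < N) F t.
  rewrite /path_deviation -(big_mkord xpredT F).
  rewrite (big_cat_nat (n := h + h.+1 * m)) //=; congr (_ + _).
  by rewrite (big_cat_nat (n := h)) //= leq_addr.
have short u v : qbound (\sum_(u <= t < v) F t) ((v - u)%:R * (2 / pistar)).
  have -> : (v - u)%:R * (2 / pistar) = \sum_(u <= t < v) (2 / pistar).
    by rewrite sumr_const_nat mulr_natl.
  by apply: qbound_sum => t _; exact: centered_pair_qbound.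
have middle : qbound (\sum_(h <= t < h + h.+1 * m) F t) (2 * h.+1%:R * e).
  rewrite big_nat_residues.
  pose tr r := \tr (csum (pair_law P pi) (pair_mx pi) (residue_pairs h m r s) ^+ (2 * p)).
  apply: (@qbound_le _ _ _ (\sum_(r < h.+1) (e + e * (tr r / e ^+ (2 * p))))).
    rewrite big_split /= sumr_const card_ord -mulr_sumr -mulr_suml.
    have : \sum_(r < h.+1) tr r / e ^+ (2 * p) <= h.+1%:R.
      by rewrite -mulr_suml ler_pdivrMr ?exprn_gt0.
    rewrite -mulr_suml => /(ler_wpM2l (ltW e0)).
    rewrite -[e *+ _]mulr_natr; lra.
  apply: qbound_sum => r _.
  have -> : \sum_(k < m) F (h + r + h.+1 * k)%N =
      csum (pair_law P pi) (pair_mx pi) (residue_pairs h m r s) by rewrite csum_mkseq.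
  apply: qbound_trace_pow => //.
  by apply: csum_sym; exact: pair_mx_sym.
rewrite split; apply: qbound_le (qboundD (qboundD (short 0 h) middle) (short _ _)).
rewrite subn0.
have : (h + (N - (h + h.+1 * m)) <= 2 * h.+1)%N by lia.
rewrite -(ler_nat R) natrD natrM => hle.
have := ler_wpM2r (_ : 0 <= 2 / pistar) hle; rewrite divr_ge0 ?(ltW pistar0) // => /(_ isT).
lra.
Qed.

Lemma residue_moment_ge0 h m p s : 0 <= residue_moment h m p s.
Proof.
apply: sumr_ge0 => r _; apply: trace_even_pow_ge0.
by apply: csum_sym; exact: pair_mx_sym.
Qed.

(** (1 - gap)^h <= e^(-gap h) <= pistar / n. *)
Lemma mixing_time_bound h t i j : ln (N.+1%:R / pistar) <= gap * h%:R -> (h <= t)%N ->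
  (P ^+ t) i j <= (1 + N.+1%:R^-1) * pi 0 j.
Proof.
move=> hh ht; apply: le_trans (transition_le_stationary sto irr aper stat rev d2 t i j) _.
rewrite mulrC ler_wpM2r ?(ltW (pi0 j)) // lerD2l ler_pdivrMr //.
have /andP[l0 l1] := subgap_itv sto irr aper stat rev d2.
apply: (@le_trans _ _ ((1 - gap) ^+ h)).
  by rewrite ler_wiXn2l // ltW.
apply: (@le_trans _ _ (expR (- (gap * h%:R)))).
  rewrite mulrC -mulrN expRM_natl lerXn2r ?nnegrE ?expR_ge0 //; exact: expR_ge1Dx.
apply: (@le_trans _ _ (expR (- ln (N.+1%:R / pistar)))); first by rewrite ler_expR lerN2.
by rewrite expRN lnK ?posrE ?divr_gt0 ?ltr0n // invf_div mulrC.
Qed.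

(** The factor (1 + 1/n)^m lost in the domination is at most e because m <= n. *)
Lemma residue_moment_expectation h m p : (0 < m)%N -> (0 < p)%N ->
  (2 * p)%:R <= m%:R * pistar -> (h.+1 * m.+1 <= N.+1)%N ->
  ln (N.+1%:R / pistar) <= gap * h%:R ->
  Epath P N x (residue_moment h m p) <=
  h.+1%:R * (expR 1 * (d%:R * ((p%:R * (m%:R / pistar)) ^+ p * expR (9 * p%:R)))).
Proof.
move=> m0 p0 pm hN hh; rewrite /residue_moment Epath_sum.
have hE (X : R) : h.+1%:R * X = \sum_(i < h.+1) X by rewrite sumr_const card_ord mulr_natl.
rewrite hE; apply: ler_sum => r _.
have n0 : (0 : R) < N.+1%:R by rewrite ltr0n.
have c0 : 0 <= 1 + N.+1%:R^-1 :> R by rewrite addr_ge0 // invr_ge0.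
have trge0 l : 0 <= \tr (csum (pair_law P pi) (pair_mx pi) l ^+ (2 * p)).
  by apply: trace_even_pow_ge0; apply: csum_sym; exact: pair_mx_sym.
have := @sampled_pairs_domination _ _ P pi sto irr stat d2 i0 h (1 + N.+1%:R^-1)
  (fun t i j ht => mixing_time_bound i j hh ht) c0 m N x (h + r) (x, x)
  (fun l => \tr (csum (pair_law P pi) (pair_mx pi) l ^+ (2 * p))) trge0 (leq_addr _ _).
have rh := ltn_ord r.
have hle : (h + r + h.+1 * m <= N + h)%N.
  by move: hN rh; clear; lia.
move=> /(_ hle) h1; apply: (le_trans h1).
apply: ler_pM; [by rewrite exprn_ge0| | |].
- by apply: Epath_ge0 => // _ z; exact: pair_law_ge0.
- apply: (@le_trans _ _ (expR (N.+1%:R^-1) ^+ m)).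
    by rewrite lerXn2r ?nnegrE ?expR_ge0 // expR_ge1Dx.
  rewrite -expRM_natl ler_expR ler_pdivrMr // mul1r ler_nat.
  by rewrite (leq_trans _ hN) // (leq_trans (leqnSn m)) // leq_pmull.
exact: pair_trace_moment.
Qed.

(** Markov's inequality for the trace moments: e is chosen such that the expected
moment is below its threshold by a factor of order exp (2 p) / d. *)
Lemma matrix_concentration h m p (e : R) : (0 < m)%N -> (0 < p)%N ->
  (2 * p)%:R <= m%:R * pistar -> (h.+1 * m.+1 <= N.+1 < h.+1 * m.+2)%N ->
  ln (N.+1%:R / pistar) <= gap * h%:R ->
  0 < e -> e ^+ 2 = expR 11 * (p%:R * (m%:R / pistar)) ->
  exists B : seq 'I_d -> bool,
    Epath P N x (fun s => (B s)%:R) <= expR 1 * d%:R * expR (- (2 * p%:R)) /\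
    forall s, ~~ B s ->
      qbound (path_deviation s) (2 * h.+1%:R * e + 4 * h.+1%:R / pistar).
Proof.
move=> m0 p0 pm hN hh e0 e2.
exists (fun s => h.+1%:R * e ^+ (2 * p) < residue_moment h m p s); split; last first.
  by move=> s; rewrite -leNgt; exact: path_deviation_qbound.
have hE : 0 < h.+1%:R * e ^+ (2 * p) by rewrite mulr_gt0 ?ltr0n // exprn_gt0.
apply: le_trans (@Epath_Markov _ _ _ (stochastic_ge0 sto) _ _ _ (residue_moment h m p) _ hE _ _) _.
- by move=> s _; exact: residue_moment_ge0.
- by move=> s _ /ltW.
rewrite ler_pdivrMr //.
have /andP[hN1 _] := hN.
apply: le_trans (residue_moment_expectation m0 p0 pm hN1 hh) _.
rewrite exprM e2 le_eqVlt; apply/orP; left; apply/eqP.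
set Y := p%:R * _.
have -> : (expR 11 * Y) ^+ p = expR (p%:R * 11) * Y ^+ p by rewrite exprMn expRM_natl.
have -> : expR (p%:R * 11) = expR (9 * p%:R) * expR (2 * p%:R) :> R.
  by rewrite -expRD; congr expR; ring.
have -> : expR (- (2 * p%:R)) = (expR (2 * p%:R))^-1 :> R by rewrite expRN.
by field; rewrite gt_eqF // expR_gt0.
Qed.

End MatrixConcentration.

(** * From concentration to the plug-in estimators *)

Lemma pihat_count (R : realType) d n (X : nat -> 'I_d) i :
  pihat R n X 0 i = (count_mem i (mkseq X n))%:R / n%:R.
Proof.
rewrite mxE; congr (_%:R / _).
rewrite /mkseq count_map -sum1_count -sum1_card.
transitivity (\sum_(t < n | X t == i) 1)%N; first by apply: eq_bigl => t; rewrite inE.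
by rewrite -(big_mkord (fun t => X t == i) (fun=> 1%N)) /index_iota subn0.
Qed.

Section Perturbation.
Variables (R : realType) (d : nat) (P : 'M[R]_d) (pi : 'rV[R]_d).
Hypothesis sto : stochastic P.
Hypothesis irr : irreducible P.
Hypothesis aper : aperiodic P.
Hypothesis stat : stationary P pi.
Hypothesis rev : reversible P pi.
Hypothesis d2 : (2 <= d)%N.
Local Notation gap := (spectral_gap P).
Local Notation L := (Lsym P pi).
Let gap0 : 0 < gap. Proof. by case/andP: (gap_itv sto irr aper stat rev d2). Qed.
Let pi0 i : 0 < pi 0 i. Proof. exact: stationary_gt0 sto irr stat i. Qed.
Let s0 i : Num.sqrt (pi 0 i) != 0. Proof. exact: sqrtpi_neq0 sto irr stat i. Qed.

Variables (n : nat) (X : nat -> 'I_d).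
Local Notation M := (Mhat R n X).
Local Notation q := (pihat R n X).

Definition rescaled_Mhat : 'M[R]_d :=
  \matrix_(a, b) ((M a b + M b a) / (2 * Num.sqrt (pi 0 a) * Num.sqrt (pi 0 b))).

Lemma rescaled_MhatE : rescaled_Mhat =
  n.-1%:R^-1 *: \sum_(t < n.-1) pair_mx pi (X t, X t.+1).
Proof.
apply/matrixP => a b; rewrite [LHS]mxE [RHS]mxE summxE.
have ME c e : M c e = n.-1%:R^-1 * \sum_(t < n.-1) ((X t == c) && (X t.+1 == e))%:R.
  rewrite mxE mulrC; congr (_ * _); rewrite -sum1_card natr_sum big_mkcond /=.
  by apply: eq_bigr => t _; rewrite inE xpair_eqE; case: (_ && _).
rewrite !ME -mulrDr -mulrA; congr (_ * _); rewrite -big_split /= mulr_suml.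
apply: eq_bigr => t _; rewrite !mxE /= ![_ == X _]eq_sym.
rewrite [(X t.+1 == a) && _]andbC mulrDl mulrDr; congr (_ + _).
  case: (boolP (_ && _)) => [/andP[/eqP <- /eqP <-]|_]; last by rewrite mul0r mulr0.
  by rewrite mul1r mulr1.
case: (boolP (_ && _)) => [/andP[/eqP <- /eqP <-]|_]; last by rewrite mul0r mulr0.
by rewrite mul1r mulr1; congr (_^-1); ring.
Qed.

Definition rescaling (i : 'I_d) : R := Num.sqrt (pi 0 i) / Num.sqrt (q 0 i).

(** Replacing pi by the empirical frequencies in the normalization multiplies rows
and columns by the [rescaling] factors. *)
Lemma Sym_LhatE : Sym (Lhat R n X) =
  \matrix_(a, b) (rescaling a * rescaled_Mhat a b * rescaling b).
Proof.
apply/matrixP => a b.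
have LE c e : Lhat R n X c e = (Num.sqrt (q 0 c))^-1 * M c e * (Num.sqrt (q 0 e))^-1.
  by rewrite /Lhat mul_mx_diag mxE mul_diag_mx mxE [X in X * _ * _]mxE [X in _ * _ * X]mxE.
rewrite [LHS]mxE [X in _ * X = _]mxE [X in _ * (_ + X) = _]mxE !LE [RHS]mxE.
rewrite [rescaled_Mhat a b]mxE /rescaling; move: (M a b) (M b a) => u v.
move: (Num.sqrt (q 0 a))^-1 (Num.sqrt (q 0 b))^-1 => w z.
by field; rewrite !s0.
Qed.

Variables (eta delta1 : R).
Hypothesis eta_half : eta <= 2^-1.
Hypothesis freq_close : forall i, `|q 0 i - pi 0 i| <= eta * pi 0 i.
Hypothesis mx_close : qbound (rescaled_Mhat - L) delta1.

Lemma pihat_gt0 i : 0 < q 0 i.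
Proof.
have := freq_close i => /ler_normlP [h _].
have : eta * pi 0 i <= 2^-1 * pi 0 i by rewrite ler_pM2r.
have := pi0 i; move: (q 0 i) (pi 0 i) h => u v h; lra.
Qed.

Lemma rescaling_gt0 i : 0 < rescaling i.
Proof. by rewrite divr_gt0 // sqrtr_gt0 // pihat_gt0. Qed.

Lemma rescaling_sqr i : rescaling i ^+ 2 * q 0 i = pi 0 i.
Proof.
have q0 := pihat_gt0 i.
rewrite /rescaling exprMn exprVn !sqr_sqrtr ?ltW //.
by rewrite divfK // gt_eqF.
Qed.

(** With r for the factor, (r - 1) (r + 1) q_i = pi_i - q_i, and
(r + 1) q_i >= r^2 q_i = pi_i because r <= 3/2. *)
Lemma rescaling_close i : `|rescaling i - 1| <= eta /\ rescaling i ^+ 2 <= 2.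
Proof.
have r0 := rescaling_gt0 i; have := rescaling_sqr i; have p0 := pi0 i.
have := freq_close i => /ler_normlP [h1 h2].
move: (rescaling i) r0 => r r0; move: (q 0 i) (pi 0 i) p0 h1 h2 => u v v0 h1 h2 e.
have eh : eta * v <= 2^-1 * v by rewrite ler_pM2r.
have u0 : 2^-1 * v <= u by lra.
have r2 : r ^+ 2 <= 2.
  have : r ^+ 2 * (2^-1 * v) <= r ^+ 2 * u by rewrite ler_wpM2l ?sqr_ge0.
  rewrite e => h; rewrite -(ler_pM2r v0); lra.
split => //.
have e0 : 0 <= eta by rewrite -(pmulr_lge0 _ v0) (le_trans (normr_ge0 (u - v))) // ler_norml; apply/andP; split; lra.
have up : 0 < u by lra.
have k : (r - 1) * ((r + 1) * u) = v - u by rewrite -e; ring.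
have r3 : v <= (r + 1) * u.
  rewrite -e ler_pM2r //.
  have r32 : r <= 3 / 2.
    rewrite leNgt; apply/negP => r32.
    have : 0 < (r - 3 / 2) * (r + 3 / 2) by rewrite mulr_gt0 //; lra.
    rewrite expr2 in r2; lra.
  have : 0 <= (3 / 2 - r) * r by rewrite mulr_ge0 //; lra.
  rewrite expr2; lra.
rewrite ler_norml; apply/andP; split.
- case: (lerP 1 r) => r1; first by lra.
  have : (1 - r) * v <= (1 - r) * ((r + 1) * u) by rewrite ler_wpM2l // subr_ge0 ltW.
  move=> h; rewrite -(ler_pM2r v0); lra.
- case: (lerP r 1) => r1; first by lra.
  have : (r - 1) * v <= (r - 1) * ((r + 1) * u) by rewrite ler_wpM2l // subr_ge0 ltW.
  move=> h; rewrite -(ler_pM2r v0); lra.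
Qed.

Lemma eta_ge0 : (0 < d)%N -> 0 <= eta.
Proof.
move=> d0; have [h _] := rescaling_close (Ordinal d0).
exact: le_trans (normr_ge0 _) h.
Qed.

(** With y = G x, the form of G A G - L at x is that of A - L at y plus
<y - x, L (y + x)>, and |y - x| <= eta |x|, |y + x| <= 3 |x|. *)
Lemma Sym_Lhat_close : 0 <= delta1 -> qbound (Sym (Lhat R n X) - L) (2 * delta1 + 3 * eta).
Proof.
move=> d10 x; have e0 := eta_ge0 (ltnW d2).
pose y : 'cV[R]_d := \col_i (rescaling i * x i 0).
have -> : dotp x ((Sym (Lhat R n X) - L) *m x) =
    dotp y ((rescaled_Mhat - L) *m y) + dotp (y - x) (L *m (y + x)).
  have -> : dotp x ((Sym (Lhat R n X) - L) *m x) =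
      dotp y (rescaled_Mhat *m y) - dotp x (L *m x).
    rewrite mulmxBl dotpBr; congr (_ - _); rewrite Sym_LhatE.
    apply: eq_bigr => i _; rewrite [in LHS]mxE [(rescaled_Mhat *m y) i 0]mxE [y i 0]mxE.
    rewrite !mulr_sumr; apply: eq_bigr => k _; rewrite [y k 0]mxE.
    by rewrite [X in _ * (X * _) = _]mxE; ring.
  rewrite mulmxBl mulmxDr !(dotpBl, dotpBr) !dotpDr.
  have -> : dotp x (L *m y) = dotp y (L *m x).
    by rewrite dotp_mulmxr (Lsym_sym sto irr stat rev) dotpC.
  ring.
have yy : dotp y y <= 2 * dotp x x.
  rewrite mulr_sumr; apply: ler_sum => i _; rewrite [y i 0]mxE.
  have [_ h] := rescaling_close i.
  have -> : rescaling i * x i 0 * (rescaling i * x i 0) = rescaling i ^+ 2 * (x i 0 * x i 0).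
    by ring.
  by rewrite ler_wpM2r // -expr2 sqr_ge0.
have yx : dotp (y - x) (y - x) <= eta ^+ 2 * dotp x x.
  rewrite mulr_sumr; apply: ler_sum => i _; rewrite !mxE.
  have [h _] := rescaling_close i.
  have -> : (rescaling i * x i 0 - x i 0) * (rescaling i * x i 0 - x i 0) =
     (rescaling i - 1) ^+ 2 * (x i 0 * x i 0) by ring.
  rewrite ler_wpM2r // -?expr2 ?sqr_ge0 // -real_normK ?num_real //.
  by rewrite lerXn2r ?nnegrE.
have yx' : dotp (y + x) (y + x) <= 9 * dotp x x.
  rewrite mulr_sumr; apply: ler_sum => i _; rewrite !mxE.
  have [_ h] := rescaling_close i.
  have -> : (rescaling i * x i 0 + x i 0) * (rescaling i * x i 0 + x i 0) =
     (rescaling i + 1) ^+ 2 * (x i 0 * x i 0) by ring.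
  rewrite ler_wpM2r // -?expr2 ?sqr_ge0 //.
  have := sqr_ge0 (rescaling i - 1); rewrite sqrrB sqrrD; lra.
rewrite mulrDl (le_trans (ler_normD _ _)) // lerD //.
  apply: (le_trans (mx_close y)); have := ler_wpM2l d10 yy; lra.
rewrite -ler_sqr ?nnegrE ?mulr_ge0 ?dotp_ge0 // real_normK ?num_real //.
apply: (le_trans (Cauchy_Schwarz_dotp _ _)).
have L1 := qbound_mulmx_sqr (y + x) (Lsym_sym sto irr stat rev)
  (Lsym_qbound sto irr aper stat rev d2).
rewrite expr1n mul1r in L1.
have -> : (3 * eta * dotp x x) ^+ 2 = eta ^+ 2 * dotp x x * (9 * dotp x x) by ring.
by apply: ler_pM; rewrite ?dotp_ge0 // (le_trans L1).
Qed.

Lemma min_max_close (a b a' b' e : R) : `|a - a'| <= e -> `|b - b'| <= e ->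
  Num.max a' `|b'| <= 1 ->
  `|(1 - Num.min 1 (Num.max a `|b|)) - (1 - Num.max a' `|b'|)| <= e.
Proof.
move=> /ler_normlP[h1 h2] hb h1m.
have : `| `|b| - `|b'| | <= e by apply: le_trans hb; exact: ler_dist_dist.
move=> /ler_normlP[h3 h4].
move: h1m; rewrite ge_max => /andP[m1 m2].
rewrite ler_norml; case: (leP a `|b|) => c1; case: (leP a' `|b'|) => c2;
  case: (leP 1 _) => c3; apply/andP; split; lra.
Qed.

Lemma gap_hat_close : 0 <= delta1 -> `|gap_hat R n X - gap| <= 2 * delta1 + 3 * eta.
Proof.
move=> d10; rewrite /gap_hat; case: existsP => [[i /eqP qi]|_].
  by have := pihat_gt0 i; rewrite qi ltxx.
have c := Sym_Lhat_close d10.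
have c' : qbound (L - Sym (Lhat R n X)) (2 * delta1 + 3 * eta).
  by rewrite -opprB; exact: qboundN.
have sA : (Sym (Lhat R n X))^T = Sym (Lhat R n X).
  by apply/matrixP => a b; rewrite !mxE addrC.
have sL := Lsym_sym sto irr stat rev.
have gE : gap = 1 - Num.max (second_eigenvalue L) `|last_eigenvalue L|.
  rewrite /spectral_gap /second_eigenvalue /last_eigenvalue.
  by rewrite (Lsym_similar sto irr stat).
rewrite gE; apply: min_max_close.
- move: sA sL c c'; move: (Sym _) (L) => A B.
  case: (d) d2 A B => [//|[//|d'] _ A B sA sB c c'].
  have := second_eigenvalue_perturb sA sB c; have := second_eigenvalue_perturb sB sA c'.
  rewrite ler_norml => h1 h2; apply/andP; split; lra.
- move: sA sL c c'; move: (Sym _) (L) => A B.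
  case: (d) d2 A B => [//|d' _ A B sA sB c c'].
  have := last_eigenvalue_perturb sA sB c; have := last_eigenvalue_perturb sB sA c'.
  rewrite ler_norml => h1 h2; apply/andP; split; lra.
- by have := gap0; rewrite gE; lra.
Qed.
End Perturbation.

Section MinEntry.
Variables (R : realType) (d : nat) (p q : 'rV[R]_d).
Hypothesis d2 : (2 <= d)%N.
Hypothesis p01 : forall i, 0 <= p 0 i <= 1.
Hypothesis q01 : forall i, 0 <= q 0 i <= 1.

(** Only the lower bound on the minimum of q needs an argument. Writing s^2 for p_j
and k^2 for K, the bound s^2 - c s k is increasing in s once 2 s >= c k; if the
minimum of p is too small for this, it is at most c^2 K itself. *)
Lemma min_entry_close (c K : R) : 1 <= c -> 0 <= K ->
  (forall i, `|q 0 i - p 0 i| <= c * (Num.sqrt (p 0 i * K) + K)) ->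
  `|min_entry q - min_entry p| <= c ^+ 2 * (Num.sqrt (min_entry p * K) + K).
Proof.
move=> c1 K0 h.
have p1 i : p 0 i <= 1 by case/andP: (p01 i).
have q1 i : q 0 i <= 1 by case/andP: (q01 i).
have [i pi_] := min_entry_attained d2 p1; have [j qj] := min_entry_attained d2 q1.
have mp k : min_entry p <= p 0 k by exact: min_entry_le.
have mq k : min_entry q <= q 0 k by exact: min_entry_le.
have p0 : 0 <= min_entry p by rewrite pi_; case/andP: (p01 i).
have q0 : 0 <= min_entry q by rewrite qj; case/andP: (q01 j).
have cc : c <= c ^+ 2 by rewrite expr2 ler_peMl // (le_trans _ c1).
have S0 := sqrtr_ge0 (min_entry p * K).
have cS : c * (Num.sqrt (min_entry p * K) + K) <= c ^+ 2 * (Num.sqrt (min_entry p * K) + K).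
  by rewrite ler_wpM2r // addr_ge0.
rewrite ler_norml; apply/andP; split; last first.
  have := h i => /ler_normlP [_]; have := mq i; rewrite -pi_; lra.
have := h j => /ler_normlP [hj _]; rewrite -qj in hj.
rewrite !sqrtrM ?(le_trans p0 (mp j)) // in hj cS S0 *.
have mj := mp j.
set r := Num.sqrt (min_entry p) in hj cS S0 *; set s := Num.sqrt (p 0 j) in hj.
set k := Num.sqrt K in hj cS S0 *.
have k0 : 0 <= k by exact: sqrtr_ge0.
have kk : k ^+ 2 = K by rewrite sqr_sqrtr.
have rr : r ^+ 2 = min_entry p by rewrite sqr_sqrtr.
have ss : s ^+ 2 = p 0 j by rewrite sqr_sqrtr // (le_trans p0).
have r0 : 0 <= r by exact: sqrtr_ge0.
have s0 : 0 <= s by exact: sqrtr_ge0.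
have rs : r <= s by rewrite ler_sqrt // (le_trans p0).
(* r and s are the square roots of the minimum of p and of p_j *)
have [big|small] := lerP (c * k) (s + r).
  have : 0 <= (s - r) * (s + r - c * k) by rewrite mulr_ge0 // subr_ge0.
  move: hj cS; rewrite -rr -ss !expr2; lra.
have rc : r <= c * k by lra.
have : r ^+ 2 <= (c * k) ^+ 2 by rewrite lerXn2r ?nnegrE // (le_trans r0 rc).
have : 0 <= c ^+ 2 * (r * k) by rewrite mulr_ge0 ?sqr_ge0 // mulr_ge0.
rewrite exprMn kk rr; lra.
Qed.
End MinEntry.

(** * Choice of the parameters *)

Lemma ln_ge_half (R : realType) (y : R) : 2 <= y -> 2^-1 <= ln y.
Proof.
move=> y2; apply: (@le_trans _ _ (ln 2)).
  have := @ln1D_ge R 1; rewrite -[1 + 1]/(2 : R) => h.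
  by apply: le_trans (h _); [rewrite div1r|lra].
by rewrite ler_ln ?posrE //; lra.
Qed.

Lemma expR1_le4 (R : realType) : expR 1 <= 4 :> R.
Proof.
have h := expR_ge1Dx (- 2^-1 : R).
have -> : expR 1 = (expR (- 2^-1) ^+ 2)^-1 :> R.
  by rewrite -expRM_natl -expRN; congr expR; field.
rewrite invf_ple ?posrE ?exprn_gt0 ?expR_gt0 //.
have : 0 <= (expR (- 2^-1) - 2^-1 : R) * (expR (- 2^-1) + 2^-1).
  by rewrite mulr_ge0 //; lra.
rewrite expr2; lra.
Qed.

(** The numbers needed by [matrix_concentration]: Q is log (n / pistar), h + 1 the
number of residue classes, m the number of transitions sampled in each of them,
and 2 p the order of the moments. *)
Lemma block_parameters (R : realType) (ps g D Q Ln : R) (n : nat) :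
  0 < ps <= 2^-1 -> 0 < g <= 1 -> 2^-1 <= D -> 2^-1 <= Q -> Q <= Ln ->
  1000 * (D * Ln) <= ps * g * n%:R ->
  exists h m p : nat, [/\ (0 < m)%N, (0 < p)%N, (2 * p)%:R <= m%:R * ps &
    (h.+1 * m.+1 <= n < h.+1 * m.+2)%N] /\
    [/\ Q <= g * h%:R, h.+1%:R <= 5 * (Ln / g), 2 * D <= p%:R & p%:R <= 4 * D].
Proof.
move=> /andP[ps0 ps1] /andP[g0 g1] D2 Q2 QL big.
have D0 : 0 < D by lra.
have L0 : 0 < Ln by lra.
have Qg : 0 <= Q / g by rewrite divr_ge0 ?ltW //; lra.
(* h exceeds Q / g, and p exceeds 2 D, by at most 1 *)
pose h := (Num.truncn (Q / g)).+1.
have /andP[hlo hhi] : (h.-1)%:R <= Q / g < h%:R by apply: truncn_itv.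
pose p := (Num.truncn (2 * D)).+1.
have /andP[plo phi] : (p.-1)%:R <= 2 * D < p%:R by apply: truncn_itv; lra.
have hQ : Q <= g * h%:R by rewrite mulrC -ler_pdivrMr // ltW.
have gi : 1 <= g^-1 by rewrite invf_ge1.
have Lg : Q / g <= Ln / g by rewrite ler_wpM2r // invr_ge0 ltW.
have hE : h%:R = (h.-1)%:R + 1 :> R by rewrite natr1.
have pE : p%:R = (p.-1)%:R + 1 :> R by rewrite natr1.
have a5 : h.+1%:R <= 5 * (Ln / g).
  rewrite -natr1 hE.
  have : 2^-1 * 1 <= Q / g by rewrite ler_pM //; lra.
  lra.
have p4 : p%:R <= 4 * D by rewrite pE; lra.
pose a := h.+1; have a0 : (0 < a)%N by [].
have aR : (0 : R) < a%:R by rewrite ltr0n.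
have Dps : 2^-1 * 2 <= D / ps.
  apply: ler_pM => //; rewrite -[2]invrK lef_pV2 ?posrE ?invr_gt0 //.
have na : 200 * (D / ps) * a%:R <= n%:R.
  have : 200 * (D / ps) * a%:R <= 200 * (D / ps) * (5 * (Ln / g)).
    by rewrite ler_wpM2l //; lra.
  move=> /le_trans; apply.
  have -> : 200 * (D / ps) * (5 * (Ln / g)) = 1000 * (D * Ln) / (ps * g).
    by field; rewrite !gt_eqF.
  by rewrite ler_pdivrMr ?mulr_gt0 // [n%:R * _]mulrC.
have n2a : (2 * a <= n)%N.
  rewrite -(ler_nat R) natrM; apply: le_trans na; rewrite ler_wpM2r ?(ltW aR) //; lra.
pose m := (n %/ a).-1.
have q2 : (2 <= n %/ a)%N by rewrite leq_divRL.
have mE : (m.+1 = n %/ a)%N by rewrite /m prednK // ltnW.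
have m0 : (0 < m)%N by rewrite -ltnS mE.
have nlo : (a * m.+1 <= n)%N by rewrite mE mulnC leq_divM.
have nhi : (n < a * m.+2)%N by rewrite mE mulnC ltn_ceil.
exists h, m, p; split; last by split => //; exact: ltW.
split => //; last by rewrite nlo nhi.
have : n%:R <= a%:R * m.+2%:R :> R by rewrite -natrM ler_nat ltnW.
have -> : m.+2%:R = m%:R + 2 :> R by rewrite -natrD addn2.
rewrite [a%:R * _]mulrC => /(le_trans na); rewrite ler_pM2r // => mlo.
have mps : (200 * (D / ps)) * ps <= (m%:R + 2) * ps by rewrite ler_wpM2r // ltW.
have e : D / ps * ps = D by rewrite divfK // gt_eqF.
rewrite -mulrA e in mps; rewrite natrM; lra.
Qed.

(** The first summand serves the frequencies, 1536 = 3 * 512 the rescaling by the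
frequencies, and 160 + 40 e^6 = 2 (80 + 20 e^6) the matrix deviation. *)
Definition gap_constant (R : realType) : R := 128 ^+ 2 + (1696 + 40 * expR 6).

Lemma gap_constant_ge (R : realType) : 128 ^+ 2 <= gap_constant R.
Proof.
apply: ler_wpDr (lexx _); apply: addr_ge0; first exact: ler0n.
by apply: mulr_ge0; [exact: ler0n|exact: expR_ge0].
Qed.

Lemma gap_constant_ge1 (R : realType) : 1 <= gap_constant R.
Proof.
apply: le_trans (gap_constant_ge R); apply: exprn_ege1; rewrite ler1n.
by [].
Qed.

Section Assembly.
Variables (R : realType) (d : nat) (P : 'M[R]_d) (pi : 'rV[R]_d).
Hypothesis sto : stochastic P.
Hypothesis irr : irreducible P.
Hypothesis aper : aperiodic P.
Hypothesis stat : stationary P pi.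
Hypothesis rev : reversible P pi.
Hypothesis d2 : (2 <= d)%N.
Local Notation gap := (spectral_gap P).
Local Notation pistar := (min_entry pi).
Let gap0 : 0 < gap. Proof. by case/andP: (gap_itv sto irr aper stat rev d2). Qed.
Let gap1 : gap <= 1. Proof. by case/andP: (gap_itv sto irr aper stat rev d2). Qed.
Let pi0 i : 0 < pi 0 i. Proof. exact: stationary_gt0 sto irr stat i. Qed.
Let pi1 i : pi 0 i <= 1. Proof. exact: stationary_le1 stat i. Qed.
Let pistar0 : 0 < pistar. Proof. exact: stationary_min_gt0 sto irr stat d2. Qed.
Let pistar1 : pistar <= 2^-1. Proof. exact: stationary_min_le_half sto irr stat d2. Qed.
Let dR : (2 : R) <= d%:R. Proof. by rewrite ler_nat. Qed.

Variables (N : nat) (delta : R) (i0 x : 'I_d).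
Hypothesis delta01 : 0 < delta < 1.
Local Notation n := N.+1.
Let nR : (0 : R) < n%:R. Proof. by rewrite ltr0n. Qed.
Let n1 : (1 : R) <= n%:R. Proof. by rewrite ler1n. Qed.
Let delta0 : 0 < delta. Proof. by case/andP: delta01. Qed.
Let delta1 : delta < 1. Proof. by case/andP: delta01. Qed.

Definition log_state : R := ln (1 / (pistar * delta)).
Definition log_dim : R := ln (d%:R / delta).
Definition log_time : R := ln (n%:R / (pistar * delta)).
Definition effective_noise : R := log_state / (gap * n%:R).
Definition gap_rate : R := Num.sqrt (log_dim * log_time / (pistar * gap * n%:R)).
Local Notation K := effective_noise.

Let psd0 : 0 < pistar * delta. Proof. by rewrite mulr_gt0. Qed.
Let psd1 : pistar * delta <= 2^-1.
Proof. by rewrite -[leRHS]mulr1; apply: ler_pM => //; exact: ltW. Qed.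

Let inv2 (y : R) : 0 < y -> y <= 2^-1 -> 2 <= 1 / y.
Proof. by move=> y0 y2; rewrite div1r -[2]invrK lef_pV2 ?posrE ?invr_gt0. Qed.

Lemma log_state_ge : 2^-1 <= log_state.
Proof. by apply: ln_ge_half; exact: inv2. Qed.

Lemma log_dim_ge : 2^-1 <= log_dim.
Proof.
apply: ln_ge_half; rewrite ler_pdivlMr // (le_trans _ dR) //.
by rewrite ler_piMr // ltW.
Qed.

Lemma log_time_ge_state : log_state <= log_time.
Proof.
by rewrite ler_ln ?posrE ?divr_gt0 // ler_wpM2r // invr_ge0 ltW.
Qed.

Lemma log_time_ge : ln (n%:R / pistar) <= log_time.
Proof.
rewrite ler_ln ?posrE ?divr_gt0 // ler_wpM2l ?(ltW nR) // lef_pV2 ?posrE //.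
by rewrite ler_piMr // ltW.
Qed.

Lemma effective_noise_gt0 : 0 < K.
Proof. by rewrite divr_gt0 ?mulr_gt0 // (lt_le_trans _ log_state_ge). Qed.

Definition frequencies_deviate (s : seq 'I_d) : bool :=
  [exists i : 'I_d,
     freq_radius pi i K <= `|(count_mem i (x :: s))%:R / n%:R - pi 0 i|].

Lemma frequencies_deviate_prob :
  Epath P N x (fun s => (frequencies_deviate s)%:R) <= delta / 2.
Proof.
apply: le_trans (frequency_deviation sto irr aper stat rev d2 N x effective_noise_gt0) _.
have -> : n%:R * gap * K = log_state.
  by rewrite /effective_noise; field; rewrite !gt_eqF.
have -> : expR (- (6 * log_state)) = (pistar * delta) ^+ 6.
  rewrite -mulrN expRM_natl expRN lnK ?posrE ?divr_gt0 // div1r invrK //.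
have dp : d%:R <= pistar^-1.
  by rewrite -[leRHS]mul1r ler_pdivlMr // mulrC (stationary_min_card stat).
apply: (@le_trans _ _ (pistar^-1 * (4 / pistar * (pistar * delta) ^+ 6))).
  by rewrite ler_wpM2r // mulr_ge0 ?exprn_ge0 ?divr_ge0 // ltW.
have -> : pistar^-1 * (4 / pistar * (pistar * delta) ^+ 6) =
   4 * pistar ^+ 4 * (delta ^+ 5 * delta).
  by field; rewrite gt_eqF.
have p4 : pistar ^+ 4 <= 2^-1 ^+ 4 by rewrite lerXn2r ?nnegrE // ltW.
have d5 : delta ^+ 5 <= 1 by rewrite exprn_ile1 // ltW.
have d5' : delta ^+ 5 * delta <= delta by rewrite ler_piMl // ltW.
have -> : delta / 2 = (4 * 8^-1) * delta by field.
apply: ler_pM => //.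
- by rewrite mulr_ge0 // exprn_ge0 // ltW.
- by rewrite mulr_ge0 ?exprn_ge0 // ltW.
rewrite ler_pM2l //; apply: (le_trans p4); rewrite !exprS expr0; lra.
Qed.

Local Notation X s := (nth i0 (x :: s)).

Lemma pihat_frequency s i : size s = N ->
  pihat R n (X s) 0 i = (count_mem i (x :: s))%:R / n%:R.
Proof.
move=> sN; rewrite pihat_count; congr (_%:R / _); congr (count _ _).
have -> : n = size (x :: s) by rewrite /= sN.
by rewrite mkseq_nth.
Qed.

Lemma frequencies_close s i : size s = N -> ~~ frequencies_deviate s ->
  `|pihat R n (X s) 0 i - pi 0 i| <= freq_radius pi i K.
Proof.
move=> sN; rewrite /frequencies_deviate negb_exists => /forallP/(_ i).
by rewrite -ltNge pihat_frequency // => /ltW.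
Qed.

Lemma pistar_hat_close s : size s = N -> ~~ frequencies_deviate s ->
  `|pistar_hat R n (X s) - pistar| <= 128 ^+ 2 * (Num.sqrt (pistar * K) + K).
Proof.
move=> sN fd; rewrite /pistar_hat.
apply: min_entry_close => //.
- by move=> i; rewrite pi1 ltW.
- move=> i; rewrite pihat_frequency //; apply/andP; split; first by rewrite divr_ge0.
  rewrite ler_pdivrMr // mul1r ler_nat.
  by rewrite (leq_trans (count_size _ _)) //= sN.
- by lra.
- exact: ltW effective_noise_gt0.
- by move=> i; exact: frequencies_close.
Qed.


Let E0 : 0 <= gap_rate. Proof. exact: sqrtr_ge0. Qed.
Let D2 := log_dim_ge.
Let S2 := log_state_ge.
Let T2 : 2^-1 <= log_time. Proof. exact: le_trans log_state_ge log_time_ge_state. Qed.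

Lemma gap_rate_sqr : gap_rate ^+ 2 * (pistar * gap * n%:R) = log_dim * log_time.
Proof.
rewrite sqr_sqrtr ?divfK //; first by rewrite gt_eqF // !mulr_gt0.
have D0 := D2; have T0 := T2.
by rewrite divr_ge0 ?mulr_ge0 ?(ltW gap0) ?(ltW pistar0) //; lra.
Qed.

Hypothesis small : gap_constant R * gap_rate < 1.

Let E1 : gap_rate < 1 / 1024.
Proof.
have : 1024 * gap_rate <= gap_constant R * gap_rate.
  rewrite ler_wpM2r // /gap_constant expr2; have := expR_ge0 (6 : R); lra.
have := small; lra.
Qed.

(** Since K / pistar is at most (2 rate)^2, the absolute deviations become relative
ones. *)
Lemma relative_frequency_close s i : size s = N -> ~~ frequencies_deviate s ->
  `|pihat R n (X s) 0 i - pi 0 i| <= (512 * gap_rate) * pi 0 i.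
Proof.
move=> sN fd; apply: (le_trans (frequencies_close i sN fd)).
(* log_dim >= 1/2 and log_state <= log_time *)
have Kle : K <= pistar * (2 * gap_rate) ^+ 2.
  rewrite /effective_noise ler_pdivrMr ?mulr_gt0 //.
  have -> : pistar * (2 * gap_rate) ^+ 2 * (gap * n%:R) =
    4 * (gap_rate ^+ 2 * (pistar * gap * n%:R)) by ring.
  rewrite gap_rate_sqr.
  have : 2^-1 * log_time <= log_dim * log_time by rewrite ler_wpM2r //; have := T2; lra.
  have := log_time_ge_state; have := T2; lra.
have Kle' : K <= pi 0 i * (2 * gap_rate) ^+ 2.
  by apply: (le_trans Kle); rewrite ler_wpM2r ?sqr_ge0 // min_entry_le.
have p0 := pi0 i.
have h1 : Num.sqrt (pi 0 i * K) <= 2 * gap_rate * pi 0 i.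
  rewrite -[leRHS]ger0_norm; last by rewrite !mulr_ge0 // ltW.
  rewrite -sqrtr_sqr ler_wsqrtr //.
  have -> : (2 * gap_rate * pi 0 i) ^+ 2 = pi 0 i * (pi 0 i * (2 * gap_rate) ^+ 2) by ring.
  by rewrite ler_pM2l.
have h2 : pi 0 i * (2 * gap_rate) ^+ 2 <= pi 0 i * (2 * gap_rate).
  rewrite ler_pM2l // expr2 ler_piMl ?mulr_ge0 //; have := E1; lra.
rewrite /freq_radius; lra.
Qed.

Lemma gap_hat_close_whp : exists B : seq 'I_d -> bool,
  Epath P N x (fun s => (B s)%:R) <= delta / 2 /\
  forall s, size s = N -> ~~ frequencies_deviate s -> ~~ B s ->
    `|gap_hat R n (X s) - gap| <= gap_constant R * gap_rate.
Proof.
have C1 : 1000 * (log_dim * log_time) <= pistar * gap * n%:R.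
  rewrite -gap_rate_sqr.
  have E100 : gap_rate <= 1 / 100 by have := E1; lra.
  have E2 : gap_rate ^+ 2 <= 1 / 100 * (1 / 100).
    by rewrite expr2; apply: ler_pM.
  have w0 : 0 <= pistar * gap * n%:R by rewrite !mulr_ge0 // ltW.
  have := ler_wpM2r w0 E2; lra.
have Q2 : 2^-1 <= ln (n%:R / pistar).
  apply: ln_ge_half; apply: (le_trans (inv2 pistar0 pistar1)).
  by rewrite ler_wpM2r // invr_ge0 ltW.
have ps01 : 0 < pistar <= 2^-1 by apply/andP.
have g01 : 0 < gap <= 1 by apply/andP.
have [h [m [p [[m0 p0 pm hN] [Qh a5 p2 p4]]]]] :=
  block_parameters ps01 g01 D2 Q2 log_time_ge C1.
pose e : R := Num.sqrt (expR 11 * (p%:R * (m%:R / pistar))).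
have pR : (0 : R) < p%:R by rewrite ltr0n.
have mR : (0 : R) < m%:R by rewrite ltr0n.
have e20 : 0 < expR 11 * (p%:R * (m%:R / pistar)).
  by rewrite mulr_gt0 ?expR_gt0 // mulr_gt0 // divr_gt0.
have e0 : 0 < e by rewrite sqrtr_gt0.
have e2 : e ^+ 2 = expR 11 * (p%:R * (m%:R / pistar)) by rewrite sqr_sqrtr // ltW.
have [B [BP BQ]] := matrix_concentration sto irr aper stat rev d2 i0 x m0 p0 pm hN Qh e0 e2.
exists B; split.
  apply: (le_trans BP).
  have d0 : (0 : R) < d%:R by apply: lt_le_trans dR.
  apply: (@le_trans _ _ (4 * d%:R * (delta / d%:R) ^+ 4)).
    apply: ler_pM; rewrite ?mulr_ge0 ?expR_ge0 //.
      by rewrite ler_wpM2r ?expR1_le4 // ltW.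
    apply: (@le_trans _ _ (expR (- (4 * log_dim)))); first by rewrite ler_expR; lra.
    by rewrite -mulrN expRM_natl expRN lnK ?posrE ?divr_gt0 // invf_div.
  have -> : 4 * d%:R * (delta / d%:R) ^+ 4 = 4 * (delta ^+ 3 * delta) / d%:R ^+ 3.
    by field; rewrite gt_eqF.
  rewrite ler_pdivrMr ?exprn_gt0 //.
  have d3 : delta ^+ 3 <= 1 by rewrite exprn_ile1 // ltW.
  have d3' : delta ^+ 3 * delta <= delta by rewrite ler_piMl // ltW.
  have d8 : 2 ^+ 3 <= d%:R ^+ 3 :> R by rewrite lerXn2r ?nnegrE // ltW.
  have : delta / 2 * 2 ^+ 3 <= delta / 2 * d%:R ^+ 3.
    by rewrite ler_wpM2l // divr_ge0 // ltW.
  have -> : delta / 2 * 2 ^+ 3 = 4 * delta by field.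
  lra.
move=> s sN fd nB.
have N0 : (0 < N)%N.
  have /andP[h1 _] := hN; rewrite -ltnS (leq_trans _ h1) // (leq_trans (_ : 2 <= m.+1)%N) //.
  by rewrite leq_pmull.
have NR : (0 : R) < N%:R by rewrite ltr0n.
have nN : n%:R <= 2 * N%:R :> R.
  have : (1 : R) <= N%:R by rewrite ler1n.
  by rewrite -[n%:R]natr1; lra.
set a : R := h.+1%:R in a5 BQ.
have aR : 0 < a by rewrite ltr0n.
have am : a * m%:R <= n%:R.
  have /andP[h1 _] := hN; rewrite -natrM ler_nat (leq_trans _ h1) // leq_mul2l leqnSn orbT //.
have Lps : log_time / gap / pistar <= 2 * (n%:R * gap_rate).
  have -> : log_time / gap / pistar = log_time / (pistar * gap) by field; rewrite !gt_eqF.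
  rewrite ler_pdivrMr ?mulr_gt0 //.
  have : 2^-1 * log_time <= log_dim * log_time by rewrite ler_wpM2r //; have := T2; lra.
  rewrite -gap_rate_sqr.
  have : gap_rate * gap_rate <= gap_rate.
    by rewrite ler_piMl //; have := E1; lra.
  have w0 : 0 <= pistar * gap * n%:R by rewrite !mulr_ge0 // ltW.
  move=> /(ler_wpM2r w0); rewrite expr2; lra.
have ae : a * e <= 5 * expR 6 * (n%:R * gap_rate).
  rewrite -ler_sqr ?nnegrE; last 2 first.
  - by rewrite mulr_ge0 // ltW.
  - by rewrite !mulr_ge0 ?expR_ge0 // ltW.
  rewrite exprMn e2.
  have -> : a ^+ 2 * (expR 11 * (p%:R * (m%:R / pistar))) =
      expR 11 * (a * m%:R) * (a * (p%:R / pistar)) by ring.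
  apply: (@le_trans _ _ (expR 11 * n%:R * (5 * (log_time / gap) * (4 * log_dim / pistar)))).
    apply: ler_pM.
    - by rewrite mulr_ge0 ?expR_ge0 // mulr_ge0 // ltW.
    - by rewrite mulr_ge0 ?(ltW aR) // divr_ge0 // ltW.
    - by rewrite ler_wpM2l ?expR_ge0.
    - apply: ler_pM => //; first by rewrite divr_ge0 // ltW.
      by rewrite ler_wpM2r // invr_ge0 ltW.
  have -> : expR 11 * n%:R * (5 * (log_time / gap) * (4 * log_dim / pistar)) =
      20 * expR 11 * (n%:R * gap_rate) ^+ 2.
    have -> : 5 * (log_time / gap) * (4 * log_dim / pistar) =
       20 * (log_dim * log_time) / (pistar * gap) by field; rewrite !gt_eqF.
    by rewrite -gap_rate_sqr; field; rewrite !gt_eqF.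
  rewrite [leRHS]exprMn ler_wpM2r ?sqr_ge0 // exprMn.
  have -> : expR 6 ^+ 2 = expR 12 :> R by rewrite -expRM_natl; congr expR; lra.
  have : expR 11 <= expR 12 :> R by rewrite ler_expR; lra.
  have := expR_ge0 (11 : R); rewrite expr2; lra.
pose delta_mat := (20 * expR 6 + 80) * gap_rate.
have delta_mat0 : 0 <= delta_mat.
  by rewrite mulr_ge0 // addr_ge0 // mulr_ge0 // expR_ge0.
have close : qbound (rescaled_Mhat pi n (X s) - Lsym P pi) delta_mat.
  have -> : rescaled_Mhat pi n (X s) - Lsym P pi = N%:R^-1 *: path_deviation P pi i0 N x s.
    rewrite rescaled_MhatE /path_deviation /centered sumrB sumr_const card_ord.
    rewrite (pair_mx_mean sto irr stat rev) scalerBr -[Lsym P pi *+ N]scaler_nat scalerA mulVf ?gt_eqF //.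
    by rewrite scale1r.
  apply: qbound_le (qboundZ _ (BQ s nB)).
  rewrite gtr0_norm ?invr_gt0 // mulrC ler_pdivrMr //.
  have h1 : a / pistar <= 10 * (n%:R * gap_rate).
    have : a / pistar <= 5 * (log_time / gap) / pistar by rewrite ler_wpM2r // invr_ge0 ltW.
    lra.
  have h2 : n%:R * gap_rate <= 2 * N%:R * gap_rate by rewrite ler_wpM2r.
  have h3 : (10 * expR 6 + 40) * (n%:R * gap_rate) <= (10 * expR 6 + 40) * (2 * N%:R * gap_rate).
    by rewrite ler_wpM2l // addr_ge0 // mulr_ge0 // expR_ge0.
  have -> : 2 * a * e + 4 * a / pistar = 2 * (a * e) + 4 * (a / pistar) by ring.
  have -> : delta_mat * N%:R = (10 * expR 6 + 40) * (2 * N%:R * gap_rate).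
    by rewrite /delta_mat; ring.
  lra.
have eta_half : 512 * gap_rate <= 2^-1 by have := E1; lra.
have := gap_hat_close sto irr aper stat rev d2 eta_half
  (fun i => relative_frequency_close i sN fd) close delta_mat0.
move=> /le_trans; apply.
have -> : 2 * delta_mat + 3 * (512 * gap_rate) = (1696 + 40 * expR 6) * gap_rate.
  by rewrite /delta_mat; ring.
by rewrite ler_wpM2r // /gap_constant lerDr sqr_ge0.
Qed.

End Assembly.

(** * Accuracy of the estimators with high probability *)

Lemma Mhat_ext (R : realType) d n (x y : nat -> 'I_d) :
  (forall t, (t < n)%N -> x t = y t) -> Mhat R n x = Mhat R n y.
Proof.
move=> h; apply/matrixP => i j; rewrite !mxE; congr (_%:R / _).
apply: eq_card => t; rewrite !inE; have tn := ltn_ord t.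
by rewrite !h //; lia.
Qed.

Lemma pihat_ext (R : realType) d n (x y : nat -> 'I_d) :
  (forall t, (t < n)%N -> x t = y t) -> pihat R n x = pihat R n y.
Proof.
move=> h; apply/matrixP => i j; rewrite !mxE; congr (_%:R / _).
by apply: eq_card => t; rewrite !inE h.
Qed.

Lemma gap_hat_ext (R : realType) d n (x y : nat -> 'I_d) :
  (forall t, (t < n)%N -> x t = y t) -> gap_hat R n x = gap_hat R n y.
Proof.
by move=> h; rewrite /gap_hat /Lhat (Mhat_ext R h) (pihat_ext R h).
Qed.

Section Deviation.
Variables (R : realType) (d : nat) (P : 'M[R]_d) (pi : 'rV[R]_d).
Hypothesis sto : stochastic P.
Hypothesis irr : irreducible P.
Hypothesis aper : aperiodic P.
Hypothesis stat : stationary P pi.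
Hypothesis rev : reversible P pi.
Hypothesis d2 : (2 <= d)%N.
Local Notation gap := (spectral_gap P).
Local Notation pistar := (min_entry pi).

(** The two estimates with natural logarithms; a change of base only changes the
constant. The argument n.-1 of [log_time] is the number of transitions. *)
Definition accurate (n : nat) (delta : R) (x : nat -> 'I_d) : Prop :=
  `|pistar_hat R n x - pistar| <=
    128 ^+ 2 * (Num.sqrt (pistar * (log_state pi delta / (gap * n%:R)))
             + log_state pi delta / (gap * n%:R)) /\
  `|gap_hat R n x - gap| <= gap_constant R *
    Num.sqrt (log_dim d delta * log_time pi n.-1 delta / (pistar * gap * n%:R)).

Lemma gap_hat_trivial n (x : nat -> 'I_d) : `|gap_hat R n x - gap| <= 1.
Proof.
have /andP[g0 g1] := gap_itv sto irr aper stat rev d2.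
have /andP[h0 h1] : 0 <= gap_hat R n x <= 1.
  rewrite /gap_hat; case: ifP => _; first by rewrite lexx ler01.
  set m := Num.min _ _.
  have m1 : m <= 1 by rewrite /m ge_min lexx.
  have m0 : 0 <= m by rewrite /m le_min ler01 le_max normr_ge0 orbT.
  by apply/andP; split; lra.
by rewrite ler_norml; apply/andP; split; lra.
Qed.

Lemma accurate_whp N (delta : R) (i0 x : 'I_d) : 0 < delta < 1 ->
  Epath P N x (fun s => (~~ `[< accurate N.+1 delta (nth i0 (x :: s)) >])%:R) <= delta.
Proof.
move=> delta01; have /andP[delta0 _] := delta01.
have K0 := stochastic_ge0 sto.
have fd := frequencies_deviate_prob sto irr aper stat rev d2 N x delta01.
have [B [BP BQ]] : exists B : seq 'I_d -> bool, Epath P N x (fun s => (B s)%:R) <= delta / 2 /\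
    forall s, size s = N -> ~~ frequencies_deviate P pi N delta x s -> ~~ B s ->
    `|gap_hat R N.+1 (nth i0 (x :: s)) - gap| <= gap_constant R * gap_rate P pi N delta.
  have [small|big] := ltP (gap_constant R * gap_rate P pi N delta) 1.
    exact: (gap_hat_close_whp sto irr aper stat rev d2 i0 x delta01 small).
  exists (fun _ => false); split.
    rewrite (_ : Epath _ _ _ _ = 0); first by rewrite divr_ge0 // ltW.
    exact: Epath0.
  by move=> s _ _ _; exact: le_trans (gap_hat_trivial _ _) big.
have half := lerD fd BP; rewrite -mulrDl -mulr2n -[delta *+ 2]mulr_natr mulfK // in half.
apply: le_trans half; rewrite -EpathD; apply: Epath_le => // s sN.
case: asboolP => [_|nacc] /=; first by rewrite addr_ge0.
case: (boolP (frequencies_deviate _ _ _ _ _ _)) => [_|nf] /=; first by rewrite lerDl.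
case: (boolP (B s)) => [_|nB] /=; first by rewrite lerDr.
case: nacc; split; last exact: (BQ s sN nf nB).
exact: (pistar_hat_close sto irr aper stat rev d2 i0 delta01 sN nf).
Qed.

(** The estimators read only the first n states of the path, so the event is a path
event, and its complement has probability at most delta from every start. *)
Lemma accurate_probability n (disp : measure_display) (Omega : measurableType disp)
    (Pr : probability Omega R) (X : nat -> Omega -> 'I_d) (delta : R)
    (A : (nat -> 'I_d) -> Prop) :
  (1 <= n)%N -> markov_chain n Pr P X -> 0 < delta < 1 ->
  (forall x y, (forall t, (t < n)%N -> x t = y t) -> A x -> A y) ->
  (forall x, accurate n delta x -> A x) ->
  ((1 - delta)%:E <= Pr [set w | A (fun t => X t w)])%E.
Proof.
case: n => // N _ mc delta01 Aext accA.
have i0 : 'I_d by apply: (@Ordinal d 0); rewrite (leq_trans _ d2).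
have [q [q0 q1 qE]] := path_law mc (ltn0Sn N).
pose B (s : seq 'I_d) := `[< A (nth i0 s) >].
have -> : [set w | A (fun t => X t w)] = path_event N.+1 X B.
  apply/seteqP; split => w; rewrite /path_event /=.
    by move=> Aw; apply/asboolP; apply: Aext Aw => t tn; rewrite nth_mkseq.
  by move/asboolP; apply: Aext => t tn; rewrite nth_mkseq.
have [_ ->] := qE B; rewrite lee_fin /=.
have -> : 1 - delta = \sum_i q i * (1 - delta) by rewrite -mulr_suml q1 mul1r.
apply: ler_sum => i _; rewrite ler_wpM2l //.
have K0 := stochastic_ge0 sto.
have bad : Epath P N i (fun s => (~~ B (i :: s))%:R) <= delta.
  apply: le_trans (accurate_whp N i0 i delta01); apply: Epath_le => // s _.
  rewrite /B; case: asboolP => [_|nA] /=; first by case: (~~ _).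
  by case: asboolP => // /accA.
have e : Epath P N i (fun s => (B (i :: s))%:R) +
    Epath P N i (fun s => (~~ B (i :: s))%:R) = 1.
  rewrite -EpathD -[RHS](Epath_cst (stochastic_row_sum sto) N i 1); apply: Epath_ext => s _.
  by case: (B _); rewrite ?addr0 ?add0r.
lra.
Qed.
End Deviation.

Unset Implicit Arguments.
Set Strict Implicit.

Theorem theorem3p3 (R : realType) (b : R) (hb : 1 < b) :
  exists C : R, 1 <= C /\
  forall (d n : nat) (P : 'M[R]_d) (pi : 'rV[R]_d)
    (disp : measure_display) (Omega : measurableType disp)
    (Pr : probability Omega R) (X : nat -> Omega -> 'I_d) (delta : R),
  (2 <= d)%N -> (1 <= n)%N ->
  ergodic P -> stationary P pi -> reversible P pi ->
  markov_chain n Pr P X ->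
  0 < delta < 1 ->
  let pistar := min_entry pi in
  let gap := spectral_gap P in
  let good := [set w | let x := fun t => X t w in
     `|pistar_hat R n x - pistar| <=
       C * (Num.sqrt (pistar * logb b (1 / (pistar * delta)) / (gap * n%:R))
            + logb b (1 / (pistar * delta)) / (gap * n%:R))
     /\
     `|gap_hat R n x - gap| <=
       C * Num.sqrt (logb b (d%:R / delta) * logb b (n%:R / (pistar * delta))
                     / (pistar * gap * n%:R))] in
  ((1 - delta)%:E <= Pr good)%E.
Proof.
have lb : 0 < ln b by rewrite ln_gt0.
pose beta := Num.max 1 (ln b).
have b1 : 1 <= beta by rewrite /beta le_max lexx.
have blb : ln b <= beta by rewrite /beta le_max lexx orbT.
have bsq : Num.sqrt (ln b) <= beta.
  rewrite -[leRHS]ger0_norm ?(le_trans ler01 b1) // -sqrtr_sqr ler_wsqrtr //.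
  by apply: (le_trans blb); rewrite expr2 ler_peMl // (le_trans ler01).
exists (gap_constant R * beta); split.
  by rewrite -[leLHS]mulr1; apply: ler_pM => //; exact: gap_constant_ge1.
move=> d n P pi disp Omega Pr X delta d2 n1 [sto irr aper] stat rev mc delta01.
set pistar := min_entry pi; set gap := spectral_gap P; cbv zeta.
pose A (x : nat -> 'I_d) := `|pistar_hat R n x - pistar| <= gap_constant R * beta *
    (Num.sqrt (pistar * logb b (1 / (pistar * delta)) / (gap * n%:R))
     + logb b (1 / (pistar * delta)) / (gap * n%:R)) /\
  `|gap_hat R n x - gap| <= gap_constant R * beta *
    Num.sqrt (logb b (d%:R / delta) * logb b (n%:R / (pistar * delta))
              / (pistar * gap * n%:R)).
apply: (accurate_probability sto irr aper stat rev d2 (A := A) n1 mc delta01).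
  move=> x y xy; rewrite /A.
  by rewrite /pistar_hat (gap_hat_ext R xy) (pihat_ext R xy).
move=> x [hp hg].
have pistar0 : 0 < pistar := stationary_min_gt0 sto irr stat d2.
have /andP[gap0 _] : 0 < gap <= 1 := gap_itv sto irr aper stat rev d2.
have nR : (0 : R) < n%:R by rewrite ltr0n.
have lnE y : ln y = ln b * logb b y by rewrite /logb mulrC divfK // gt_eqF.
have gn0 : 0 < gap * n%:R by rewrite mulr_gt0.
have state0 := log_state_ge sto irr stat d2 delta01.
split.
- apply: (le_trans hp).
  rewrite -!/pistar -!/gap.
  have -> : log_state pi delta / (gap * n%:R) = ln b * (logb b (1 / (pistar * delta)) / (gap * n%:R)).
    by rewrite /log_state lnE mulrA.
  set k := logb b _ / _.
  have k0 : 0 <= k.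
    rewrite divr_ge0 ?(ltW gn0) // /logb divr_ge0 ?(ltW lb) //.
    by apply: le_trans state0; rewrite invr_ge0.
  have -> : pistar * (ln b * k) = ln b * (pistar * k) by ring.
  have -> : pistar * logb b (1 / (pistar * delta)) / (gap * n%:R) = pistar * k.
    by rewrite /k mulrA.
  rewrite sqrtrM ?(ltW lb) //.
  have h1 := ler_wpM2r (sqrtr_ge0 (pistar * k)) bsq.
  have h2 := ler_wpM2r k0 blb.
  set S := Num.sqrt (pistar * k) in h1 *.
  have : 128 ^+ 2 * (Num.sqrt (ln b) * S + ln b * k) <= gap_constant R * (beta * S + beta * k).
    apply: ler_pM.
    + exact: sqr_ge0.
    + by rewrite addr_ge0 // mulr_ge0 ?sqrtr_ge0 // ltW.
    + exact: gap_constant_ge.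
    + exact: lerD.
  lra.
- apply: (le_trans hg).
  rewrite -!/pistar -!/gap -[leRHS]mulrA ler_wpM2l //; first exact: le_trans ler01 (gap_constant_ge1 R).
  have -> : log_dim d delta * log_time pi n.-1 delta / (pistar * gap * n%:R) =
     ln b ^+ 2 * (logb b (d%:R / delta) * logb b (n%:R / (pistar * delta)) / (pistar * gap * n%:R)).
    by rewrite /log_dim /log_time prednK // (lnE (d%:R / delta)) (lnE (n%:R / (pistar * delta))); ring.
  rewrite sqrtrM ?sqr_ge0 // sqrtr_sqr ger0_norm ?(ltW lb) //.
  by rewrite ler_wpM2r // sqrtr_ge0.
Qed.
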